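(* Let $S=\{z\in\mathbb{C}: a<\operatorname{Im} z<b\}$ with $-\infty\le a<b\le+\infty$, let $m\ge 1$ be an integer, and let $a_k\in AP(S)$ for $0\le k\le m$. Let $w(z)$ be a continuous solution in $S$ of the equation $$a_m(z)w^m+a_{m-1}(z)w^{m-1}+\dots+a_1(z)w+a_0(z)=0,$$ that is, $w:S\to\mathbb{C}$ is continuous and satisfies this equation with $w=w(z)$ for all $z\in S$. Then $w\in AP(S)$.
   Context: For a strip $S=\{z\in\mathbb{C}: a<\operatorname{Im} z<b\}$ ($a$ may be $-\infty$ and $b$ may be $+\infty$), write $S'\subset\subset S$ if $S'=\{z\in\mathbb{C}: a'<\operatorname{Im} z<b'\}$ with $a<a'<b'<b$. A function $f$ on $S$ is called analytic almost periodic on $S$ if it belongs to the closure of the set of finite exponential sums $\sum a_n e^{i\lambda_n z}$, $a_n\in\mathbb{C}$, $\lambda_n\in\mathbb{R}$, with respect to the topology of uniform convergence on every substrip $S'\subset\subset S$. Equivalently, the family $\{f(z+h)\}_{h\in\mathbb{R}}$ of real translates of the analytic function $f$ is relatively compact with respect to the topology of uniform convergence on every substrip $S'\subset\subset S$. $AP(S)$ denotes the space of all analytic almost periodic functions on $S$, equipped with the topology of uniform convergence on every substrip $S'\subset\subset S$.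
   Formalization: The equation is assumed nontrivial: at least one coefficient a_k does not vanish identically on S. If all a_k are identically 0, every continuous w (e.g. w(z) = Re z) is a solution and the claim fails. *)

(* Defs.v *)
From HB Require Import structures.
From mathcomp Require Import all_boot all_order all_algebra.
From mathcomp Require Import all_classical all_reals all_analysis.
From mathcomp.real_closed Require Import complex.

Set Implicit Arguments.
Unset Strict Implicit.
Unset Printing Implicit Defensive.

Import Order.TTheory GRing.Theory Num.Theory.
Import numFieldNormedType.Exports.

Local Open Scope classical_set_scope.
Local Open Scope ring_scope.
Local Open Scope complex_scope.

(* The normed module (hence uniform and topological) structure induced by the
   norm |z|, which the library only declares on the alias R[i]^o. *)
#[warning="-redundant-canonical-projection"]
HB.instance Definition _ (R : realType) := NormedModule.copy R[i] R[i]^o.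

(* e^(x + iy) = e^x (cos y + i sin y) *)
Definition cexp (R : realType) (z : R[i]) : R[i] :=
  (expR (complex.Re z))%:C * (cos (complex.Im z) +i* sin (complex.Im z)).

Definition strip (R : realType) (a b : \bar R) : set R[i] :=
  [set z | (a < (complex.Im z)%:E)%E /\ ((complex.Im z)%:E < b)%E].

(* The sets S' with S' ⊂⊂ strip a b.  The strict inequalities a < a' < b' < b
   force a' and b' to be finite even when a = -oo or b = +oo. *)
Definition substrips (R : realType) (a b : \bar R) : set (set R[i]) :=
  [set S' | exists a' b' : R,
     [/\ (a < a'%:E)%E, a' < b', (b'%:E < b)%E & S' = strip a'%:E b'%:E]].

Definition exp_sums (R : realType) : set (R[i] -> R[i]) :=
  [set f | exists (n : nat) (c : 'I_n -> R[i]) (lambda : 'I_n -> R),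
     f = fun z : R[i] => \sum_(k < n) c k * cexp ('i%C * (lambda k)%:C * z)].

(* A function on the strip is represented by a total function R[i] -> R[i].
   All substrips lie inside the strip, so the topology of uniform convergence
   on them, and hence membership in AP, ignores the values outside. *)
Definition AP (R : realType) (a b : \bar R) : set (R[i] -> R[i]) :=
  closure (@exp_sums R : set {family substrips a b, R[i] -> R[i]}).

(* Main.v *)
Require Import Defs.
From mathcomp Require Import all_boot all_order all_fingroup all_algebra.
From mathcomp Require Import all_classical all_reals all_analysis.
From mathcomp.real_closed Require Import complex.
From mathcomp Require Import ring lra zify.

(** The proof is elementary: it uses neither integration nor the general theory of
    holomorphic functions.  A function is called holomorphic at a point when it is
    a uniform limit of polynomials on some disc around it ([holo]).

    Function theory.  Averages over roots of unity give polynomials the mean value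
    property, hence the maximum principle ([max_modulus]), which needs holomorphy
    only where the function does not vanish.  It gives Schwarz's lemma and Taylor
    expansions with bounds depending only on radius and supremum ([schwarz],
    [taylor]), and therefore a quantitative unique continuation, uniform along a
    strip ([small_propagates]).

    Almost periodic functions.  For an exponential sum, and so for a limit [f] of
    such sums, the translations that almost fix [f] on a band contain a Bohr set
    ([ap_bohr]), and Bohr sets are syndetic ([bohr_cover]).  So if [f] does not
    vanish identically, it is bounded below somewhere in every disc of given
    radius in a band ([ap_lower_bound]), its zeros are isolated, and around every
    point there is a circle of controlled radius on which [f] is bounded below
    ([exists_circle_lower]).  Conversely, a bounded holomorphic function that is
    almost fixed by the translations of a Bohr set is almost periodic
    ([bohr_approximation]): average its translates against a kernel concentrated
    on the Bohr set, with the help of an invariant mean.  The average is an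
    exponential sum, because the mean of a holomorphic function along a horizontal
    line does not depend on the line ([mean_strip_cst]).  In the coordinate
    [log z] the same theorem produces Laurent expansions in a punctured disc,
    hence the theorem on removable singularities ([removable]).

    The root.  Take an equation of minimal degree for [w], and let [Q] be the
    derivative of its polynomial at [w].  By minimality [Q] is not identically
    zero; it is algebraic over the almost periodic functions, and the lowest
    nonzero coefficient [f] of an equation for it is bounded by a multiple of
    [|Q|] on every band ([simplicity_certificate]; as [w] is only known to be
    continuous, cancelling powers of [Q] requires the connectedness argument
    [glue]).  Hence [w] is a simple root off the isolated zeros of [f], where it
    is holomorphic by Newton's iteration, and the remaining singularities are
    removable ([root_holo]).  The product of [w] with the leading coefficient is
    integral, hence bounded on bands, and so is [w], by the maximum principle on
    the circles found above ([quotient_bounded]).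

    Almost periods of the root.  Let [t] belong to a small Bohr set of the
    coefficients.  Then [w (z + t)] almost solves the equation at [z], so
    [w (z + t) - w z] is either tiny or not small where [f] is bounded below, and
    if it is small on one box of a band, it is tiny on the whole band
    ([translate_gap], [translate_spread]).  By the pigeonhole principle two of the
    translates by [0, t, ..., N t] are close on a box, so some [k t] with
    [1 <= k <= N], and with it [N! t], almost fixes [w] on the band
    ([root_bohr]).  These translations form a Bohr set, with frequencies divided
    by [N!], and [bohr_approximation] concludes. *)

Set Implicit Arguments.
Unset Strict Implicit.
Unset Printing Implicit Defensive.

Import Order.TTheory GRing.Theory Num.Theory.
Import numFieldNormedType.Exports.

Local Open Scope classical_set_scope.
Local Open Scope ring_scope.
Local Open Scope complex_scope.

(** * The real-valued modulus *)

(** The norm on [R[i]] takes its values in [R[i]], whose order is only partial;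
    with a modulus in [R] all estimates live in a real field. *)
Definition cabs (R : realType) (z : R[i]) : R := Normc.normc z.
Arguments cabs : simpl never.

Lemma le_eps (R : realType) (x y : R) :
  (forall e : R, 0 < e -> x <= y + e) -> x <= y.
Proof. by move=> h; apply/ler_addgt0Pr. Qed.

Section Modulus.
Variable R : realType.
Implicit Types (x y z : R[i]) (r : R).

Lemma cabsE z : `|z| = (cabs z)%:C.
Proof. by case: z => a b; rewrite normc_def. Qed.

Lemma cabs_ge0 z : 0 <= cabs z.
Proof. by case: z => a b; rewrite /cabs /= sqrtr_ge0. Qed.

Lemma cabs0 : cabs (0 : R[i]) = 0.
Proof. exact: Normc.normc0. Qed.

Lemma cabs1 : cabs (1 : R[i]) = 1.
Proof. exact: Normc.normc1. Qed.

Lemma cabs_eq0 z : cabs z = 0 -> z = 0.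
Proof. exact: Normc.eq0_normc. Qed.

Lemma cabs_gt0 z : (0 < cabs z) = (z != 0).
Proof.
rewrite lt0r cabs_ge0 andbT; apply/idP/idP; last first.
  by apply: contra => /eqP /cabs_eq0 ->.
by apply: contra => /eqP ->; rewrite cabs0.
Qed.

Lemma cabsM x y : cabs (x * y) = cabs x * cabs y.
Proof. exact: Normc.normcM. Qed.

Lemma cabsV x : cabs x^-1 = (cabs x)^-1.
Proof. exact: Normc.normcV. Qed.

Lemma cabsN x : cabs (- x) = cabs x.
Proof. exact: normcN. Qed.

Lemma cabsX x n : cabs (x ^+ n) = cabs x ^+ n.
Proof. by elim: n => [|n IH]; rewrite ?expr0 ?cabs1 // !exprS cabsM IH. Qed.

Lemma cabsD x y : cabs (x + y) <= cabs x + cabs y.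
Proof. exact: le_normcD. Qed.

Lemma cabsB x y : cabs (x - y) <= cabs x + cabs y.
Proof. by rewrite -(cabsN y); exact: cabsD. Qed.

Lemma cabsBC x y : cabs (x - y) = cabs (y - x).
Proof. by rewrite -cabsN opprB. Qed.

Lemma cabs_trans y x z : cabs (x - z) <= cabs (x - y) + cabs (y - z).
Proof. by have := cabsD (x - y) (y - z); rewrite addrA subrK. Qed.

Lemma cabs_sub x y : cabs x <= cabs y + cabs (x - y).
Proof. by rewrite -{1}(subrK y x) addrC; exact: cabsD. Qed.

Lemma cabsC r : cabs r%:C = `|r|.
Proof. by rewrite /cabs /= expr0n addr0 sqrtr_sqr. Qed.

Lemma cabs_nat n : cabs (n%:R : R[i]) = n%:R.
Proof. by rewrite -(rmorph_nat (real_complex R)) cabsC normr_nat. Qed.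

Lemma cabs_i : cabs ('i%C : R[i]) = 1.
Proof. by rewrite /cabs /= expr0n add0r expr1n sqrtr1. Qed.

Lemma cabs_sum (I : Type) (s : seq I) (P : pred I) (F : I -> R[i]) :
  cabs (\sum_(i <- s | P i) F i) <= \sum_(i <- s | P i) cabs (F i).
Proof.
elim/big_rec2: _ => [|i y x _ le_xy]; first by rewrite cabs0.
by apply: le_trans (cabsD _ _) _; rewrite lerD2l.
Qed.

Lemma Re_le_cabs z : `|complex.Re z| <= cabs z.
Proof.
case: z => a b; rewrite /cabs /= -sqrtr_sqr ler_sqrt ?addr_ge0 ?sqr_ge0 //.
by rewrite lerDl sqr_ge0.
Qed.

Lemma Im_le_cabs z : `|complex.Im z| <= cabs z.
Proof.
case: z => a b; rewrite /cabs /= -sqrtr_sqr ler_sqrt ?addr_ge0 ?sqr_ge0 //.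
by rewrite lerDr sqr_ge0.
Qed.

Lemma cabs_le_ReIm z : cabs z <= `|complex.Re z| + `|complex.Im z|.
Proof.
rewrite {1}(complexE z) (le_trans (cabsD _ _)) // cabsM cabs_i mul1r !cabsC.
exact: lexx.
Qed.

Lemma cabs_sqr z : cabs z ^+ 2 = complex.Re z ^+ 2 + complex.Im z ^+ 2.
Proof.
by case: z => a b; rewrite /cabs /= sqr_sqrtr // addr_ge0 ?sqr_ge0.
Qed.

Lemma cabs_le0 z : (forall e, 0 < e -> cabs z <= e) -> z = 0.
Proof.
move=> h; apply: cabs_eq0; apply/eqP; rewrite eq_le cabs_ge0 andbT.
by apply/le_eps => e e0; rewrite add0r; exact: h.
Qed.

Lemma ReD x y : complex.Re (x + y) = complex.Re x + complex.Re y.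
Proof. by case: x; case: y. Qed.

Lemma ImD x y : complex.Im (x + y) = complex.Im x + complex.Im y.
Proof. by case: x; case: y. Qed.

Lemma ReB x y : complex.Re (x - y) = complex.Re x - complex.Re y.
Proof. by case: x; case: y. Qed.

Lemma ImB x y : complex.Im (x - y) = complex.Im x - complex.Im y.
Proof. by case: x; case: y. Qed.

End Modulus.

(** * Limits along an ultrafilter *)

Lemma nonprincipal_ultrafilter :
  exists U : set_system nat, UltraFilter U /\ \oo `<=` U.
Proof. exact: ultraFilterLemma. Qed.

(** A fixed nonprincipal ultrafilter: along it every bounded sequence has a
    limit, and this single linear functional serves as compactness, as
    completeness and, below, as an invariant mean. *)
Definition ultra : set_system nat := sval (cid nonprincipal_ultrafilter).

#[global] Instance ultra_ultra : UltraFilter ultra.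
Proof. exact: (svalP (cid nonprincipal_ultrafilter)).1. Qed.

Lemma ultra_ge n : ultra [set k | (n <= k)%N].
Proof.
apply: (svalP (cid nonprincipal_ultrafilter)).2.
by exists n => // k /=.
Qed.

Definition is_ulim (R : realType) (u : nat -> R[i]) (l : R[i]) :=
  forall e : R, 0 < e -> ultra [set n | cabs (u n - l) < e].

Section Ulim.
Variable R : realType.
Implicit Types (u v : nat -> R[i]) (l m : R[i]) (x : R).

Lemma bounded_real_ulim (u : nat -> R) (M : R) : (forall n, `|u n| <= M) ->
  exists x, forall e, 0 < e -> ultra [set n | `|u n - x| < e].
Proof.
move=> uM.
have [x [_ xu]] : exists x, [set` `[- M, M]] x /\ cluster (u @ ultra) x.
  have c := @segment_compact R (- M) M.
  have FA : (u @ ultra) [set` `[- M, M]].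
    apply: (@filterE _ ultra) => n /=.
    by rewrite in_itv /= -ler_norml; exact: uM.
  have [] := c (u @ ultra) _ FA.
  by move=> x [x1 x2]; exists x.
exists x => e e0.
have [//|uC] := in_ultra_setVsetC [set n | `|u n - x| < e] ultra_ultra.
have [y [/= yu yx]] := xu (~` [set y | `|y - x| < e]) (ball x e) uC (nbhsx_ballx x e e0).
by case: yu; move: yx; rewrite -ball_normE /= distrC.
Qed.

Lemma bounded_ulim u (M : R) : (forall n, cabs (u n) <= M) -> exists l, is_ulim u l.
Proof.
move=> uM.
have [n|x xu] := @bounded_real_ulim (fun n => complex.Re (u n)) M.
  exact: le_trans (Re_le_cabs _) (uM n).
have [n|y yu] := @bounded_real_ulim (fun n => complex.Im (u n)) M.
  exact: le_trans (Im_le_cabs _) (uM n).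
exists (x +i* y) => e e0.
have e2 : 0 < e / 2 by rewrite divr_gt0.
apply: filterS (filterI (xu _ e2) (yu _ e2)) => n /= [h1 h2].
apply: le_lt_trans (cabs_le_ReIm _) _; rewrite ReB ImB /=; lra.
Qed.

Lemma ulim_ex u l n (e : R) (A : set nat) : is_ulim u l -> ultra A -> 0 < e ->
  exists k, [/\ (n <= k)%N, A k & cabs (u k - l) < e].
Proof.
move=> ul uA e0.
have [k [[? ?] ?]] := filter_ex (filterI (filterI (ultra_ge n) uA) (ul e e0)).
by exists k.
Qed.

Lemma ulim_const l : is_ulim (fun=> l) l.
Proof. by move=> e e0; apply: filterE => n /=; rewrite subrr cabs0. Qed.

Lemma ulimD u v l m : is_ulim u l -> is_ulim v m ->
  is_ulim (fun n => u n + v n) (l + m).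
Proof.
move=> ul vm e e0; have e2 : 0 < e / 2 by rewrite divr_gt0.
apply: filterS (filterI (ul _ e2) (vm _ e2)) => n /= [h1 h2].
rewrite opprD addrACA; apply: le_lt_trans (cabsD _ _) _; lra.
Qed.

Lemma ulimZ (c : R[i]) u l : is_ulim u l -> is_ulim (fun n => c * u n) (c * l).
Proof.
move=> ul e e0; have c0 := cabs_ge0 c.
have h : 0 < e / (cabs c + 1) by rewrite divr_gt0 //; lra.
apply: filterS (ul _ h) => n /=; rewrite -mulrBr cabsM.
rewrite ltr_pdivlMr; last lra.
by move=> h1; apply: le_lt_trans h1; rewrite mulrDr mulr1 mulrC lerDl cabs_ge0.
Qed.

Lemma ulim_dom u v l m : is_ulim u l -> is_ulim v m ->
  (forall n, cabs (u n) <= complex.Re (v n)) -> cabs l <= complex.Re m.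
Proof.
move=> ul vm uv; apply/le_eps => e e0; have e2 : 0 < e / 2 by rewrite divr_gt0.
have [n [/= h1 h2]] := filter_ex (filterI (ul _ e2) (vm _ e2)).
have := uv n; have := cabs_sub l (u n); rewrite (cabsBC l).
have := Re_le_cabs (v n - m); rewrite ReB ler_norml => /andP[]; lra.
Qed.

Lemma ulim_le u l x : is_ulim u l -> (forall n, cabs (u n) <= x) -> cabs l <= x.
Proof.
move=> ul ux; apply: (@ulim_dom u (fun=> x%:C) l x%:C) => //; exact: ulim_const.
Qed.

(** Two sequences that get close have the same limit even if neither converges in
    the usual sense. *)
Lemma ulim_null u v l m : is_ulim u l -> is_ulim v m ->
  (forall e, 0 < e -> exists n0, forall n, (n0 <= n)%N -> cabs (u n - v n) <= e) ->
  l = m.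
Proof.
move=> ul vm uv; apply/eqP; rewrite -subr_eq0; apply/eqP/cabs_le0 => e e0.
have e3 : 0 < e / 3 by rewrite divr_gt0.
have [n0 h] := uv _ e3.
have [n [h1 h2 h3]] := ulim_ex n0 ul (vm _ e3) e3.
have := h n h1; move: h2 h3 => /=.
have := cabs_trans (u n) l m; have := cabs_trans (v n) (u n) m.
rewrite (cabsBC l (u n)); lra.
Qed.

Lemma ulim_uniq u l m : is_ulim u l -> is_ulim u m -> l = m.
Proof.
move=> ul um; apply: (ulim_null ul um) => e e0; exists 0%N => n _.
by rewrite subrr cabs0 ltW.
Qed.

End Ulim.

(** An atom for the null sequence [1 / (n + 1)]. *)
Definition inv_succ (R : realType) (n : nat) : R := n.+1%:R^-1.

Section RealHelpers.
Variable R : realType.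
Implicit Types x q e : R.

Lemma nat_ub x : exists n : nat, x <= n%:R.
Proof.
exists (Num.bound `|x|); apply: le_trans (ler_norm _) _.
by rewrite ltW // archi_boundP.
Qed.

Lemma geom_small q e : 0 <= q < 1 -> 0 < e -> exists n : nat, q ^+ n < e.
Proof.
move=> /andP[q0 q1] e0.
have /cvgrPdist_lt /(_ _ e0) [n _ /(_ n (leqnn n))] :=
  @cvg_expr R q ltac:(rewrite ger0_norm; lra).
by rewrite sub0r normrN /= ger0_norm ?exprn_ge0 //; exists n.
Qed.

Lemma inv_succ_gt0 n : 0 < inv_succ R n.
Proof. by rewrite invr_gt0. Qed.

Lemma inv_succ_le1 n : inv_succ R n <= 1.
Proof. by rewrite /inv_succ invf_le1 ?ler1n ?ltr0n. Qed.

Lemma inv_succ_small e : 0 < e -> exists n0, forall k, (n0 <= k)%N -> inv_succ R k < e.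
Proof.
move=> e0; have [n hn] := nat_ub e^-1; exists n => k nk.
rewrite -[e]invrK /inv_succ ltf_pV2 ?posrE ?invr_gt0 // (le_lt_trans hn) // ltr_nat.
by rewrite ltnS.
Qed.

End RealHelpers.

(** * The complex exponential *)

Section ComplexExponential.
Variable R : realType.
Implicit Types (x y t : R) (z h : R[i]).

Lemma sin_le_norm t : `|sin t| <= `|t|.
Proof.
wlog t0 : t / 0 < t => [hwlog|].
  have [t0|t0|->] := ltgtP t 0.
  - by have := hwlog (- t); rewrite sinN !normrN oppr_gt0; apply.
  - exact: hwlog.
  - by rewrite sin0.
have [|c _] := @MVT_segment R sin cos 0 t (ltW t0).
  by apply: continuous_subspaceT => c; exact: continuous_sin.
rewrite sin0 !subr0 => ->; rewrite normrM ler_piMl //; exact: cos_max.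
Qed.

Lemma cosE_sin_half t : cos t = 1 - 2 * sin (t / 2) ^+ 2.
Proof.
have -> : cos t = cos ((t / 2) *+ 2) by congr cos; rewrite -mulr_natr; field.
rewrite cos_mulr2n cos2sin2 -mulr_natr; ring.
Qed.

Lemma cos_sub1_le t : `|cos t - 1| <= t ^+ 2 / 2.
Proof.
rewrite cosE_sin_half (_ : _ - 1 = - (2 * sin (t / 2) ^+ 2)); last ring.
rewrite normrN normrM normrX (@ger0_norm _ 2) //.
have := sin_le_norm (t / 2); have := normr_ge0 (sin (t / 2)).
rewrite normrM (@ger0_norm _ 2^-1) ?invr_ge0 // => h0 h.
rewrite -[t ^+ 2](real_normK (num_real t)); nra.
Qed.

Lemma sin_sub_le t : `|t| <= 1 -> `|sin t - t| <= t ^+ 2.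
Proof.
wlog t0 : t / 0 < t => [hwlog|].
  have [t0|t0|->] := ltgtP t 0.
  - by have := hwlog (- t); rewrite sinN -opprD !normrN sqrrN oppr_gt0; apply.
  - exact: hwlog.
  - by rewrite sin0 subrr normr0 expr0n.
rewrite gtr0_norm // => t1.
have [|c /itvP c0t] := @MVT_segment R (fun t => sin t - t) (fun t => cos t - 1) 0 t (ltW t0).
  apply: continuous_subspaceT => c; apply: cvgB; last exact: cvg_id.
  exact: continuous_sin.
rewrite sin0 !subr0 => ->; rewrite normrM (gtr0_norm t0).
have := cos_sub1_le c; have := normr_ge0 (cos c - 1).
have c0 : 0 <= c by rewrite c0t.
have ct : c <= t by rewrite c0t.
move=> ? ?; have ? : c ^+ 2 <= t ^+ 2 by rewrite ler_sqr ?nnegrE //; lra.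
have ? : t ^+ 2 <= 1 by nra.
rewrite expr2; apply: ler_wpM2r; first exact: ltW.
apply: le_trans (_ : t ^+ 2 / 2 <= _); nra.
Qed.

Lemma expR_sub1_le t : `|t| <= 1 / 2 -> `|expR t - 1 - t| <= 2 * t ^+ 2.
Proof.
rewrite ler_norml => /andP[h1 h2].
have g1 := expR_ge1Dx t; have g2 := expR_ge1Dx (- t).
have e0 := expR_gt0 t; have e1 : expR t * expR (- t) = 1 by exact: expRxMexpNx_1.
have g3 : expR t * (1 - t) <= expR t * expR (- t) by rewrite ler_pM2l.
rewrite e1 in g3.
have g4 : expR t <= 2 by nra.
rewrite ger0_norm; last lra.
have -> : expR t - 1 - t = (expR t * (1 - t) - 1) + expR t * t - t by ring.
nra.
Qed.

Lemma cexpD z h : cexp (z + h) = cexp z * cexp h.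
Proof.
case: z h => [a b] [c d]; rewrite /cexp /= expRD rmorphM /=.
rewrite mulrACA; congr (_ * _); rewrite cosD sinD.
by apply/eqP; rewrite eq_complex /=; apply/andP; split; apply/eqP; ring.
Qed.

Lemma cexp0 : cexp (0 : R[i]) = 1.
Proof. by rewrite /cexp /= expR0 cos0 sin0 mul1r. Qed.

Lemma cexpMn z n : cexp (n%:R * z) = cexp z ^+ n.
Proof.
elim: n => [|n IH]; first by rewrite mul0r cexp0 expr0.
by rewrite exprS -IH -cexpD mulrSr mulrDl mul1r addrC.
Qed.

Lemma cabs_cexp z : cabs (cexp z) = expR (complex.Re z).
Proof.
case: z => a b; rewrite /cexp cabsM cabsC gtr0_norm ?expR_gt0 //=.
by rewrite /cabs /= cos2Dsin2 sqrtr1 mulr1.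
Qed.

(** Second order estimate at the origin; the constant is generous. *)
Lemma cexp_sub1_le h : cabs h <= 1 / 2 -> cabs (cexp h - 1 - h) <= 10 * cabs h ^+ 2.
Proof.
move=> h2; rewrite cabs_sqr; move: (Re_le_cabs h) (Im_le_cabs h).
case: h h2 => x y /= h2 hx hy.
have {}hx : `|x| <= 1 / 2 by exact: le_trans h2.
have {}hy : `|y| <= 1 / 2 by exact: le_trans h2.
apply: le_trans (cabs_le_ReIm _) _ => /=.
have := expR_sub1_le hx; have := cos_sub1_le y.
have := @sin_sub_le y ltac:(lra); have e0 := expR_gt0 x.
rewrite !mul0r !addr0 !subr0.
have -> : expR x * cos y - 1 - x = (expR x - 1 - x) + expR x * (cos y - 1) by ring.
have -> : expR x * sin y - y =
  expR x * (sin y - y) + (expR x - 1 - x) * y + x * y by ring.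
move=> hs hc he.
have ex : expR x <= 2.
  have := expR_sub1_le hx; rewrite ler_norml => /andP[_].
  by move: hx; rewrite ler_norml => /andP[]; nra.
have xy : `|x * y| <= (x ^+ 2 + y ^+ 2) / 2.
  rewrite normrM -[x ^+ 2](real_normK (num_real x)) -[y ^+ 2](real_normK (num_real y)).
  by have := sqr_ge0 (`|x| - `|y|); nra.
have h1 : `|expR x * (cos y - 1)| <= y ^+ 2.
  by rewrite normrM (gtr0_norm e0); have := normr_ge0 (cos y - 1); nra.
have h3 : `|expR x * (sin y - y)| <= 2 * y ^+ 2.
  by rewrite normrM (gtr0_norm e0); have := normr_ge0 (sin y - y); nra.
have h4 : `|(expR x - 1 - x) * y| <= x ^+ 2.
  rewrite normrM; have := normr_ge0 (expR x - 1 - x); have := normr_ge0 y; nra.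
have := ler_normD (expR x - 1 - x) (expR x * (cos y - 1)).
have := ler_normD (expR x * (sin y - y) + (expR x - 1 - x) * y) (x * y).
have := ler_normD (expR x * (sin y - y)) ((expR x - 1 - x) * y).
have := sqr_ge0 x; have := sqr_ge0 y; rewrite ?mul0r ?addr0; lra.
Qed.

(** Averaging a polynomial over the powers of a primitive root of unity extracts
    its constant coefficient; all that is needed of the root are these sums. *)
Lemma root_of_unity n : (0 < n)%N -> exists w : R[i],
  cabs w = 1 /\ forall j, (0 < j < n)%N -> \sum_(k < n) (w ^+ j) ^+ k = 0.
Proof.
move=> n0; pose t : R := 2 * pi / n%:R; exists (cexp (0 +i* t)).
have n0R : 0 < n%:R :> R by rewrite ltr0n.
split=> [|j /andP[j0 jn]]; first by rewrite cabs_cexp expR0.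
have pow m : cexp (0 +i* t) ^+ m = cos (m%:R * t) +i* sin (m%:R * t).
  rewrite -cexpMn -(rmorph_nat (real_complex R)) /cexp /=.
  by rewrite !mul0r mulr0 subrr addr0 expR0 mul1r.
have w1 : cexp (0 +i* t) ^+ j != 1.
  rewrite pow eq_complex negb_and /= cosE_sin_half; apply/orP; left.
  suff : 0 < sin (j%:R * t / 2) by move=> s0; apply/eqP; nra.
  have -> : j%:R * t / 2 = pi * (j%:R / n%:R) by rewrite /t; field; rewrite gt_eqF.
  apply: sin_gt0_pi; rewrite mulr_gt0 ?pi_gt0 ?divr_gt0 ?ltr0n //=.
  by rewrite gtr_pMr ?pi_gt0 // ltr_pdivrMr // mul1r ltr_nat.
apply: (mulfI (_ : cexp (0 +i* t) ^+ j - 1 != 0)); first by rewrite subr_eq0.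
rewrite mulr0 -subrX1 -exprM mulnC exprM [_ ^+ n]pow.
have -> : n%:R * t = pi *+ 2 by rewrite /t -mulr_natr; field; rewrite gt_eqF.
by rewrite cos2pi sin2pi expr1n subrr.
Qed.

End ComplexExponential.

(** * Compactness of closed discs *)

(** Continuity within a set, with the real-valued modulus. *)
Definition cont_at (R : realType) (D : set R[i]) (f : R[i] -> R[i]) (z : R[i]) :=
  forall e : R, 0 < e -> exists2 d : R, 0 < d &
    forall y, D y -> cabs (y - z) < d -> cabs (f y - f z) < e.

Definition disc (R : realType) (c : R[i]) (r : R) : set R[i] :=
  [set z | cabs (z - c) <= r].

Section Compactness.
Variable R : realType.
Implicit Types (c z y h : R[i]) (r e d : R) (f : R[i] -> R[i]).

Lemma disc_ulim c r (u : nat -> R[i]) : (forall n, disc c r (u n)) ->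
  exists2 z, disc c r z & is_ulim u z.
Proof.
move=> uD.
have [|z zu] := @bounded_ulim R u (cabs c + r).
  move=> n; have := cabs_sub (u n) c; have := uD n; rewrite /disc /=; lra.
exists z => //; rewrite /disc /=.
apply: (ulim_le (ulimD zu (ulim_const (- c)))) => n; exact: uD.
Qed.

(** Points where [u] comes close to its supremum have a limit along the
    ultrafilter, and continuity makes it a maximum. *)
Lemma disc_max c r (u : R[i] -> R) : 0 <= r ->
  (forall z, disc c r z -> forall e : R, 0 < e -> exists2 d : R, 0 < d &
     forall y, disc c r y -> cabs (y - z) < d -> `|u y - u z| < e) ->
  exists2 z, disc c r z & forall y, disc c r y -> u y <= u z.
Proof.
move=> r0 uc.
have cc : disc c r c by rewrite /disc /= subrr cabs0.
have [M uM] : exists M, forall y, disc c r y -> u y <= M.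
  apply: contrapT => noM.
  have h n : exists y, disc c r y /\ n%:R < u y.
    apply: contrapT => hn; apply: noM; exists n%:R => y yD.
    by rewrite leNgt; apply/negP => yn; apply: hn; exists y.
  have [v vP] := choice h.
  have [z zD zv] := disc_ulim (fun n => (vP n).1).
  have [d d0 hd] := uc z zD 1 ltr01.
  have [n0 hn0] := nat_ub (u z + 1).
  have [k [nk _ kd]] := ulim_ex n0 zv (@filterT _ ultra _) d0.
  have := hd _ (vP k).1 kd; rewrite ltr_norml => /andP[_ h1].
  have := (vP k).2; have : n0%:R <= k%:R :> R by rewrite ler_nat.
  lra.
pose A := [set u y | y in disc c r].
have supA : has_sup A.
  by split; [exists (u c), c | exists M => _ [y yD <-]; exact: uM].
have h n : exists y, disc c r y /\ sup A - inv_succ R n < u y.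
  have n0 := inv_succ_gt0 R n.
  by have [_ [y yD <-] hy] := sup_adherent n0 supA; exists y.
have [v vP] := choice h.
have [z zD zv] := disc_ulim (fun n => (vP n).1).
exists z => // y yD.
have /le_trans : u y <= sup A by apply: sup_ubound; [exact: supA.2 | exists y].
apply; apply/le_eps => e e0; have e2 : 0 < e / 2 by rewrite divr_gt0.
have [d d0 hd] := uc z zD _ e2.
have [n0 hn0] := inv_succ_small e2.
have [k [nk _ kd]] := ulim_ex n0 zv (@filterT _ ultra _) d0.
have := hd _ (vP k).1 kd; rewrite ltr_norml => /andP[_ h1].
have := (vP k).2; have := hn0 k nk; lra.
Qed.

(** Heine-Cantor. *)
Lemma disc_uniform_cont c r f : (forall z, disc c r z -> cont_at (disc c r) f z) ->
  forall e : R, 0 < e -> exists2 d : R, 0 < d & forall x y, disc c r x -> disc c r y ->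
    cabs (x - y) < d -> cabs (f x - f y) < e.
Proof.
move=> fc e e0; apply: contrapT => nod.
have h n : exists p : R[i] * R[i], [/\ disc c r p.1, disc c r p.2,
    cabs (p.1 - p.2) < inv_succ R n & e <= cabs (f p.1 - f p.2)].
  apply: contrapT => hn; apply: nod; exists (inv_succ R n); first exact: inv_succ_gt0.
  move=> x y xD yD xy; rewrite ltNge; apply/negP => h; apply: hn.
  by exists (x, y).
have [v vP] := choice h.
have [n|z zD zv] := @disc_ulim c r (fun n => (v n).1); first by have [] := vP n.
have e2 : 0 < e / 2 by rewrite divr_gt0.
have [d d0 hd] := fc z zD _ e2; have d2 : 0 < d / 2 by rewrite divr_gt0.
have [n0 hn0] := inv_succ_small d2.
have [k [nk _ kd]] := ulim_ex n0 zv (@filterT _ ultra _) d2.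
have [h1 h2 h3 h4] := vP k; have h5 := hn0 k nk.
have k1 : cabs (f (v k).1 - f z) < e / 2 by apply: hd => //; lra.
have k2 : cabs (f (v k).2 - f z) < e / 2.
  apply: hd => //; have := cabs_trans (v k).1 (v k).2 z.
  rewrite (cabsBC (v k).2 (v k).1); lra.
have := cabs_trans (f z) (f (v k).1) (f (v k).2); rewrite (cabsBC (f z)); lra.
Qed.

End Compactness.

(** * Functions approximable by polynomials *)

(** Holomorphy is encoded as local uniform approximability by polynomials: this
    class is visibly stable under the ring operations, uniform limits and
    Newton's iteration, and approximation by entire functions is how almost
    periodic functions are given. *)
Definition poly_approx (R : realType) (f : R[i] -> R[i]) (z : R[i]) (r : R) :=
  forall e : R, 0 < e -> exists p : {poly R[i]},
    forall h, cabs h <= r -> cabs (f (z + h) - p.[h]) <= e.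

Definition holo (R : realType) (f : R[i] -> R[i]) (z : R[i]) :=
  exists2 r : R, 0 < r & poly_approx f z r.

Section PolyApprox.
Variable R : realType.
Implicit Types (c z y h : R[i]) (r s e d : R) (f g : R[i] -> R[i]).
Implicit Types p q : {poly R[i]}.

Lemma poly_bounded p r : exists2 M : R, 0 < M & forall h, cabs h <= r -> cabs p.[h] <= M.
Proof.
exists (\sum_(i < size p) cabs p`_i * `|r| ^+ i + 1).
  by rewrite ltr_wpDl // sumr_ge0 // => i _; rewrite mulr_ge0 ?cabs_ge0 ?exprn_ge0.
move=> h hr; rewrite horner_coef; apply: le_trans (cabs_sum _ _ _) _.
rewrite -[leLHS]addr0 lerD // ler_sum // => i _; rewrite cabsM cabsX.
rewrite ler_wpM2l ?cabs_ge0 // lerXn2r ?nnegrE ?cabs_ge0 //.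
exact: le_trans hr (ler_norm _).
Qed.

Lemma poly_divX p : exists q, p = q * 'X + p.[0]%:P.
Proof.
elim/poly_ind: p => [|p c _]; first by exists 0; rewrite mul0r add0r horner0.
by exists p; rewrite !hornerE ?mulr0 ?add0r.
Qed.

Lemma pa_sub f g z r s : poly_approx f z r -> s <= r ->
  (forall h, cabs h <= s -> g (z + h) = f (z + h)) -> poly_approx g z s.
Proof.
move=> fp sr fg e e0; have [p hp] := fp e e0; exists p => h hs.
by rewrite fg //; apply: hp; exact: le_trans sr.
Qed.

Lemma pa_shift f z r y s : poly_approx f z r -> cabs (y - z) + s <= r ->
  poly_approx f y s.
Proof.
move=> fp yz e e0; have [p hp] := fp e e0.
exists (p \Po ('X + (y - z)%:P)) => h hs; rewrite horner_comp hornerD hornerX hornerC.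
have -> : y + h = z + (h + (y - z)) by ring.
by apply: hp; apply: le_trans (cabsD _ _) _; lra.
Qed.

Lemma pa_limit f z r :
  (forall e : R, 0 < e -> exists2 g, poly_approx g z r &
     forall h, cabs h <= r -> cabs (f (z + h) - g (z + h)) <= e) ->
  poly_approx f z r.
Proof.
move=> fg e e0; have e2 : 0 < e / 2 by rewrite divr_gt0.
have [g gp hg] := fg _ e2; have [p hp] := gp _ e2; exists p => h hr.
apply: le_trans (cabs_trans (g (z + h)) _ _) _.
by have := hg h hr; have := hp h hr; lra.
Qed.

Lemma pa_poly p y z r : poly_approx (fun x => p.[x - y]) z r.
Proof.
move=> e e0; exists (p \Po ('X + (z - y)%:P)) => h _.
rewrite horner_comp hornerD hornerX hornerC (_ : z + h - y = h + (z - y)); last ring.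
by rewrite subrr cabs0 ltW.
Qed.

Lemma pa_cst k z r : poly_approx (fun=> k) z r.
Proof. by move=> e e0; exists k%:P => h _; rewrite hornerC /= subrr cabs0 ltW. Qed.

Lemma pa_id z r : poly_approx id z r.
Proof. by move=> e e0; exists ('X + z%:P) => h _; rewrite hornerD hornerX hornerC /= [z + h]addrC subrr cabs0 ltW. Qed.

Lemma paD f g z r : poly_approx f z r -> poly_approx g z r ->
  poly_approx (fun x => f x + g x) z r.
Proof.
move=> fp gp e e0; have e2 : 0 < e / 2 by rewrite divr_gt0.
have [p hp] := fp _ e2; have [q hq] := gp _ e2; exists (p + q) => h hr.
rewrite hornerD opprD addrACA; apply: le_trans (cabsD _ _) _.
by have := hp h hr; have := hq h hr; lra.
Qed.

Lemma pa_bounded f z r : poly_approx f z r ->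
  exists2 M : R, 0 < M & forall h, cabs h <= r -> cabs (f (z + h)) <= M.
Proof.
move=> fp; have [p hp] := fp _ ltr01; have [M M0 hM] := poly_bounded p r.
exists (M + 1) => [|h hr]; first by rewrite addr_gt0.
have := cabs_sub (f (z + h)) p.[h]; have := hp h hr; have := hM h hr; lra.
Qed.

Lemma paM f g z r : poly_approx f z r -> poly_approx g z r ->
  poly_approx (fun x => f x * g x) z r.
Proof.
move=> fp gp; have [M M0 hM] := pa_bounded gp.
move=> e e0; have eM : 0 < e / 2 / M by rewrite !divr_gt0.
have [p hp] := fp _ eM; have [K K0 hK] := poly_bounded p r.
have eK : 0 < e / 2 / K by rewrite !divr_gt0.
have [q hq] := gp _ eK; exists (p * q) => h hr.
rewrite hornerM (_ : _ - _ = (f (z + h) - p.[h]) * g (z + h)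
                              + p.[h] * (g (z + h) - q.[h])); last ring.
apply: le_trans (cabsD _ _) _; rewrite !cabsM.
have h1 : cabs (f (z + h) - p.[h]) * cabs (g (z + h)) <= e / 2 / M * M.
  by rewrite ler_pM ?cabs_ge0 ?hp ?hM.
have h2 : cabs p.[h] * cabs (g (z + h) - q.[h]) <= K * (e / 2 / K).
  by rewrite ler_pM ?cabs_ge0 ?hq ?hK.
rewrite divfK ?gt_eqF // in h1; rewrite [K * _]mulrC divfK ?gt_eqF // in h2; lra.
Qed.

Lemma paZ k f z r : poly_approx f z r -> poly_approx (fun x => k * f x) z r.
Proof. by move=> fp; apply: paM => //; exact: pa_cst. Qed.

Lemma paB f g z r : poly_approx f z r -> poly_approx g z r ->
  poly_approx (fun x => f x - g x) z r.
Proof.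
move=> fp gp; have := paD fp (paZ (-1) gp).
by move/pa_sub; apply => // h _; rewrite mulN1r.
Qed.

Lemma paX f z r n : poly_approx f z r -> poly_approx (fun x => f x ^+ n) z r.
Proof.
move=> fp; elim: n => [|n IH]; first exact: pa_cst.
by move: (paM fp IH) => /pa_sub; apply => // h _; rewrite exprS.
Qed.

Lemma pa_sum (I : Type) (l : seq I) (F : I -> R[i] -> R[i]) z r :
  (forall i, poly_approx (F i) z r) ->
  poly_approx (fun x => \sum_(i <- l) F i x) z r.
Proof.
move=> Fp; elim: l => [|i l IH].
  by apply: pa_sub (pa_cst 0 z r) (lexx r) _ => h _; rewrite big_nil.
by move: (paD (Fp i) IH) => /pa_sub; apply => // h _; rewrite big_cons.
Qed.

Lemma pa_horner p f z r : poly_approx f z r -> poly_approx (fun x => p.[f x]) z r.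
Proof.
move=> fp; elim/poly_ind: p => [|p c IH].
  by apply: pa_sub (pa_cst 0 z r) (lexx r) _ => h _; rewrite horner0.
move: (paD (paM IH fp) (pa_cst c z r)) => /pa_sub; apply => // h _.
by rewrite !hornerE.
Qed.

Lemma pa_comp f g z y r s : poly_approx f z r -> poly_approx g y s ->
  (forall h, cabs h <= s -> cabs (g (y + h) - z) <= r) ->
  poly_approx (fun x => f (g x)) y s.
Proof.
move=> fp gp gr; apply: pa_limit => e e0; have [p hp] := fp e e0.
exists (fun x => p.[g x - z]); first by apply: pa_horner; apply: paB => //; exact: pa_cst.
move=> h hs; rewrite (_ : f (g (y + h)) = f (z + (g (y + h) - z))); last first.
  by congr f; ring.
by apply: hp; exact: gr.
Qed.

Lemma pa_cont f z r : 0 < r -> poly_approx f z r -> cont_at setT f z.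
Proof.
move=> r0 fp e e0; have e3 : 0 < e / 4 by rewrite divr_gt0.
have [p hp] := fp _ e3; have [q pq] := poly_divX p.
have [M M0 hM] := poly_bounded q r.
exists (Num.min r (e / 4 / M)); first by rewrite lt_min r0 !divr_gt0.
move=> y _; rewrite lt_min => /andP[yr yM].
have hy := hp (y - z) (ltW yr); have h0 := hp 0; rewrite cabs0 in h0.
have {}h0 := h0 (ltW r0); rewrite addr0 in h0.
rewrite (_ : z + (y - z) = y) in hy; last by ring.
have hq : cabs (p.[y - z] - p.[0]) <= e / 4.
  rewrite pq !hornerE addrK cabsM.
  have hq := hM (y - z) (ltW yr).
  have : cabs q.[y - z] * cabs (y - z) <= M * (e / 4 / M).
    by rewrite ler_pM ?cabs_ge0 // ltW.
  by rewrite [M * _]mulrC divfK // gt_eqF.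
have := cabs_trans p.[y - z] (f y) (f z); have := cabs_trans p.[0] p.[y - z] (f z).
rewrite (cabsBC p.[0]); lra.
Qed.

Lemma holo_cont f z : holo f z -> cont_at setT f z.
Proof. by case=> r r0; exact: pa_cont. Qed.

Lemma holo2 f g k z : holo f z -> holo g z ->
  (forall r, poly_approx f z r -> poly_approx g z r -> poly_approx k z r) -> holo k z.
Proof.
move=> [r r0 fp] [s s0 gp] H; exists (Num.min r s); first by rewrite lt_min r0.
by apply: H; [apply: (pa_sub fp) | apply: (pa_sub gp)] => //; rewrite ge_min lexx ?orbT.
Qed.

Lemma holoD f g z : holo f z -> holo g z -> holo (fun x => f x + g x) z.
Proof. by move=> fz gz; apply: (holo2 fz gz) => r; exact: paD. Qed.

Lemma holoB f g z : holo f z -> holo g z -> holo (fun x => f x - g x) z.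
Proof. by move=> fz gz; apply: (holo2 fz gz) => r; exact: paB. Qed.

Lemma holoM f g z : holo f z -> holo g z -> holo (fun x => f x * g x) z.
Proof. by move=> fz gz; apply: (holo2 fz gz) => r; exact: paM. Qed.

Lemma holoX f z n : holo f z -> holo (fun x => f x ^+ n) z.
Proof. by move=> [r r0 fp]; exists r => //; exact: paX. Qed.

Lemma holo_cst k z : holo (fun=> k) z.
Proof. by exists 1 => //; exact: pa_cst. Qed.

Lemma holo_id z : holo id z.
Proof. by exists 1 => //; exact: pa_id. Qed.

Lemma holo_ext f g z d : 0 < d -> (forall y, cabs (y - z) < d -> f y = g y) ->
  holo f z -> holo g z.
Proof.
move=> d0 fg [r r0 fp]; exists (Num.min r (d / 2)); first by rewrite lt_min r0 divr_gt0.
apply: (pa_sub fp) => [|h]; first by rewrite ge_min lexx.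
by rewrite le_min => /andP[_ hd]; rewrite fg // addrC addKr; lra.
Qed.

Lemma holo_comp f g z : holo g z -> holo f (g z) -> holo (fun x => f (g x)) z.
Proof.
move=> [s s0 gp] [r r0 fp]; have [d d0 hd] := pa_cont s0 gp r0.
exists (Num.min s (d / 2)); first by rewrite lt_min s0 divr_gt0.
apply: (pa_comp fp); first by apply: (pa_sub gp) => //; rewrite ge_min lexx.
move=> h; rewrite le_min => /andP[hs hd2]; apply/ltW/hd => //.
by rewrite addrC addKr; lra.
Qed.

(** Geometric series. *)
Lemma holo_inv z y : z != y -> holo (fun x => (x - y)^-1) z.
Proof.
rewrite -subr_eq0; set c := z - y => c0.
have c0' : 0 < cabs c by rewrite cabs_gt0.
exists (cabs c / 2); first by rewrite divr_gt0.
move=> e e0; pose K : R := 2 / cabs c.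
have K0 : 0 < K by rewrite divr_gt0.
have [n hn] := @geom_small R (1 / 2) (e / K) ltac:(lra) ltac:(by rewrite divr_gt0).
exists (c^-1 *: \sum_(k < n) (- c^-1 *: 'X) ^+ k) => h hc.
set q := - c^-1 * h.
have q2 : cabs q <= 1 / 2.
  rewrite /q cabsM cabsN cabsV mulrC ler_pdivrMr //; lra.
have ch : z + h - y != 0.
  rewrite -cabs_gt0 (_ : z + h - y = c + h); last by rewrite /c; ring.
  have := cabs_sub c (- h); rewrite opprK cabsN; lra.
rewrite hornerE horner_sum; under eq_bigr => k _ do rewrite hornerE hornerZ hornerX.
rewrite -/q.
have e1 : (1 - q) = (z + h - y) / c by rewrite /q /c; field.
have q1 : 1 - q != 0 by rewrite e1 mulf_neq0 ?invr_neq0.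
have -> : (z + h - y)^-1 = c^-1 * (1 - q)^-1.
  by rewrite e1 invf_div mulrA mulVf // mul1r.
have -> : \sum_(k < n) q ^+ k = (1 - q ^+ n) / (1 - q).
  by apply: (canRL (mulfK q1)); rewrite mulrC -{2}(expr1n _ n) subrXX;
    congr (_ * _); apply: eq_bigr => k _; rewrite expr1n mul1r.
rewrite -mulrBr -{1}(mul1r (1 - q)^-1) -mulrBl opprB addrC subrK !cabsM !cabsV cabsX.
have iq : (cabs (1 - q))^-1 <= 2.
  have : 1 / 2 <= cabs (1 - q).
    by have := cabs_sub 1 q; rewrite cabs1; lra.
  move=> h2; rewrite -[2]invrK lef_pV2 ?posrE //; lra.
have qn : cabs q ^+ n <= (1 / 2) ^+ n by rewrite lerXn2r ?nnegrE ?cabs_ge0 //; lra.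
have : (cabs c)^-1 * (cabs q ^+ n * (cabs (1 - q))^-1) <= (cabs c)^-1 * ((1 / 2) ^+ n * 2).
  by rewrite ler_wpM2l ?invr_ge0 ?cabs_ge0 // ler_pM ?exprn_ge0 ?invr_ge0 ?cabs_ge0.
move/le_trans; apply; rewrite (_ : _ * _ = (1 / 2) ^+ n * K); last by rewrite /K; ring.
by rewrite -ler_pdivlMr // ltW.
Qed.

End PolyApprox.

(** * The maximum principle *)

Section MaximumPrinciple.
Variable R : realType.
Implicit Types (c z y h w : R[i]) (r s e d M : R) (f g : R[i] -> R[i]).
Implicit Types p q : {poly R[i]}.

(** The discrete mean value property, exact as soon as the number of sample points
    exceeds the degree; it replaces the integral over a circle. *)
Lemma poly_mean p n w (rho : R) : (size p <= n)%N -> (0 < n)%N ->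
  (forall j, (0 < j < n)%N -> \sum_(k < n) (w ^+ j) ^+ k = 0) ->
  \sum_(k < n) p.[rho%:C * w ^+ k] = n%:R * p.[0].
Proof.
move=> pn n0 hw.
under eq_bigr => k _ do rewrite (horner_coef_wide _ pn).
rewrite exchange_big /=; case: n n0 pn hw => // n _ pn hw.
rewrite big_ord_recl [X in _ + X]big1 => [|i _].
  rewrite addr0; under eq_bigr => k _ do rewrite expr0 mulr1.
  by rewrite sumr_const card_ord horner_coef0 mulr_natl.
under eq_bigr => k _ do rewrite exprMn mulrA -exprM mulnC exprM.
rewrite -mulr_sumr hw ?mulr0 //; apply/andP; split => //; exact: ltn_ord.
Qed.

Lemma sub_mean f z r (rho e : R) : poly_approx f z r -> 0 <= rho <= r -> 0 < e ->
  exists n w, [/\ (0 < n)%N, cabs w = 1, \sum_(k < n) w ^+ k = 0 &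
    n%:R * cabs (f z) <= \sum_(k < n) cabs (f (z + rho%:C * w ^+ k)) + n%:R * e].
Proof.
move=> fp /andP[rho0 rhor] e0; have e2 : 0 < e / 2 by rewrite divr_gt0.
have [p hp] := fp _ e2; pose n := (maxn (size p) 2).
have n2 : (1 < n)%N by rewrite leq_maxr.
have [w [w1 hw]] := root_of_unity R (ltnW n2).
have wk k : cabs (rho%:C * w ^+ k) = rho.
  by rewrite cabsM cabsC cabsX w1 expr1n mulr1 ger0_norm.
exists n, w; split => //; first exact: ltnW.
  by have := hw 1%N n2; rewrite expr1.
have := hp 0; rewrite cabs0 addr0 => /(_ (le_trans rho0 rhor)) h0.
have mean := poly_mean rho (leq_maxl (size p) 2) (ltnW n2) hw.
have n0 : 0 <= n%:R :> R by [].
have h1 : n%:R * cabs p.[0] <= \sum_(k < n) cabs (f (z + rho%:C * w ^+ k)) + n%:R * (e / 2).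
  rewrite -[X in X * cabs p.[0]]cabs_nat -cabsM -mean; apply: le_trans (cabs_sum _ _ _) _.
  rewrite mulr_natl -[X in _ *+ X]card_ord -sumr_const -big_split /=.
  apply: ler_sum => k _; have := hp (rho%:C * w ^+ k); rewrite wk => /(_ rhor).
  rewrite cabsBC; have := cabs_sub p.[rho%:C * w ^+ k] (f (z + rho%:C * w ^+ k)); lra.
have h2 : n%:R * cabs (f z) <= n%:R * (cabs p.[0] + e / 2).
  by rewrite ler_wpM2l //; have := cabs_sub (f z) p.[0]; lra.
move: h1 h2 => /=; move: (\sum_(k < n) _) (n%:R) => S1 t; lra.
Qed.

Lemma sqr_mean n z w (rho : R) : cabs w = 1 -> \sum_(k < n) w ^+ k = 0 ->
  \sum_(k < n) cabs (z + rho%:C * w ^+ k) ^+ 2 = n%:R * (cabs z ^+ 2 + rho ^+ 2).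
Proof.
move=> w1 ws.
have rs : \sum_(k < n) complex.Re (w ^+ k) = 0.
  have : complex.Re (\sum_(k < n) w ^+ k) = 0 by rewrite ws.
  by rewrite (big_morph (@complex.Re R) (@ReD R) (erefl _)).
have im : \sum_(k < n) complex.Im (w ^+ k) = 0.
  have : complex.Im (\sum_(k < n) w ^+ k) = 0 by rewrite ws.
  by rewrite (big_morph (@complex.Im R) (@ImD R) (erefl _)).
transitivity (\sum_(k < n) ((cabs z ^+ 2 + rho ^+ 2) +
    (2 * rho * complex.Re z * complex.Re (w ^+ k) +
     2 * rho * complex.Im z * complex.Im (w ^+ k)))).
  apply: eq_bigr => k _.
  have : cabs (w ^+ k) ^+ 2 = 1 by rewrite cabsX w1 !expr1n.
  rewrite !cabs_sqr; case: z => a b; case: (w ^+ k) => x y /= xy.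
  rewrite !mul0r subr0 addr0.
  have -> : rho ^+ 2 = rho ^+ 2 * (x ^+ 2 + y ^+ 2) by rewrite xy mulr1.
  ring.
rewrite big_split /= sumr_const card_ord big_split /= -!mulr_sumr rs im.
by rewrite !mulr0 !addr0 mulr_natl.
Qed.

(** Adding a small multiple of [|z - c|^2] makes the mean value inequality
    strict, so that the maximum cannot be interior.  Holomorphy is only required
    where [f] does not vanish: this is what lets isolated exceptional points in. *)
Lemma max_modulus c r f M : 0 < r ->
  (forall z, disc c r z -> cont_at (disc c r) f z) ->
  (forall z, cabs (z - c) < r -> f z != 0 -> holo f z) ->
  (forall z, cabs (z - c) = r -> cabs (f z) <= M) ->
  forall z, disc c r z -> cabs (f z) <= M.
Proof.
move=> r0 fc fh fM z zD; apply/le_eps => e e0.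
have M0 : 0 <= M.
  apply: le_trans (cabs_ge0 (f (c + r%:C))) (fM _ _).
  by rewrite addrC addKr cabsC gtr0_norm.
pose a := e / r ^+ 2; have a0 : 0 < a by rewrite divr_gt0 ?exprn_gt0.
have ar : a * r ^+ 2 = e by rewrite /a divfK // gt_eqF ?exprn_gt0.
pose u x := cabs (f x) + a * cabs (x - c) ^+ 2.
suff uM : forall y, disc c r y -> u y <= M + e.
  by apply: le_trans (uM z zD); rewrite /u lerDl mulr_ge0 ?exprn_ge0 ?cabs_ge0 ?ltW.
have ubd : forall y, disc c r y -> a * cabs (y - c) ^+ 2 <= e.
  move=> y yD; rewrite -ar ler_pM2l // lerXn2r ?nnegrE ?cabs_ge0 //; exact: ltW.
have [y0 y0D|m mD um] := @disc_max R c r u (ltW r0).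
  move=> e1 e10; have e2 : 0 < e1 / 2 by rewrite divr_gt0.
  have [d d0 hd] := fc y0 y0D _ e2.
  have ar0 : 0 < a * (2 * r) by rewrite mulr_gt0 // mulr_gt0.
  have K0 : 0 < e1 / 2 / (a * (2 * r)) by rewrite divr_gt0.
  exists (Num.min d (e1 / 2 / (a * (2 * r)))); first by rewrite lt_min d0.
  move=> x xD; rewrite lt_min => /andP[xd]; rewrite ltr_pdivlMr // => xK.
  have h1 := hd x xD xd.
  have h2 := cabs_sub (f x) (f y0).
  have h3 := cabs_sub (f y0) (f x); rewrite (cabsBC (f y0)) in h3.
  have h4 := cabs_sub (x - c) (y0 - c).
  have h5 := cabs_sub (y0 - c) (x - c).
  have e5 : x - c - (y0 - c) = x - y0 by ring.
  rewrite (cabsBC (y0 - c)) e5 in h5; rewrite e5 in h4.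
  have h6 : a * `|cabs (x - c) ^+ 2 - cabs (y0 - c) ^+ 2| <= a * (cabs (x - y0) * (2 * r)).
    rewrite ler_pM2l // subr_sqr normrM ler_pM //.
      by rewrite ler_norml; apply/andP; split; lra.
    rewrite ger0_norm ?addr_ge0 ?cabs_ge0 //.
    by move: xD y0D; rewrite /disc /=; lra.
  have -> : u x - u y0 = (cabs (f x) - cabs (f y0)) +
      a * (cabs (x - c) ^+ 2 - cabs (y0 - c) ^+ 2) by rewrite /u; ring.
  apply: le_lt_trans (ler_normD _ _) _; rewrite [`|a * _|]normrM (gtr0_norm a0).
  have h7 : `|cabs (f x) - cabs (f y0)| <= cabs (f x - f y0).
    by rewrite ler_norml; apply/andP; split; lra.
  have h8 : a * (cabs (x - y0) * (2 * r)) < e1 / 2 by rewrite mulrCA.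
  lra.
move=> y yD; apply: le_trans (um y yD) _.
have [mr|mr] := eqVneq (cabs (m - c)) r.
  by rewrite /u lerD ?fM ?ubd.
have {}mr : cabs (m - c) < r by rewrite lt_neqAle mr.
have [fm0|fm0] := eqVneq (f m) 0.
  by rewrite /u fm0 cabs0 lerD ?ubd.
have [s s0 fs] := fh m mr fm0; exfalso.
pose rho := Num.min s (r - cabs (m - c)).
have rho0 : 0 < rho by rewrite lt_min s0 subr_gt0.
have rhos : 0 <= rho <= s by rewrite ltW //= ge_min lexx.
have rhor : rho <= r - cabs (m - c) by rewrite ge_min lexx orbT.
have e'0 : 0 < a * rho ^+ 2 / 2 by rewrite divr_gt0 // mulr_gt0 ?exprn_gt0.
have [n [w [n0 w1 ws hn]]] := sub_mean fs rhos e'0.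
have : \sum_(k < n) u (m + rho%:C * w ^+ k) <= \sum_(k < n) u m.
  apply: ler_sum => k _; apply: um; rewrite /disc /=.
  have -> : m + rho%:C * w ^+ k - c = (m - c) + rho%:C * w ^+ k by ring.
  apply: le_trans (cabsD _ _) _.
  by rewrite cabsM cabsC cabsX w1 expr1n mulr1 gtr0_norm //; lra.
rewrite big_split /= -mulr_sumr.
have -> : \sum_(k < n) cabs (m + rho%:C * w ^+ k - c) ^+ 2 =
    n%:R * (cabs (m - c) ^+ 2 + rho ^+ 2).
  rewrite -(sqr_mean _ _ w1 ws); apply: eq_bigr => k _.
  by congr (cabs _ ^+ 2); ring.
rewrite sumr_const card_ord -mulr_natl /u.
have n0R : 0 < n%:R :> R by rewrite ltr0n.
have : 0 < n%:R * (a * rho ^+ 2 / 2) by rewrite mulr_gt0.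
move: hn; move: (\sum_(k < n) _) => S1.
nra.
Qed.

Lemma holo_max_modulus c r f M : 0 < r -> (forall z, disc c r z -> holo f z) ->
  (forall z, cabs (z - c) = r -> cabs (f z) <= M) ->
  forall z, disc c r z -> cabs (f z) <= M.
Proof.
move=> r0 fh; apply: max_modulus => // [z zD e e0|z zr _]; last exact/fh/ltW.
by have [d d0 hd] := holo_cont (fh z zD) e0; exists d => // y _; exact: hd.
Qed.

End MaximumPrinciple.

(** * Division and Taylor expansion *)

Section Taylor.
Variable R : realType.
Implicit Types (c z y h w : R[i]) (r s e d M : R) (f g : R[i] -> R[i]).
Implicit Types p q : {poly R[i]}.

(** The maximum principle carries smallness of [p - q] on the disc over to
    [(p - q) / h]: approximating polynomials can be divided termwise. *)
Lemma pa_divide f z r : 0 < r -> poly_approx f z r ->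
  exists2 g, (forall h, f (z + h) = f z + h * g (z + h)) & poly_approx g z r.
Proof.
move=> r0 fp; have hP n := fp _ (inv_succ_gt0 R n).
have [P hPP] := choice hP.
have hQ n := poly_divX (P n); have [Q hQQ] := choice hQ.
have qle n m h : cabs h <= r ->
    cabs ((Q n).[h] - (Q m).[h]) <= 2 / r * (inv_succ R n + inv_succ R m).
  move=> hr; rewrite -hornerN -hornerD.
  have hD : disc 0 r h by rewrite /disc /= subr0.
  apply: (@holo_max_modulus R 0 r (horner (Q n - Q m))) => // [y _|y].
    exists 1 => //; have := pa_poly (Q n - Q m) 0 y 1.
    by move/pa_sub; apply => // x _; rewrite subr0.
  rewrite subr0 => yr.
  have yy0 : y != 0 by rewrite -cabs_gt0 yr.
  have pq k : (P k).[y] = (Q k).[y] * y + (P k).[0].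
    by rewrite {1}hQQ hornerD hornerM hornerX hornerC.
  have e1 : (Q n - Q m).[y] * y = ((P n).[y] - (P m).[y]) - ((P n).[0] - (P m).[0]).
    by rewrite !pq hornerD hornerN; ring.
  have bd x : cabs x <= r -> cabs ((P n).[x] - (P m).[x]) <= inv_succ R n + inv_succ R m.
    move=> xr; apply: le_trans (cabs_trans (f (z + x)) _ _) _.
    by rewrite cabsBC lerD ?hPP.
  rewrite mulrAC ler_pdivlMr // -{1}yr -cabsM e1.
  apply: le_trans (cabsB _ _) _.
  have b1 := bd y; have b2 := bd 0; rewrite cabs0 in b2.
  have := b1 ltac:(by rewrite yr); have := b2 (ltW r0); lra.
have [l hl] : exists l, is_ulim (fun n => (Q n).[0]) l.
  apply: (@bounded_ulim R _ (cabs (Q 0%N).[0] + 2 / r * 2)) => n.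
  apply: le_trans (cabs_sub _ (Q 0%N).[0]) _; rewrite lerD2l.
  apply: le_trans (qle n 0%N 0 _) _; first by rewrite cabs0 ltW.
  rewrite ler_wpM2l ?divr_ge0 ?(ltW r0) //.
  by have := inv_succ_le1 R n; have := inv_succ_le1 R 0; lra.
exists (fun x => if x == z then l else (f x - f z) / (x - z)).
  move=> h; case: ifPn => [/eqP zh|zh]; last first.
    rewrite (_ : z + h - z = h); last by ring.
    have h0 : h != 0 by apply: contra zh => /eqP ->; rewrite addr0.
    by field.
  have -> : h = 0 by rewrite -(addrK z h) [h + z]addrC zh subrr.
  by rewrite mul0r !addr0.
have gl h : cabs h <= r ->
    is_ulim (fun n => (Q n).[h]) (if z + h == z then l else (f (z + h) - f z) / (z + h - z)).
  move=> hr; case: ifPn => [/eqP zh|zh].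
    by have -> : h = 0 by rewrite -(addrK z h) [h + z]addrC zh subrr.
  rewrite (_ : z + h - z = h); last by ring.
  have h0 : h != 0 by apply: contra zh => /eqP ->; rewrite addr0.
  have h0' : 0 < cabs h by rewrite cabs_gt0.
  move=> e e0; have eh : 0 < e * cabs h / 2 by rewrite divr_gt0 ?mulr_gt0.
  have [n0 hn0] := inv_succ_small eh.
  apply: filterS (ultra_ge n0) => n /= /hn0 hn.
  have -> : (Q n).[h] - (f (z + h) - f z) / h =
      - ((f (z + h) - (P n).[h]) - (f z - (P n).[0])) / h.
    by rewrite {1}hQQ hornerD hornerM hornerX hornerC; field.
  rewrite cabsM cabsN cabsV ltr_pdivrMr //.
  have b1 := hPP n h hr; have := hPP n 0; rewrite cabs0 addr0 => /(_ (ltW r0)) b2.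
  by apply: le_lt_trans (cabsB _ _) _; lra.
move=> e e0; have e4 : 0 < e * r / 4 by rewrite divr_gt0 ?mulr_gt0.
have [n0 hn0] := inv_succ_small e4.
exists (Q n0) => h hr; rewrite cabsBC.
have hu := ulimD (ulim_const (Q n0).[h]) (ulimZ (-1) (gl h hr)).
rewrite mulN1r in hu; apply/le_eps => d d0.
have [k [nk _ hk]] := ulim_ex n0 hu (@filterT _ ultra _) d0.
rewrite mulN1r in hk.
have := cabs_sub ((Q n0).[h] - (if z + h == z then l else (f (z + h) - f z) / (z + h - z)))
   ((Q n0).[h] - (Q k).[h]).
have := qle n0 k h hr.
have : 2 / r * (inv_succ R n0 + inv_succ R k) <= e.
  rewrite mulrAC ler_pdivrMr //; have := hn0 _ nk; have := hn0 _ (leqnn _); lra.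
move: hk; rewrite cabsBC; lra.
Qed.

(** Schwarz's lemma: the quotient is bounded on the boundary circle, hence inside.
    The same [g] serves for all concentric discs. *)
Lemma schwarz f z r : 0 < r -> (forall y, disc z r y -> holo f y) ->
  exists g, [/\ forall h, f (z + h) = f z + h * g (z + h),
    forall y, disc z r y -> holo g y &
    forall (rho k : R), 0 < rho <= r -> (forall y, disc z rho y -> cabs (f y) <= k) ->
      forall y, disc z rho y -> cabs (g y) <= 2 / rho * k].
Proof.
move=> r0 fh; have [|s s0 fs] := fh z; first by rewrite /disc /= subrr cabs0 ltW.
have [g hg gs] := pa_divide s0 fs; exists g.
have gh y : disc z r y -> holo g y.
  move=> yD; have [->|yz] := eqVneq y z; first by exists s.
  have yz0 : 0 < cabs (y - z) by rewrite cabs_gt0 subr_eq0.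
  apply: (@holo_ext R (fun x => (f x - f z) * (x - z)^-1) g y (cabs (y - z)) yz0).
    move=> x xy; have xz : x - z != 0.
      rewrite -cabs_gt0; have := cabs_sub (y - z) (x - z).
      by rewrite (_ : y - z - (x - z) = y - x) ?(cabsBC y x) //; [lra | ring].
    have := hg (x - z); rewrite (_ : z + (x - z) = x); last ring.
    by move=> ->; field.
  by apply: holoM; [apply: holoB; [exact: fh | exact: holo_cst] | exact: holo_inv].
split => // rho k /andP[rho0 rhor] fk.
have zz : disc z rho z by rewrite /disc /= subrr cabs0 ltW.
apply: holo_max_modulus => // [y yD|y yr].
  by apply: gh; exact: le_trans rhor.
have := hg (y - z); rewrite (_ : z + (y - z) = y); last ring.
move=> e1; rewrite mulrAC ler_pdivlMr // -{1}yr -cabsM.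
have -> : g y * (y - z) = f y - f z by rewrite e1; ring.
apply: le_trans (cabsB _ _) _; have := fk z zz; have := fk y; rewrite /disc /= yr lexx.
by move=> /(_ isT); lra.
Qed.

(** The remainders are successive quotients, so their bounds follow from
    Schwarz's lemma on every concentric disc at once; the loss of a factor [2]
    per step only costs half of the radius of convergence. *)
Lemma taylor f z r : 0 < r -> (forall y, disc z r y -> holo f y) ->
  exists (c : nat -> R[i]) (g : nat -> R[i] -> R[i]),
  [/\ forall n h, f (z + h) = \sum_(k < n) c k * h ^+ k + h ^+ n * g n (z + h),
    forall n, c n = g n z,
    forall n y, disc z r y -> holo (g n) y &
    forall n (rho k : R), 0 < rho <= r -> (forall y, disc z rho y -> cabs (f y) <= k) ->
      forall y, disc z rho y -> cabs (g n y) <= (2 / rho) ^+ n * k].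
Proof.
move=> r0 fh.
have step (g : R[i] -> R[i]) : exists g', (forall y, disc z r y -> holo g y) ->
    [/\ forall h, g (z + h) = g z + h * g' (z + h),
    forall y, disc z r y -> holo g' y &
    forall (rho k : R), 0 < rho <= r -> (forall y, disc z rho y -> cabs (g y) <= k) ->
      forall y, disc z rho y -> cabs (g' y) <= 2 / rho * k].
  have [gh|gh] := pselect (forall y, disc z r y -> holo g y).
    by have [g' hg'] := schwarz r0 gh; exists g'.
  by exists g.
have [S hS] := choice step; pose g n := iter n S f.
have gh n y : disc z r y -> holo (g n) y.
  elim: n y => [|n IH] y yD; first exact: fh.
  by have [_ H _] := hS _ IH; exact: H.
exists (fun n => g n z), g; split => // n.
  elim: n => [|n IH] h; first by rewrite big_ord0 add0r mul1r.
  rewrite IH big_ord_recr /= exprSr -addrA; congr (_ + _).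
  by have [H _ _] := hS _ (gh n); rewrite H mulrDr mulrA [in RHS]mulrC.
move=> rho k rhor fk; elim: n => [|n IH] y yD; first by rewrite mul1r; exact: fk.
have [_ _ H] := hS _ (gh n); rewrite exprS -mulrA; exact: H IH _ yD.
Qed.

Lemma holo_lipschitz f z r M : 0 < r -> (forall y, disc z r y -> holo f y) ->
  (forall y, disc z r y -> cabs (f y) <= M) ->
  forall h, cabs h <= r -> cabs (f (z + h) - f z) <= 2 / r * M * cabs h.
Proof.
move=> r0 fh fM h hr; have [g [hg _ gM]] := schwarz r0 fh.
rewrite hg (_ : _ - _ = g (z + h) * h); last ring.
rewrite cabsM ler_wpM2r ?cabs_ge0 //.
by apply: (gM r M); rewrite ?r0 ?lexx // /disc /= addrC addKr.
Qed.

(** First order Taylor formula: the bounds depend only on the radius and on the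
    supremum, which makes them uniform along a strip. *)
Lemma holo_quadratic f z r M : 0 < r -> (forall y, disc z r y -> holo f y) ->
  (forall y, disc z r y -> cabs (f y) <= M) -> exists c,
  cabs c <= 2 / r * M /\
  forall h, cabs h <= r -> cabs (f (z + h) - f z - c * h) <= (2 / r) ^+ 2 * M * cabs h ^+ 2.
Proof.
move=> r0 fh fM; have [c [g [hg cg _ gM]]] := taylor r0 fh.
have rr : 0 < r <= r by rewrite r0 lexx.
exists (c 1%N); split => [|h hr].
  by rewrite cg; apply: (gM 1%N r M rr fM); rewrite /disc /= subrr cabs0 ltW.
have := hg 2%N h; rewrite big_ord_recr big_ord_recr big_ord0 /= add0r expr0 expr1 mulr1.
have -> : c 0%N = f z by have := hg 0%N 0; rewrite big_ord0 addr0 add0r mul1r cg.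
move=> ->; rewrite (_ : _ - _ = g 2%N (z + h) * h ^+ 2); last ring.
rewrite cabsM cabsX ler_wpM2r ?exprn_ge0 ?cabs_ge0 //.
by apply: (gM 2%N r M rr fM); rewrite /disc /= addrC addKr.
Qed.

End Taylor.

(** * Exponentials along a strip *)

Section Cis.
Variable R : realType.
Implicit Types (l m t x : R) (z y h : R[i]) (r e d M : R).

Lemma cabs_subX z y M n : 1 <= M -> cabs z <= M -> cabs y <= M ->
  cabs (z ^+ n - y ^+ n) <= n%:R * M ^+ n * cabs (z - y).
Proof.
move=> M1 zM yM; rewrite subrXX cabsM mulrC ler_wpM2r ?cabs_ge0 //.
apply: le_trans (cabs_sum _ _ _) _.
rewrite mulr_natl -[X in _ *+ X]card_ord -sumr_const ler_sum // => i _.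
rewrite cabsM !cabsX; apply: (@le_trans _ _ (M ^+ (n.-1 - i) * M ^+ i)).
  by rewrite ler_pM ?exprn_ge0 ?cabs_ge0 // lerXn2r ?nnegrE ?cabs_ge0 //; lra.
rewrite -exprD ler_weXn2l //; have := ltn_ord i; lia.
Qed.

(** Euler's limit gives the polynomials approximating the exponential. *)
Lemma cexp_pa z r : poly_approx (@cexp R) z r.
Proof.
apply: (@pa_shift R _ 0 (`|r| + cabs z) z r); last first.
  by rewrite subr0 addrC lerD2r ler_norm.
set s := `|r| + cabs z; have s0 : 0 <= s by rewrite addr_ge0 ?cabs_ge0.
move=> e e0.
have [n hn] := nat_ub (s + s + 10 * s ^+ 2 * expR s / e + 1).
have hK : 0 <= 10 * s ^+ 2 * expR s / e.
  by rewrite divr_ge0 ?(ltW e0) // mulr_ge0 ?expR_ge0 // mulr_ge0 ?sqr_ge0.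
have n1 : 1 <= n%:R :> R by lra.
have n0 : 0 < n%:R :> R by lra.
have nC : n%:R != 0 :> R[i] by rewrite pnatr_eq0 -lt0n -(ltr_nat R).
exists ((1 + n%:R^-1 *: 'X) ^+ n) => h hs; rewrite add0r.
rewrite horner_exp hornerD hornerC hornerZ hornerX.
rewrite {1}(_ : h = n%:R * (n%:R^-1 * h)); last by field.
rewrite cexpMn; set k := n%:R^-1 * h.
have kn : cabs k = cabs h / n%:R by rewrite cabsM cabsV cabs_nat mulrC.
have ks : cabs k <= s / n%:R by rewrite kn ler_pM2r ?invr_gt0.
have sn : s / n%:R <= 1 / 2 by rewrite ler_pdivrMr //; lra.
have sn0 : 0 <= s / n%:R by rewrite divr_ge0 // ltW.
apply: le_trans (@cabs_subX _ _ (expR (s / n%:R)) n _ _ _) _.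
- by apply: le_trans (expR_ge1Dx _); rewrite lerDl.
- rewrite cabs_cexp ler_expR; apply: le_trans ks.
  by apply: le_trans (Re_le_cabs _); exact: ler_norm.
- apply: le_trans (cabsD _ _) _; rewrite cabs1.
  by apply: le_trans (expR_ge1Dx _); rewrite lerD2l.
rewrite -expRM_natl (_ : n%:R * (s / n%:R) = s); last by field; rewrite gt_eqF.
have -> : cexp k - (1 + k) = cexp k - 1 - k by ring.
have k2 : cabs k <= 1 / 2 by exact: le_trans sn.
have h1 := cexp_sub1_le k2.
have h2 : cabs k ^+ 2 <= (s / n%:R) ^+ 2 by rewrite lerXn2r ?nnegrE ?cabs_ge0.
apply: (@le_trans _ _ (n%:R * expR s * (10 * (s / n%:R) ^+ 2))).
  rewrite ler_wpM2l ?mulr_ge0 ?expR_ge0 ?(ltW n0) //.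
  by apply: le_trans h1 _; rewrite ler_pM2l.
have -> : n%:R * expR s * (10 * (s / n%:R) ^+ 2) = (10 * s ^+ 2 * expR s) / n%:R.
  by field; rewrite gt_eqF.
rewrite ler_pdivrMr // [e * _]mulrC -ler_pdivrMr //; lra.
Qed.

Definition cis l z : R[i] := cexp ('i%C * l%:C * z).

Lemma cis_pa l z r : poly_approx (cis l) z r.
Proof.
suff : poly_approx (fun y => cexp ('i%C * l%:C * y)) z r by [].
apply: (@pa_comp R (@cexp R) (fun y => 'i%C * l%:C * y) ('i%C * l%:C * z) z
  (cabs ('i%C * l%:C) * r) r) => [||h hr]; first exact: cexp_pa.
  by apply: paZ; exact: pa_id.
rewrite (_ : _ - _ = 'i%C * l%:C * h); last ring.
by rewrite cabsM ler_wpM2l ?cabs_ge0.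
Qed.

Lemma holo_cis l z : holo (cis l) z.
Proof. by exists 1 => //; exact: cis_pa. Qed.

Lemma cisD l z y : cis l (z + y) = cis l z * cis l y.
Proof. by rewrite /cis mulrDr cexpD. Qed.

Lemma cisDl l m z : cis (l + m) z = cis l z * cis m z.
Proof. by rewrite /cis -cexpD rmorphD /= -mulrDl -mulrDr. Qed.

Lemma cis0 l : cis l 0 = 1.
Proof. by rewrite /cis mulr0 cexp0. Qed.

Lemma cis0l z : cis 0 z = 1.
Proof. by rewrite /cis mulr0 mul0r cexp0. Qed.

Lemma cisNl l z : cis (- l) z * cis l z = 1.
Proof. by rewrite -cisDl addNr cis0l. Qed.

Lemma cabs_cis l z : cabs (cis l z) = expR (- (l * complex.Im z)).
Proof.
by rewrite /cis cabs_cexp; case: z => x y /=; congr expR; ring.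
Qed.

Lemma cabs_cis_real l t : cabs (cis l t%:C) = 1.
Proof. by rewrite cabs_cis /= mulr0 oppr0 expR0. Qed.

Lemma cisZ l k t : k != 0 -> cis (l / k) (k * t)%:C = cis l t%:C.
Proof.
move=> k0; rewrite /cis -!mulrA -!rmorphM /=; congr (cexp (_ * _%:C)).
by field.
Qed.

(** For [|l t| > 1/2] the bound is trivial, otherwise it comes from
    [cexp_sub1_le]. *)
Lemma cis_lipschitz l t : cabs (cis l t%:C - 1) <= 12 * `|l| * `|t|.
Proof.
have [h|h] := leP (`|l| * `|t|) (1 / 2); last first.
  have := cabsB (cis l t%:C) 1; rewrite cabs_cis_real cabs1; lra.
have e1 : cabs ('i%C * l%:C * t%:C) = `|l| * `|t|.
  by rewrite !cabsM !cabsC cabs_i mul1r.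
have := @cexp_sub1_le R ('i%C * l%:C * t%:C); rewrite e1 => /(_ h).
have := cabs_sub (cis l t%:C - 1) ('i%C * l%:C * t%:C); rewrite e1 /cis.
have := mulr_ge0 (normr_ge0 l) (normr_ge0 t); nra.
Qed.

End Cis.

(** * Bohr sets *)

Section Bohr.
Variable R : realType.
Implicit Types (l m t : R) (z h : R[i]) (r e d M : R) (mu : seq R).

Definition bohr mu d t := forall l, l \in mu -> cabs (cis l t%:C - 1) <= d.

Lemma bohr_sub mu1 mu2 d1 d2 t : {subset mu1 <= mu2} -> d2 <= d1 ->
  bohr mu2 d2 t -> bohr mu1 d1 t.
Proof. by move=> mus dd b l /mus /b /le_trans; apply. Qed.

Lemma cisM_sub1 l t s :
  cabs (cis l (t + s)%:C - 1) <= cabs (cis l t%:C - 1) + cabs (cis l s%:C - 1).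
Proof.
rewrite rmorphD /= cisD; apply: le_trans (cabs_trans (cis l t%:C) _ _) _.
rewrite addrC lerD2l (_ : _ - _ = cis l t%:C * (cis l s%:C - 1)); last ring.
by rewrite cabsM cabs_cis_real mul1r.
Qed.

Lemma bohr_mul mu d t n : bohr mu d t -> bohr mu (n%:R * d) (n%:R * t).
Proof.
move=> b l lmu; elim: n => [|n IH]; first by rewrite !mul0r cis0 subrr cabs0.
rewrite mulrSr mulrDl mul1r; apply: le_trans (cisM_sub1 _ _ _) _.
by rewrite mulrDl mul1r lerD // b.
Qed.

(** Dividing the frequencies by [k] allows one to divide the time by [k]. *)
Lemma bohr_div mu d k t : k != 0 -> bohr [seq l / k | l <- mu] d (k * t) -> bohr mu d t.
Proof.
by move=> k0 b l lmu; have := b (l / k) (map_f _ lmu); rewrite cisZ.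
Qed.

(** Total boundedness of a bounded set of finite-dimensional vectors: otherwise
    there is a separated sequence, which contradicts the existence of limits
    along an ultrafilter. *)
Lemma finite_net (T : choiceType) (I : finType) (F : T -> I -> R[i]) M e :
  (forall (x : T) i, cabs (F x i) <= M) -> 0 < e ->
  exists ts : seq T, forall x : T, exists2 y, y \in ts & forall i, cabs (F x i - F y i) <= e.
Proof.
move=> FM e0; apply: contrapT => noS.
have pick (ts : seq T) : exists x : T, forall y, y \in ts -> exists i, e < cabs (F x i - F y i).
  apply: contrapT => h; apply: noS; exists ts => t.
  apply: contrapT => h2; apply: h; exists t => s sts.
  apply: contrapT => h3; apply: h2; exists s => // i; rewrite leNgt; apply/negP => h4.
  by apply: h3; exists i.
have [P hP] := choice pick; pose L n := iter n (fun ts => P ts :: ts) [::].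
pose u n := P (L n).
have uL k n : (k < n)%N -> u k \in L n.
  elim: n => // n IH; rewrite ltnS leq_eqVlt => /orP[/eqP ->|kn] /=.
    by rewrite inE eqxx.
  by rewrite inE IH ?orbT.
have limF i : exists y, is_ulim (fun n => F (u n) i) y.
  by apply: (@bounded_ulim R _ M) => n.
have [l hl] := choice limF.
have e2 : 0 < e / 2 by rewrite divr_gt0.
have A : ultra [set n | forall i, cabs (F (u n) i - l i) < e / 2].
  apply: (@filter_forall nat I (fun i n => cabs (F (u n) i - l i) < e / 2)) => i.
  exact: hl.
have [k kA] := filter_ex A; have [n [nA kn]] := filter_ex (filterI A (ultra_ge k.+1)).
have [j] := hP (L n) (u k) (uL k n kn); rewrite -/(u n).
have kj := kA j; have nj := nA j.
have := cabs_trans (l j) (F (u n) j) (F (u k) j).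
rewrite (cabsBC (l j) (F (u k) j)); move: kj nj => /=; lra.
Qed.

(** Bohr sets are syndetic: the characters indexed by [mu] map the line into a
    totally bounded torus, and two times with nearby images differ by an element
    of the Bohr set. *)
Lemma bohr_cover mu d : 0 < d -> exists ts : seq R,
  forall t, exists2 s, s \in ts & bohr mu d (t - s).
Proof.
move=> d0.
have [t i|ts hts] := @finite_net R 'I_(size mu)
  (fun t i => cis (nth 0 mu i) t%:C) 1 d _ d0; first by rewrite cabs_cis_real.
exists ts => t; have [s sts hs] := hts t; exists s => // l lmu.
have il : (index l mu < size mu)%N by rewrite index_mem.
have := hs (Ordinal il); rewrite /= nth_index //.
have e1 : cis l s%:C * (cis l (t - s)%:C - 1) = cis l t%:C - cis l s%:C.
  rewrite mulrBr -cisD -rmorphD /= mulr1; congr (cis l _%:C - _); ring.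
by rewrite -e1 cabsM cabs_cis_real mul1r.
Qed.

End Bohr.

(** * Almost periodicity on closed bands *)

(** Finite levels [c], [d] within the strip; the order of [c] and [d] is left open,
    so that a single horizontal line is a band. *)
Definition inner (R : realType) (a b : \bar R) (c d : R) :=
  (a < c%:E)%E /\ (d%:E < b)%E.

Definition band (R : realType) (c d : R) : set R[i] :=
  [set z | c <= complex.Im z <= d].

Section Bands.
Variable R : realType.
Implicit Types (a b : \bar R) (c d e r t : R) (z y h : R[i]) (f g : R[i] -> R[i]).

Lemma inner_enlarge a b c d : inner a b c d ->
  exists2 s : R, 0 < s & inner a b (c - s) (d + s).
Proof.
move=> [ac db].
have [s1 s10 h1] : exists2 s : R, 0 < s & (a < (c - s)%:E)%E.
  case: a ac => [a||] // ac; last by exists 1; rewrite ?ltNyr.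
  rewrite lte_fin in ac; exists ((c - a) / 2); first by lra.
  by rewrite lte_fin; lra.
have [s2 s20 h2] : exists2 s : R, 0 < s & ((d + s)%:E < b)%E.
  case: b db => [b||] // db; last by exists 1; rewrite ?ltry.
  rewrite lte_fin in db; exists ((b - d) / 2); first by lra.
  by rewrite lte_fin; lra.
exists (Num.min s1 s2); first by rewrite lt_min s10.
split.
  by apply: lt_le_trans h1 _; rewrite lee_fin lerD2l lerN2 ge_min lexx.
by apply: le_lt_trans h2; rewrite lee_fin lerD2l ge_min lexx orbT.
Qed.

Lemma inner_join a b c1 d1 c2 d2 : inner a b c1 d1 -> inner a b c2 d2 ->
  inner a b (Num.min c1 c2) (Num.max d1 d2).
Proof. by move=> [? ?] [? ?]; rewrite /inner minEle maxEle; split; case: ifP. Qed.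

Lemma inner_sub a b c1 d1 c2 d2 : inner a b c1 d1 -> c1 <= c2 -> d2 <= d1 ->
  inner a b c2 d2.
Proof.
move=> [h1 h2] cc dd; split; first by apply: lt_le_trans h1 _; rewrite lee_fin.
by apply: le_lt_trans h2; rewrite lee_fin.
Qed.

Lemma band_strip a b c d z : inner a b c d -> band c d z -> strip a b z.
Proof.
move=> [h1 h2] /andP[cz zd]; split; first by apply: lt_le_trans h1 _; rewrite lee_fin.
by apply: le_lt_trans h2; rewrite lee_fin.
Qed.

Lemma strip_inner a b z : strip a b z -> inner a b (complex.Im z) (complex.Im z).
Proof. by []. Qed.

Lemma band_Im z : band (complex.Im z) (complex.Im z) z.
Proof. by rewrite /band /= lexx. Qed.

Lemma band_real c d z t : band c d z -> band c d (z + t%:C).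
Proof. by rewrite /band /= ImD /= addr0. Qed.

Lemma strip_real a b z t : strip a b z -> strip a b (z + t%:C).
Proof. by rewrite /strip /= ImD /= addr0. Qed.

Lemma band_disc c d s z y : band c d z -> cabs (y - z) <= s -> band (c - s) (d + s) y.
Proof.
rewrite /band /= => /andP[cz zd] yz; have := Im_le_cabs (y - z).
rewrite ImB ler_norml => /andP[h1 h2]; apply/andP; split; lra.
Qed.

Lemma band_sub c1 d1 c2 d2 z : c1 <= c2 -> d2 <= d1 -> band c2 d2 z -> band c1 d1 z.
Proof. by rewrite /band /= => h1 h2 /andP[h3 h4]; apply/andP; split; lra. Qed.

Lemma exists_inner a b : (a < b)%E -> exists c d, c < d /\ inner a b c d.
Proof.
case: a => [a||]; case: b => [b||] //; rewrite ?lte_fin => ab.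
- exists (a + (b - a) / 3), (a + 2 * (b - a) / 3); split; first lra.
  by split; rewrite lte_fin; lra.
- exists (a + 1), (a + 2); split; first lra.
  by split; rewrite ?lte_fin ?ltry //; lra.
- exists (b - 2), (b - 1); split; first lra.
  by split; rewrite ?lte_fin ?ltNyr //; lra.
- by exists 0, 1; split; [lra | split; rewrite ?ltNyr ?ltry].
Qed.

Definition ap a b f := forall c d, inner a b c d -> forall e : R, 0 < e ->
  exists2 g, exp_sums g & forall z, band c d z -> cabs (f z - g z) <= e.

Lemma exp_sums_cis (s : seq (R[i] * R)) :
  exp_sums (fun z => \sum_(x <- s) x.1 * cis x.2 z).
Proof.
exists (size s), (fun k => (nth (0, 0) s k).1), (fun k => (nth (0, 0) s k).2).
by apply/funext => z; rewrite (big_nth (0, 0)) big_mkord.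
Qed.

Lemma exp_sums_seq f : exp_sums f ->
  exists s : seq (R[i] * R), f = fun z => \sum_(x <- s) x.1 * cis x.2 z.
Proof.
move=> [n [c [l ->]]]; exists [seq (c k, l k) | k <- enum 'I_n].
by apply/funext => z; rewrite big_map big_enum.
Qed.

(** From right to left, the sets of exponential sums that are close to [f] on a
    band generate a filter, since bands are directed, and it converges to [f]. *)
Lemma AP_iff_ap a b f : (a < b)%E -> AP a b f <-> ap a b f.
Proof.
move=> ab; split.
  move=> fAP c d cd e e0; have [s s0 scd] := inner_enlarge cd.
  have [dc|dc] := ltP d c.
    exists (fun z => \sum_(x <- [::] : seq (R[i] * R)) x.1 * cis x.2 z).
      exact: exp_sums_cis.
    by move=> z; rewrite /band /= => /andP[h1 h2]; lra.
  have eC : 0 < e%:C :> R[i] by rewrite ltcR.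
  have sA : substrips a b (strip (c - s)%:E (d + s)%:E).
    by exists (c - s), (d + s); split; [exact: scd.1 | lra | exact: scd.2 |].
  have [g [gE gf]] := fAP _ (@fam_nbhs _ _ _ _ _ f (entourage_ball _ (PosNum eC)) sA).
  exists g => // z zcd; have /gf : strip (c - s)%:E (d + s)%:E z.
    by move: zcd; rewrite /strip /band /= !lte_fin => /andP[h1 h2]; split; lra.
  by rewrite -ball_normE /= cabsE ltcR => /ltW.
move=> fap; rewrite /AP closureEcvg.
pose G : set_system (R[i] -> R[i]) := [set A | exists c d e, [/\ inner a b c d, 0 < e &
  forall g, exp_sums g -> (forall z, band c d z -> cabs (f z - g z) <= e) -> A g]].
have GP : ProperFilter G.
  apply: Build_ProperFilter_ex.
    move=> A [c [d [e [cd e0 h]]]]; have [g gE gf] := fap c d cd e e0.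
    by exists g; exact: h.
  split.
  - by have [c [d [_ cd]]] := exists_inner ab; exists c, d, 1.
  - move=> A B [c1 [d1 [e1 [cd1 e10 h1]]]] [c2 [d2 [e2 [cd2 e20 h2]]]].
    exists (Num.min c1 c2), (Num.max d1 d2), (Num.min e1 e2); split.
    + exact: inner_join.
    + by rewrite lt_min e10.
    + move=> g gE gf; split.
        apply: h1 => // z z1; apply: le_trans (gf z _) _; last by rewrite ge_min lexx.
        by apply: band_sub z1; rewrite ?ge_min ?le_max lexx.
      apply: h2 => // z z1; apply: le_trans (gf z _) _; last by rewrite ge_min lexx orbT.
      by apply: band_sub z1; rewrite ?ge_min ?le_max lexx orbT.
  - move=> A B AB [c [d [e [cd e0 h]]]]; exists c, d, e; split => // g gE gf.
    exact/AB/h.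
exists G => //; split; last first.
  move=> A AE; have [c [d [_ cd]]] := exists_inner ab; exists c, d, 1; split => //.
  by move=> g gE _; exact: AE.
apply/fam_cvgP => A [a' [b' [aa' ab' bb' ->]]] P /uniform_nbhs [E [entE EP]].
move: entE; rewrite -entourage_ballE => -[e /= e0 eE].
have [e' e'0 ee'] : exists2 e' : R, 0 < e' & e = e'%:C.
  by move: e0; case: (e) => x y; rewrite ltcE /= => /andP[/eqP -> x0]; exists x.
exists a', b', (e' / 2); split => //; first by rewrite divr_gt0.
move=> g gE gf; apply: EP => z [z1 z2]; apply: eE => /=.
rewrite -ball_normE /= cabsE ee' ltcR.
apply: le_lt_trans (gf z _) _; last lra.
by rewrite /band /=; move: z1 z2; rewrite !lte_fin => /ltW -> /ltW ->.
Qed.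

End Bands.

(** * The algebra of almost periodic functions *)

Section ApAlgebra.
Variable R : realType.
Implicit Types (a b : \bar R) (c d e r t : R) (z y h : R[i]) (f g : R[i] -> R[i]).

Lemma exp_sums_bounded f c d : exp_sums f ->
  exists2 M : R, 0 < M & forall z, band c d z -> cabs (f z) <= M.
Proof.
move=> /exp_sums_seq [s ->].
exists (\sum_(x <- s) cabs x.1 * expR (`|x.2| * (`|c| + `|d|)) + 1).
  by rewrite ltr_wpDl // sumr_ge0 // => i _; rewrite mulr_ge0 ?cabs_ge0 ?expR_ge0.
move=> z /andP[cz zd]; apply: le_trans (cabs_sum _ _ _) _.
rewrite -[leLHS]addr0 lerD // ler_sum // => x _; rewrite cabsM ler_wpM2l ?cabs_ge0 //.
rewrite cabs_cis ler_expR; apply: le_trans (ler_norm _) _.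
rewrite normrN normrM ler_wpM2l // ler_norml.
have := ler_norm (- c); have := ler_norm d; rewrite normrN.
have := normr_ge0 c; have := normr_ge0 d.
have := ler_norm (- d); have := ler_norm c; rewrite normrN.
by move=> *; apply/andP; split; lra.
Qed.

Lemma exp_sumsD f g : exp_sums f -> exp_sums g -> exp_sums (fun z => f z + g z).
Proof.
move=> /exp_sums_seq [s ->] /exp_sums_seq [u ->].
have -> : (fun z => \sum_(x <- s) x.1 * cis x.2 z + \sum_(x <- u) x.1 * cis x.2 z) =
  fun z => \sum_(x <- s ++ u) x.1 * cis x.2 z by apply/funext => z; rewrite big_cat.
exact: exp_sums_cis.
Qed.

Lemma exp_sumsM f g : exp_sums f -> exp_sums g -> exp_sums (fun z => f z * g z).
Proof.
move=> /exp_sums_seq [s ->] /exp_sums_seq [u ->].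
set F := (X in exp_sums X); have -> : F =
    fun z => \sum_(x <- [seq (x.1 * v.1, x.2 + v.2) | x <- s, v <- u]) x.1 * cis x.2 z.
  apply/funext => z; rewrite /F big_allpairs_dep /= big_distrl /=.
  apply: eq_bigr => x _; rewrite big_distrr /=; apply: eq_bigr => v _.
  by rewrite cisDl mulrACA.
exact: exp_sums_cis.
Qed.

Lemma ap_bounded a b f c d : ap a b f -> inner a b c d ->
  exists2 M : R, 0 < M & forall z, band c d z -> cabs (f z) <= M.
Proof.
move=> fa cd; have [g gE fg] := fa c d cd 1 ltr01.
have [M M0 hM] := exp_sums_bounded c d gE; exists (M + 1); first by rewrite addr_gt0.
by move=> z zb; have := cabs_sub (f z) (g z); have := fg z zb; have := hM z zb; lra.
Qed.

Lemma ap_cst a b k : ap a b (fun=> k).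
Proof.
move=> c d _ e e0; exists (fun z => \sum_(x <- [:: (k, 0 : R)]) x.1 * cis x.2 z).
  exact: exp_sums_cis.
by move=> z _; rewrite big_seq1 cis0l mulr1 subrr cabs0 ltW.
Qed.

Lemma apD a b f g : ap a b f -> ap a b g -> ap a b (fun z => f z + g z).
Proof.
move=> fa ga c d cd e e0; have e2 : 0 < e / 2 by rewrite divr_gt0.
have [p pE fp] := fa c d cd _ e2; have [q qE gq] := ga c d cd _ e2.
exists (fun z => p z + q z) => [|z zb]; first exact: exp_sumsD.
rewrite opprD addrACA; apply: le_trans (cabsD _ _) _.
by have := fp z zb; have := gq z zb; lra.
Qed.

Lemma apM a b f g : ap a b f -> ap a b g -> ap a b (fun z => f z * g z).
Proof.
move=> fa ga c d cd e e0; have [M M0 hM] := ap_bounded ga cd.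
have eM : 0 < e / 2 / M by rewrite !divr_gt0.
have [p pE hp] := fa c d cd _ eM; have [K K0 hK] := exp_sums_bounded c d pE.
have eK : 0 < e / 2 / K by rewrite !divr_gt0.
have [q qE hq] := ga c d cd _ eK; exists (fun z => p z * q z) => [|z zb].
  exact: exp_sumsM.
rewrite (_ : _ - _ = (f z - p z) * g z + p z * (g z - q z)); last ring.
apply: le_trans (cabsD _ _) _; rewrite !cabsM.
have h1 : cabs (f z - p z) * cabs (g z) <= e / 2 / M * M.
  by rewrite ler_pM ?cabs_ge0 ?hp ?hM.
have h2 : cabs (p z) * cabs (g z - q z) <= K * (e / 2 / K).
  by rewrite ler_pM ?cabs_ge0 ?hq ?hK.
by rewrite divfK ?gt_eqF // in h1; rewrite [K * _]mulrC divfK ?gt_eqF // in h2; lra.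
Qed.

Lemma ap_ext a b f g : ap a b f -> f =1 g -> ap a b g.
Proof. by move=> fa /funext <-. Qed.

Lemma ap_sum a b (I : Type) (s : seq I) (F : I -> R[i] -> R[i]) :
  (forall i, ap a b (F i)) -> ap a b (fun z => \sum_(i <- s) F i z).
Proof.
move=> Fa; elim: s => [|i s IH].
  by apply: (ap_ext (@ap_cst a b 0)) => z; rewrite big_nil.
by apply: (ap_ext (apD (Fa i) IH)) => z; rewrite big_cons.
Qed.

Lemma apX a b f n : ap a b f -> ap a b (fun z => f z ^+ n).
Proof.
move=> fa; elim: n => [|n IH]; first exact: ap_cst.
by apply: (ap_ext (apM fa IH)) => z; rewrite exprS.
Qed.

Lemma ap_pa a b f z r : ap a b f -> inner a b (complex.Im z - r) (complex.Im z + r) ->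
  poly_approx f z r.
Proof.
move=> fa zr; apply: pa_limit => e e0; have [g gE fg] := fa _ _ zr e e0.
exists g.
  have [s ->] := exp_sums_seq gE.
  by apply: (@pa_sum R _ s (fun x z => x.1 * cis x.2 z)) => x; apply: paZ; exact: cis_pa.
move=> h hr; apply: fg; apply: band_disc (band_Im z) _.
by rewrite addrC addKr.
Qed.

Lemma ap_holo a b f z : ap a b f -> strip a b z -> holo f z.
Proof.
move=> fa /strip_inner /inner_enlarge [s s0 h]; exists s => //; exact: ap_pa h.
Qed.

(** A function approximated by an exponential sum is nearly invariant under the
    translations that nearly fix the finitely many characters involved. *)
Lemma ap_bohr a b f c d e : ap a b f -> inner a b c d -> 0 < e ->
  exists mu dl, 0 < dl /\ forall t, bohr mu dl t ->
    forall z, band c d z -> cabs (f (z + t%:C) - f z) <= e.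
Proof.
move=> fa cd e0; have e3 : 0 < e / 4 by rewrite divr_gt0.
have [g /exp_sums_seq [s ->] fg] := fa c d cd _ e3.
pose K := \sum_(x <- s) cabs x.1 * expR (`|x.2| * (`|c| + `|d|)) + 1.
have K0 : 0 < K.
  by rewrite ltr_wpDl // sumr_ge0 // => i _; rewrite mulr_ge0 ?cabs_ge0 ?expR_ge0.
exists [seq x.2 | x <- s], (e / 4 / K); split => [|t bt z zb]; first by rewrite !divr_gt0.
have h1 := fg z zb; have h2 := fg _ (band_real t zb).
have h3 : cabs (\sum_(x <- s) x.1 * cis x.2 (z + t%:C) -
                \sum_(x <- s) x.1 * cis x.2 z) <= e / 4.
  rewrite -sumrB; apply: le_trans (cabs_sum _ _ _) _.
  apply: (@le_trans _ _ (\sum_(x <- s) cabs x.1 * expR (`|x.2| * (`|c| + `|d|)) * (e / 4 / K))).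
    rewrite big_seq [leRHS]big_seq; apply: ler_sum => x xs.
    rewrite cisD (_ : _ - _ = (x.1 * cis x.2 z) * (cis x.2 t%:C - 1)); last ring.
    rewrite cabsM (cabsM x.1); apply: ler_pM; rewrite ?mulr_ge0 ?cabs_ge0 //; last first.
      by apply: bt; exact: map_f.
    rewrite ler_wpM2l ?cabs_ge0 // cabs_cis ler_expR; apply: le_trans (ler_norm _) _.
    rewrite normrN normrM ler_wpM2l // ler_norml; move: zb => /andP[cz zd].
    have := ler_norm (- c); have := ler_norm d; rewrite normrN.
    have := normr_ge0 c; have := normr_ge0 d.
    have := ler_norm (- d); have := ler_norm c; rewrite normrN.
    by move=> *; apply/andP; split; lra.
  rewrite -mulr_suml mulrA ler_pdivrMr // mulrC ler_wpM2l ?(ltW e3) //.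
  by rewrite /K lerDl.
move: h1 h2 h3; set p := \sum_(x <- s) _; set q := \sum_(x <- s) _ => h1 h2 h3.
have := cabs_trans q (f (z + t%:C)) (f z); have := cabs_trans p q (f z).
rewrite (cabsBC p (f z)); lra.
Qed.

End ApAlgebra.

(** * Quantitative unique continuation *)

Section Continuation.
Variable R : realType.
Implicit Types (a b : \bar R) (c d e r t M eta kap : R) (z y h : R[i]) (f g : R[i] -> R[i]).

Definition bholo f M (D : set R[i]) := forall y, D y -> holo f y /\ cabs (f y) <= M.

(** The small disc controls finitely many Taylor coefficients, the bound [M] the
    remainder. *)
Lemma small_step r M eta : 0 < r -> 0 < M -> 0 < eta ->
  exists2 kap : R, 0 < kap & forall f z, bholo f M (disc z r) ->
    (forall y, disc z (r / 8) y -> cabs (f y) <= kap) ->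
    forall y, disc z (r / 4) y -> cabs (f y) <= eta.
Proof.
move=> r0 M0 eta0.
have [n hn] := @geom_small R (1 / 2) (eta / 2 / M) ltac:(lra) ltac:(by rewrite !divr_gt0).
rewrite ltr_pdivlMr // in hn.
pose K : R := \sum_(k < n) 4 ^+ k + 1.
have K0 : 0 < K by rewrite ltr_wpDl // sumr_ge0 // => k _; rewrite exprn_ge0.
exists (eta / 2 / K); first by rewrite !divr_gt0.
move=> f z fh fk y yD.
have [cf [g [hg cg _ gM]]] := taylor r0 (fun y yD => (fh y yD).1).
have r8 : 0 < r / 8 <= r by apply/andP; split; lra.
have rr : 0 < r <= r by rewrite r0 lexx.
pose h := y - z; have hr : cabs h <= r / 4 by [].
have -> : y = z + h by rewrite /h; ring.
rewrite (hg n); apply: le_trans (cabsD _ _) _.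
have h1 : cabs (h ^+ n * g n (z + h)) <= (1 / 2) ^+ n * M.
  rewrite cabsM cabsX.
  have gb : cabs (g n (z + h)) <= (2 / r) ^+ n * M.
    apply: (gM n r M rr (fun y yD => (fh y yD).2)).
    by rewrite /disc /= addrC addKr; lra.
  apply: le_trans (_ : (r / 4) ^+ n * ((2 / r) ^+ n * M) <= _).
    by rewrite ler_pM ?exprn_ge0 ?cabs_ge0 // lerXn2r ?nnegrE ?cabs_ge0 //; lra.
  rewrite mulrA -exprMn (_ : r / 4 * (2 / r) = 1 / 2) //.
  by field; rewrite gt_eqF.
have h2 : cabs (\sum_(k < n) cf k * h ^+ k) <= eta / 2.
  apply: le_trans (cabs_sum _ _ _) _.
  apply: (@le_trans _ _ (\sum_(k < n) 4 ^+ k * (eta / 2 / K))).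
    apply: ler_sum => k _; rewrite cabsM cabsX cg.
    have zz : disc z (r / 8) z by rewrite /disc /= subrr cabs0; lra.
    have gb := gM k (r / 8) _ r8 fk z zz.
    apply: le_trans (_ : (2 / (r / 8)) ^+ k * (eta / 2 / K) * (r / 4) ^+ k <= _).
      by rewrite ler_pM ?exprn_ge0 ?cabs_ge0 // lerXn2r ?nnegrE ?cabs_ge0 //; lra.
    rewrite mulrAC -exprMn (_ : 2 / (r / 8) * (r / 4) = 4) //.
    by field; rewrite gt_eqF.
  rewrite -mulr_suml mulrA ler_pdivrMr // mulrC ler_wpM2l ?divr_ge0 ?(ltW eta0) //.
  by rewrite /K lerDl.
lra.
Qed.

Lemma band_convex c d z y t : 0 <= t <= 1 -> band c d z -> band c d y ->
  band c d (z + t%:C * (y - z)).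
Proof.
move=> /andP[t0 t1] /andP[h1 h2] /andP[h3 h4]; rewrite /band /=.
have -> : complex.Im (z + t%:C * (y - z)) = (1 - t) * complex.Im z + t * complex.Im y.
  by case: z {h1 h2}; case: y {h3 h4} => * /=; ring.
apply/andP; split; nra.
Qed.

(** A chain of overlapping discs carries smallness from one disc to another at
    bounded distance, uniformly over bounded holomorphic functions. *)
Lemma small_propagates c d r M n : 0 < r -> 0 < M -> forall eta, 0 < eta ->
  exists2 kap : R, 0 < kap & forall f, bholo f M (band (c - r) (d + r)) ->
    forall z y, band c d z -> band c d y -> cabs (y - z) <= n%:R * (r / 8) ->
    (forall x, disc z (r / 8) x -> cabs (f x) <= kap) ->
    forall x, disc y (r / 8) x -> cabs (f x) <= eta.
Proof.
move=> r0 M0; elim: n => [|n IH] eta eta0.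
  exists eta => // f _ z y _ _; rewrite mul0r => zy fk x xD; apply: fk.
  have /cabs_eq0/subr0_eq <- // : cabs (y - z) = 0.
  by apply/eqP; rewrite eq_le zy cabs_ge0.
have [k1 k10 h1] := small_step r0 M0 eta0; have [kap kap0 h2] := IH k1 k10.
exists kap => // f fh z y zb yb zy fk x xD.
have n0 : 0 < n.+1%:R :> R by rewrite ltr0n.
have nC : n.+1%:R != 0 :> R[i] by rewrite pnatr_eq0.
pose t : R := n%:R / n.+1%:R.
have t01 : 0 <= t <= 1.
  by rewrite divr_ge0 //= /t ler_pdivrMr // mul1r ler_nat.
pose y' := z + t%:C * (y - z).
have yb' : band c d y' by exact: band_convex.
have et : 1 - t = n.+1%:R^-1.
  by rewrite /t -natr1; field; rewrite natr1 gt_eqF.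
have yy' : cabs (y - y') <= r / 8.
  rewrite (_ : y - y' = (1 - t)%:C * (y - z)); last by rewrite /y' rmorphB rmorph1; ring.
  rewrite cabsM cabsC et ger0_norm ?invr_ge0 ?(ltW n0) // mulrC ler_pdivrMr // mulrC.
  exact: zy.
have y'z : cabs (y' - z) <= n%:R * (r / 8).
  rewrite (_ : y' - z = t%:C * (y - z)); last by rewrite /y'; ring.
  move: t01 => /andP[t0 _].
  rewrite cabsM cabsC ger0_norm //; apply: le_trans (ler_wpM2l t0 zy) _.
  rewrite (_ : t * _ = n%:R * (r / 8)) //.
  by rewrite /t -natr1; field; rewrite natr1 gt_eqF.
apply: (h1 f y') => [x' x'D|x' x'D|].
- by apply: fh; exact: band_disc x'D.
- exact: (h2 f fh z y').
- have := cabs_trans y x y'; move: xD; rewrite /disc /=; lra.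
Qed.

End Continuation.

Section ApZeros.
Variable R : realType.
Implicit Types (a b : \bar R) (c d e r t M eta kap : R) (z y h : R[i]) (f g : R[i] -> R[i]).

(** A nonzero value recurs along a Bohr set, hence at bounded distance from any
    point of the band, and unique continuation brings it within distance [r]. *)
Lemma ap_lower_bound a b f z0 c d r : ap a b f -> strip a b z0 -> f z0 != 0 ->
  inner a b c d -> 0 < r -> exists2 kap : R, 0 < kap &
    forall z, band c d z -> exists2 y, disc z r y & kap <= cabs (f y).
Proof.
move=> fa z0S fz0 cd r0.
have e0 : 0 < cabs (f z0) / 2 by rewrite divr_gt0 ?cabs_gt0.
pose c' := Num.min c (complex.Im z0); pose d' := Num.max d (complex.Im z0).
have cd' : inner a b c' d' by apply: inner_join => //; exact: strip_inner.
have [s s0 scd] := inner_enlarge cd'.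
pose r' := Num.min s (8 * r).
have r'0 : 0 < r' by rewrite lt_min s0 mulr_gt0.
have r's : r' <= s by rewrite ge_min lexx.
have r'r : r' / 8 <= r by rewrite ler_pdivrMr // mulrC ge_min lexx orbT.
have rcd : inner a b (c' - r') (d' + r') by apply: inner_sub scd _ _; lra.
have [M M0 hM] := ap_bounded fa rcd.
have [mu [dl [dl0 hmu]]] := ap_bohr fa cd' e0.
have [ts hts] := bohr_cover mu dl0.
have [n hn] := nat_ub ((\sum_(x <- ts) `|x| + (d' - c')) / (r' / 8)).
rewrite ler_pdivrMr ?divr_gt0 // in hn.
have e20 : 0 < cabs (f z0) / 4 by rewrite divr_gt0 ?cabs_gt0.
have [kap kap0 hk] := @small_propagates R c' d' r' M n r'0 M0 _ e20.
exists kap => // z zb; apply: contrapT => noy.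
have z0b : band c' d' z0 by rewrite /band /= ge_min le_max lexx !orbT.
have zb' : band c' d' z by apply: band_sub zb; rewrite ?ge_min ?le_max lexx.
pose t := complex.Re z - complex.Re z0; have [s1 s1ts bs] := hts t.
pose y := z0 + (t - s1)%:C; have yb : band c' d' y by exact: band_real.
have fy : cabs (f z0) / 2 <= cabs (f y).
  have := hmu _ bs z0 z0b; rewrite -/y; have := cabs_sub (f z0) (f y).
  rewrite (cabsBC (f z0)); lra.
have yz : cabs (y - z) <= n%:R * (r' / 8).
  apply: le_trans hn; apply: le_trans (cabs_le_ReIm _) _; apply: lerD.
    have -> : complex.Re (y - z) = - s1 by rewrite /y /t ReB ReD /=; ring.
    rewrite normrN big_mkcond (big_rem s1 s1ts) /= lerDl sumr_ge0 //.
  move: z0b zb' => /andP[h1 h2] /andP[h3 h4].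
  have -> : complex.Im (y - z) = complex.Im z0 - complex.Im z.
    by rewrite /y ImB ImD /=; ring.
  by rewrite ler_norml; apply/andP; split; lra.
have yy : disc y (r' / 8) y by rewrite /disc /= subrr cabs0 divr_ge0 ?ltW.
have : cabs (f y) <= cabs (f z0) / 4.
  apply: (hk f _ z y) => // [x xb|x xD].
    by split; [apply: ap_holo fa _; exact: band_strip xb | exact: hM].
  rewrite leNgt; apply/negP => fx; apply: noy; exists x; last exact: ltW.
  exact: le_trans r'r.
have : 0 < cabs (f z0) by rewrite cabs_gt0.
lra.
Qed.

(** By the lower bound near [z], the Taylor series at [z] has a nonzero
    coefficient; the first one decides. *)
Lemma ap_zeros_isolated a b f z0 z : ap a b f -> strip a b z0 -> f z0 != 0 ->
  strip a b z -> exists2 s : R, 0 < s & forall y, 0 < cabs (y - z) < s -> f y != 0.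
Proof.
move=> fa z0S fz0 zS.
have [r r0 rcd] := inner_enlarge (strip_inner zS).
have fh y : disc z r y -> holo f y.
  move=> yD; apply: ap_holo fa _; apply: band_strip rcd _.
  exact: band_disc (band_Im z) yD.
have [M M0 hM] := ap_bounded fa rcd.
have fM y : disc z r y -> cabs (f y) <= M.
  by move=> yD; apply: hM; exact: band_disc (band_Im z) yD.
have [cf [g [hg cg gh gM]]] := taylor r0 fh.
have rr : 0 < r <= r by rewrite r0 lexx.
have [k ck] : exists k, cf k != 0.
  apply: contrapT => nok.
  have ck k : cf k = 0.
    by apply/eqP; apply: contrapT => /negP h; apply: nok; exists k.
  have r4 : 0 < r / 4 by rewrite divr_gt0.
  have [kap kap0 hk] := ap_lower_bound fa z0S fz0 (strip_inner zS) r4.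
  have [y yD ky] := hk z (band_Im z).
  have [n hn] := @geom_small R (1 / 2) (kap / M) ltac:(lra) ltac:(by rewrite divr_gt0).
  rewrite ltr_pdivlMr // in hn.
  suff : cabs (f y) <= (1 / 2) ^+ n * M by lra.
  have -> : y = z + (y - z) by ring.
  rewrite (hg n) big1 ?add0r => [|i _]; last by rewrite ck mul0r.
  rewrite cabsM cabsX.
  have gb : cabs (g n (z + (y - z))) <= (2 / r) ^+ n * M.
    apply: (gM n r M rr fM); rewrite /disc /= addrC addKr.
    by move: yD; rewrite /disc /=; lra.
  apply: le_trans (_ : (r / 4) ^+ n * ((2 / r) ^+ n * M) <= _).
    by rewrite ler_pM ?exprn_ge0 ?cabs_ge0 // lerXn2r ?nnegrE ?cabs_ge0 ?(ltW r4).
  rewrite mulrA -exprMn (_ : r / 4 * (2 / r) = 1 / 2) //.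
  by field; rewrite gt_eqF.
have [k0 ck0 kmin] := ex_minnP (ex_intro (fun k => cf k != 0) k ck).
have gz : 0 < cabs (g k0 z) by rewrite cabs_gt0 -cg.
have zz : disc z r z by rewrite /disc /= subrr cabs0 ltW.
have [s s0 hs] := holo_cont (gh k0 z zz) gz.
exists s => // y /andP[yz ys].
have gy : g k0 y != 0.
  rewrite -cabs_gt0; have := hs y I ys; have := cabs_sub (g k0 z) (g k0 y).
  rewrite (cabsBC (g k0 z)); lra.
have -> : y = z + (y - z) by ring.
rewrite (hg k0) big1 ?add0r => [|i _].
  have -> : z + (y - z) = y by ring.
  by rewrite mulf_neq0 ?expf_neq0 // -cabs_gt0.
have [-> |ci] := eqVneq (cf i) 0; first by rewrite mul0r.
by have := kmin _ ci; rewrite leqNgt ltn_ord.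
Qed.

End ApZeros.

(** * Circles avoiding the zeros *)

Section Circles.
Variable R : realType.
Implicit Types (c d e r t M A : R) (z y h : R[i]) (f g : R[i] -> R[i]).

Lemma uniform_lower n (P : nat -> R -> Prop) :
  (forall k e d, P k e -> d <= e -> P k d) ->
  (forall k, (k < n)%N -> exists2 e : R, 0 < e & P k e) ->
  exists2 e : R, 0 < e & forall k, (k < n)%N -> P k e.
Proof.
move=> Pd; elim: n => [|n IH] h; first by exists 1.
have [k kn|e1 e10 h1] := IH; first by apply: h; exact: ltnW.
have [e2 e20 h2] := h n (ltnSn n).
exists (Num.min e1 e2); first by rewrite lt_min e10.
move=> k; rewrite ltnS leq_eqVlt => /orP[/eqP ->|/h1 h3].
  by apply: Pd h2 _; rewrite ge_min lexx orbT.
by apply: Pd h3 _; rewrite ge_min lexx.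
Qed.

Definition circle_lower f z r e :=
  exists2 rho : R, 0 < rho <= r / 4 & forall y, cabs (y - z) = rho -> e <= cabs (f y).

Definition taylor_bounds f z r A (cf : nat -> R[i]) (g : nat -> R[i] -> R[i]) :=
  (forall n h, f (z + h) = \sum_(k < n) cf k * h ^+ k + h ^+ n * g n (z + h)) /\
  (forall n y, disc z r y -> cabs (g n y) <= (2 / r) ^+ n * A).

Lemma circle_lower_mono r A (x : R) j (e1 e2 : R) :
  (forall f z cf G, taylor_bounds f z r A cf G ->
     x <= cabs (cf j) * (r / 4) ^+ j -> circle_lower f z r e1) -> e2 <= e1 ->
  forall f z cf G, taylor_bounds f z r A cf G ->
     x <= cabs (cf j) * (r / 4) ^+ j -> circle_lower f z r e2.
Proof.
move=> h e21 f z cf g h1 h2; have [rho rho1 h4] := h f z cf g h1 h2.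
by exists rho => // y /h4; exact: le_trans.
Qed.

(** Newton's polygon argument in its crudest form: if the [k]-th coefficient is
    not small, then on a small circle either its term dominates, or some earlier
    coefficient is not small either. *)
Lemma circle_lower_coef r A k : 0 < r -> 0 < A -> forall e, 0 < e ->
  exists2 e' : R, 0 < e' & forall f z cf G, taylor_bounds f z r A cf G ->
    e <= cabs (cf k) * (r / 4) ^+ k -> circle_lower f z r e'.
Proof.
move=> r0 A0; elim/ltn_ind: k => k IH e e0.
(* on the circle of radius [th * (r / 4)] the terms beyond the [k]-th are at most
   a quarter of it *)
pose th := Num.min 1 (e / (4 * A)).
have th0 : 0 < th by rewrite lt_min ltr01 divr_gt0 // mulr_gt0.
have th1 : th <= 1 by rewrite ge_min lexx.
have thA : th * A <= e / 4.
  have : th <= e / (4 * A) by rewrite ge_min lexx orbT.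
  by rewrite ler_pdivlMr ?mulr_gt0 //; lra.
have thk : 0 < th ^+ k by rewrite exprn_gt0.
have k0 : 0 < k.+1%:R :> R by rewrite ltr0n.
pose e1 := e * th ^+ k / (4 * k.+1%:R).
have e10 : 0 < e1 by rewrite divr_gt0 ?mulr_gt0.
have [e2 e20 h2] := @uniform_lower k (fun j e' => forall f z cf G, taylor_bounds f z r A cf G ->
    e1 <= cabs (cf j) * (r / 4) ^+ j -> circle_lower f z r e')
  (fun j _ _ => @circle_lower_mono r A _ j _ _) (fun j jk => IH j jk e1 e10).
exists (Num.min e2 (e * th ^+ k / 2)).
  by rewrite lt_min e20 divr_gt0 // mulr_gt0.
move=> f z cf g fT ek; have [hf gM] := fT.
have [[j jk ej]|small] := pselect (exists2 j, (j < k)%N & e1 <= cabs (cf j) * (r / 4) ^+ j).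
  have [rho rho1 h4] := h2 j jk f z cf g fT ej.
  by exists rho => // y /h4; apply: le_trans; rewrite ge_min lexx.
exists (th * (r / 4)).
  by apply/andP; split; nra.
move=> y yz; apply: le_trans (_ : e * th ^+ k / 2 <= _); first by rewrite ge_min lexx orbT.
pose h := y - z; have eh : cabs h = th * (r / 4) by [].
have -> : y = z + h by rewrite /h; ring.
rewrite (hf k.+1) big_ord_recr /=.
have b1 : e * th ^+ k <= cabs (cf k * h ^+ k).
  by rewrite cabsM cabsX eh exprMn mulrCA [th ^+ k * _]mulrC ler_pM2r.
have b2 : cabs (h ^+ k.+1 * g k.+1 (z + h)) <= e * th ^+ k / 4.
  rewrite cabsM cabsX eh.
  have gb : cabs (g k.+1 (z + h)) <= (2 / r) ^+ k.+1 * A.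
    apply: gM; rewrite /disc /= addrC addKr eh; nra.
  apply: le_trans (_ : (th * (r / 4)) ^+ k.+1 * ((2 / r) ^+ k.+1 * A) <= _).
    by rewrite ler_wpM2l // exprn_ge0 // mulr_ge0 ?ltW ?divr_gt0.
  rewrite mulrA -exprMn (_ : th * (r / 4) * (2 / r) = th / 2); last first.
    by field; rewrite gt_eqF.
  apply: le_trans (_ : th ^+ k.+1 * A <= _).
    by rewrite ler_wpM2r ?(ltW A0) // lerXn2r ?nnegrE ?divr_ge0 ?(ltW th0) //; lra.
  rewrite exprSr -mulrA; have : th ^+ k * (th * A) <= th ^+ k * (e / 4) by rewrite ler_pM2l.
  lra.
have b3 : cabs (\sum_(j < k) cf j * h ^+ j) <= e * th ^+ k / 4.
  apply: le_trans (cabs_sum _ _ _) _.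
  apply: (@le_trans _ _ (\sum_(j < k) e1)).
    apply: ler_sum => j _; rewrite cabsM cabsX eh.
    rewrite exprMn mulrCA; apply: (@le_trans _ _ (cabs (cf j) * (r / 4) ^+ j)).
      rewrite ler_piMl ?mulr_ge0 ?cabs_ge0 ?exprn_ge0 ?divr_ge0 ?(ltW r0) //.
      by apply: exprn_ile1 => //; exact: ltW.
    rewrite leNgt; apply/negP => hj; apply: small; exists j; [exact: ltn_ord | exact: ltW].
  rewrite sumr_const card_ord (_ : e1 *+ k = k%:R * e1); last by rewrite mulr_natl.
  rewrite /e1 mulrA ler_pdivrMr ?mulr_gt0 //.
  have : k%:R <= k.+1%:R :> R by rewrite ler_nat.
  have : 0 < e * th ^+ k by rewrite mulr_gt0.
  nra.
set S := \sum_(j < k) _; set T := cf k * h ^+ k; set U := h ^+ k.+1 * _.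
have := cabs_sub T (S + T + U); rewrite (_ : T - (S + T + U) = - (S + U)); last ring.
rewrite cabsN; have := cabsD S U; move: b1 b2 b3; rewrite -/S -/T -/U; lra.
Qed.

(** If [f] is not small on the disc, one of its first Taylor coefficients is not
    small, with constants independent of [f]. *)
Lemma exists_circle_lower r A e : 0 < r -> 0 < A -> 0 < e ->
  exists2 e' : R, 0 < e' & forall f z, bholo f A (disc z r) ->
    (exists2 y, disc z (r / 4) y & e <= cabs (f y)) -> circle_lower f z r e'.
Proof.
move=> r0 A0 e0.
have [n hn] := @geom_small R (1 / 2) (e / 2 / A) ltac:(lra) ltac:(by rewrite !divr_gt0).
rewrite ltr_pdivlMr // in hn.
have n0 : 0 < n.+1%:R :> R by rewrite ltr0n.
have e10 : 0 < e / 2 / n.+1%:R by rewrite !divr_gt0.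
have [e2 e20 h2] := @uniform_lower n.+1 (fun j e' => forall f z cf G, taylor_bounds f z r A cf G ->
    e / 2 / n.+1%:R <= cabs (cf j) * (r / 4) ^+ j -> circle_lower f z r e')
  (fun j _ _ => @circle_lower_mono r A _ j _ _)
  (fun j jk => circle_lower_coef j r0 A0 e10).
exists e2 => // f z fh [y yD ey].
have [cf [g [hg cg _ gM]]] := taylor r0 (fun y yD => (fh y yD).1).
have rr : 0 < r <= r by rewrite r0 lexx.
have {}gM k x : disc z r x -> cabs (g k x) <= (2 / r) ^+ k * A.
  by apply: gM => // x' x'D; have [] := fh x' x'D.
suff [j jn ej] : exists2 j, (j < n.+1)%N & e / 2 / n.+1%:R <= cabs (cf j) * (r / 4) ^+ j.
  exact: h2 jn _ _ _ _ (conj hg gM) ej.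
apply: contrapT => noj.
pose h := y - z; have hr : cabs h <= r / 4 by [].
have r4 : 0 < r / 4 by rewrite divr_gt0.
have : cabs (f (z + h)) < e.
  rewrite (hg n.+1); apply: le_lt_trans (cabsD _ _) _.
  have b1 : cabs (h ^+ n.+1 * g n.+1 (z + h)) < e / 2.
    rewrite cabsM cabsX.
    have gb : cabs (g n.+1 (z + h)) <= (2 / r) ^+ n.+1 * A.
      by apply: gM; rewrite /disc /= addrC addKr; lra.
    apply: le_lt_trans (_ : (r / 4) ^+ n.+1 * ((2 / r) ^+ n.+1 * A) < _).
      by rewrite ler_pM ?exprn_ge0 ?cabs_ge0 // lerXn2r ?nnegrE ?cabs_ge0 ?(ltW r4).
    rewrite mulrA -exprMn (_ : r / 4 * (2 / r) = 1 / 2); last by field; rewrite gt_eqF.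
    apply: le_lt_trans hn; rewrite ler_pM2r // exprS ler_piMl ?exprn_ge0 //; lra.
  have b2 : cabs (\sum_(j < n.+1) cf j * h ^+ j) <= e / 2.
    apply: le_trans (cabs_sum _ _ _) _.
    apply: (@le_trans _ _ (\sum_(j < n.+1) (e / 2 / n.+1%:R))).
      apply: ler_sum => j _; rewrite cabsM cabsX.
      apply: (@le_trans _ _ (cabs (cf j) * (r / 4) ^+ j)).
        by rewrite ler_wpM2l ?cabs_ge0 // lerXn2r ?nnegrE ?cabs_ge0 ?(ltW r4).
      rewrite leNgt; apply/negP => hj; apply: noj; exists j; [exact: ltn_ord | exact: ltW].
    by rewrite sumr_const card_ord -[X in X <= _]mulr_natr divfK // gt_eqF.
  lra.
have -> : z + h = y by rewrite /h; ring.
lra.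
Qed.

End Circles.

(** * An invariant mean *)

Section Mean.
Variable R : realType.
Implicit Types (c d e r s t x B L : R) (z y h l m : R[i]) (f g : R -> R[i]).

(** Averaging over [N^2] points with mesh [1 / N], where [N = n.+1], covers an
    interval of length [N] more and more finely: in the limit translation by any
    real number has no effect. *)
Definition average f n : R[i] :=
  (n.+1%:R ^+ 2)^-1 * \sum_(k < n.+1 ^ 2) f (k%:R * inv_succ R n).

Definition is_mean f l := is_ulim (average f) l.

Lemma average_dom f (g : R -> R) n : (forall t, cabs (f t) <= g t) ->
  cabs (average f n) <= complex.Re (average (fun t => (g t)%:C) n).
Proof.
move=> fg; rewrite /average -(rmorph_nat (real_complex R)) -rmorphXn -fmorphV.
rewrite -(rmorph_sum (real_complex R)) -rmorphM /= cabsM cabsC.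
rewrite ger0_norm ?invr_ge0 ?exprn_ge0 // ler_wpM2l ?invr_ge0 ?exprn_ge0 //.
by apply: le_trans (cabs_sum _ _ _) _; apply: ler_sum.
Qed.

Lemma average_cst l n : average (fun=> l) n = l.
Proof.
by rewrite /average sumr_const card_ord -[l *+ _]mulr_natl natrX mulrA mulVf ?mul1r.
Qed.

Lemma average_bounded f B n : (forall t, cabs (f t) <= B) -> cabs (average f n) <= B.
Proof. by move=> /(average_dom n) /le_trans; apply; rewrite average_cst. Qed.

Lemma mean_ex f B : (forall t, cabs (f t) <= B) -> exists l, is_mean f l.
Proof. by move=> fB; apply: (@bounded_ulim R _ B) => n; exact: average_bounded. Qed.

Lemma is_mean_cst l : is_mean (fun=> l) l.
Proof.
move=> e e0; apply: filterE => n /=.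
by rewrite average_cst subrr cabs0.
Qed.

Lemma is_meanD f g l m : is_mean f l -> is_mean g m ->
  is_mean (fun t => f t + g t) (l + m).
Proof.
move=> fl gm; have := ulimD fl gm; rewrite /is_mean.
congr is_ulim; apply/funext => n.
by rewrite /average big_split mulrDr.
Qed.

Lemma is_meanZ z f l : is_mean f l -> is_mean (fun t => z * f t) (z * l).
Proof.
move=> fl; have := ulimZ z fl; rewrite /is_mean; congr is_ulim; apply/funext => n.
by rewrite /average -mulr_sumr mulrCA.
Qed.

Lemma is_mean_sum (I : Type) (u : seq I) (F : I -> R -> R[i]) (l : I -> R[i]) :
  (forall i, List.In i u -> is_mean (F i) (l i)) ->
  is_mean (fun t => \sum_(i <- u) F i t) (\sum_(i <- u) l i).
Proof.
elim: u => [|i u IH] H.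
  rewrite big_nil; under eq_fun do rewrite big_nil; exact: is_mean_cst.
rewrite big_cons; under eq_fun do rewrite big_cons.
by apply: is_meanD; [apply: H; left | apply: IH => j ju; apply: H; right].
Qed.

Lemma is_mean_dom f (g : R -> R) l m : is_mean f l -> is_mean (fun t => (g t)%:C) m ->
  (forall t, cabs (f t) <= g t) -> cabs l <= complex.Re m.
Proof. by move=> fl gm fg; apply: (ulim_dom fl gm) => n; exact: average_dom. Qed.

Lemma is_mean_uniq f l m : is_mean f l -> is_mean f m -> l = m.
Proof. exact: ulim_uniq. Qed.

Lemma is_mean_le f l B : is_mean f l -> (forall t, cabs (f t) <= B) -> cabs l <= B.
Proof. by move=> fl fB; apply: (ulim_le fl) => n; exact: average_bounded. Qed.

(** Shifting by one mesh telescopes to two boundary terms. *)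
Lemma average_step f B j n : (forall t, cabs (f t) <= B) ->
  cabs (average (fun t => f (t + j%:R * inv_succ R n)) n - average f n) <=
  j%:R * (2 * B * (n.+1%:R ^+ 2)^-1).
Proof.
move=> fB; elim: j => [|j IH].
  have -> : (fun t => f (t + 0%:R * inv_succ R n)) = f.
    by apply/funext => t; rewrite mul0r addr0.
  by rewrite subrr cabs0 mul0r.
apply: le_trans (cabs_trans (average (fun t => f (t + j%:R * inv_succ R n)) n) _ _) _.
rewrite (_ : j.+1%:R * (2 * B * _) = 2 * B * (n.+1%:R ^+ 2)^-1 +
  j%:R * (2 * B * (n.+1%:R ^+ 2)^-1)); last by rewrite -natr1; ring.
rewrite lerD //.
rewrite /average -mulrBr cabsM cabsV cabsX cabs_nat mulrC ler_wpM2r //.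
pose F (k : nat) := f (k%:R * inv_succ R n + j%:R * inv_succ R n).
have -> : \sum_(k < n.+1 ^ 2) f (k%:R * inv_succ R n + j.+1%:R * inv_succ R n) =
          \sum_(0 <= k < n.+1 ^ 2) F k.+1.
  rewrite big_mkord; apply: eq_bigr => k _; rewrite /F -!natr1; congr f; ring.
rewrite -(big_mkord xpredT F) -sumrB telescope_sumr //.
by apply: le_trans (cabsB _ _) _; rewrite (_ : 2 * B = B + B) ?lerD ?fB //; ring.
Qed.

(** A real shift is replaced by the nearest smaller multiple of the mesh, at the
    cost of one mesh times the Lipschitz constant. *)
Lemma is_mean_shift f B L s l : (forall t, cabs (f t) <= B) ->
  (forall t x, cabs (f t - f x) <= L * `|t - x|) ->
  is_mean f l -> is_mean (fun t => f (t + s)) l.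
Proof.
move=> fB fL.
have B0 : 0 <= B by exact: le_trans (cabs_ge0 (f 0)) _.
have L0 : 0 <= L.
  have := fL 1 0; rewrite subr0 normr1 mulr1; exact: le_trans (cabs_ge0 _).
wlog s0 : f s l fB fL / 0 <= s.
  move=> hwlog fl; have [s0|s0] := leP 0 s; first exact: hwlog.
  have [m hm] := mean_ex (fun t => fB (t + s)).
  suff -> : l = m by [].
  have e1 : (fun t => f (t - s + s)) = f by apply/funext => t; rewrite subrK.
  have := hwlog (fun t => f (t + s)) (- s) m; rewrite e1 => /(_ _ _ _ hm) h.
  apply: is_mean_uniq fl _; apply: h => //; last by rewrite oppr_ge0 ltW.
  by move=> t x; have := fL (t + s) (x + s); rewrite opprD addrACA subrr addr0.
move=> fl; have [m hm] := mean_ex (fun t => fB (t + s)).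
suff -> : l = m by [].
apply: (ulim_null fl hm) => e e0.
pose K := L + 2 * B * s + 1.
have K0 : 0 < K by rewrite ltr_wpDl // addr_ge0 // !mulr_ge0.
have eK : 0 < e / K by rewrite divr_gt0.
have [n0 hn0] := inv_succ_small eK; exists n0 => n /hn0 hn.
have i0 := inv_succ_gt0 R n; set i := inv_succ R n in hn i0.
have N0 : 0 < n.+1%:R :> R by rewrite ltr0n.
have ei : n.+1%:R * i = 1 by rewrite /i /inv_succ divff // gt_eqF.
pose j := Num.truncn (s * n.+1%:R).
have /andP[j1 j2] : j%:R <= s * n.+1%:R < j.+1%:R.
  by apply: truncn_itv; rewrite mulr_ge0 // ltW.
have si : s = (s * n.+1%:R) * i by rewrite -mulrA ei mulr1.
have sj : `|s - j%:R * i| <= i.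
  rewrite {1}si -mulrBl normrM (gtr0_norm i0) ler_piMl ?(ltW i0) //.
  by rewrite ger0_norm ?subr_ge0 //; move: j2; rewrite -natr1; lra.
have h1 := average_step j n fB; rewrite -/i in h1.
have h2 : cabs (average (fun t => f (t + s)) n - average (fun t => f (t + j%:R * i)) n) <= L * i.
  rewrite /average -mulrBr -sumrB.
  apply: (@average_bounded (fun t => f (t + s) - f (t + j%:R * i))) => t.
  apply: le_trans (fL _ _) _; rewrite opprD addrACA subrr add0r.
  by rewrite ler_wpM2l.
have h3 : j%:R * (2 * B * (n.+1%:R ^+ 2)^-1) <= 2 * B * s * i.
  have -> : (n.+1%:R ^+ 2)^-1 = i ^+ 2 by rewrite /i /inv_succ exprVn.
  have -> : 2 * B * s * i = (s * n.+1%:R * i) * (2 * B * i) by rewrite -si; ring.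
  have -> : j%:R * (2 * B * i ^+ 2) = j%:R * i * (2 * B * i) by ring.
  rewrite ler_wpM2r ?mulr_ge0 ?(ltW i0) // ler_pM2r //.
have := cabs_trans (average (fun t => f (t + j%:R * i)) n) (average f n) (average (fun t => f (t + s)) n).
have h5 := le_trans h1 h3; rewrite cabsBC in h5; rewrite cabsBC in h2.
clear h1 h3.
have h4 : K * i <= e by rewrite mulrC -ler_pdivlMr // ltW.
have : K * i = L * i + 2 * B * s * i + i by rewrite /K; ring.
lra.
Qed.

End Mean.

(** * Means of holomorphic functions along horizontal lines *)

Section MeanHolo.
Variable R : realType.
Implicit Types (a b : \bar R) (c d e r s t B L : R) (x z y h l m : R[i]).
Implicit Types (f g : R[i] -> R[i]).

Definition hbounded a b f := (forall z, strip a b z -> holo f z) /\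
  forall c d, inner a b c d -> exists2 B : R, 0 < B & forall z, band c d z -> cabs (f z) <= B.

Lemma hbounded_line a b f z : hbounded a b f -> strip a b z ->
  exists2 B : R, 0 < B & forall t, cabs (f (z + t%:C)) <= B.
Proof.
move=> [_ fB] /strip_inner /fB [B B0 hB]; exists B => // t.
by apply: hB; apply: band_real; exact: band_Im.
Qed.

(** Locally by Schwarz's lemma; for distant points by boundedness. *)
Lemma hbounded_lipschitz a b f c d : hbounded a b f -> inner a b c d ->
  exists s L, [/\ 0 < s, 0 < L & forall z y, band c d z -> band c d y ->
    cabs (f z - f y) <= L * cabs (z - y)].
Proof.
move=> [fh fB] cd; have [s s0 scd] := inner_enlarge cd.
have [B B0 hB] := fB _ _ scd; exists s, (2 / s * B).
have L0 : 0 < 2 / s * B by rewrite mulr_gt0 ?divr_gt0.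
split => // z y zb yb; rewrite cabsBC (cabsBC z).
have [hs|hs] := leP (cabs (y - z)) s.
  have := @holo_lipschitz R f z s B s0 _ _ (y - z) hs.
  rewrite (_ : z + (y - z) = y); last ring.
  apply => x xD; last by apply: hB; exact: band_disc xD.
  by apply: fh; apply: band_strip scd _; exact: band_disc xD.
apply: le_trans (cabsB _ _) _.
have hz : cabs (f z) <= B by apply: hB; apply: band_sub zb; lra.
have hy : cabs (f y) <= B by apply: hB; apply: band_sub yb; lra.
have : 2 / s * B * s <= 2 / s * B * cabs (y - z) by rewrite ler_pM2l // ltW.
have -> : 2 / s * B * s = 2 * B by field; rewrite gt_eqF.
lra.
Qed.

(** The mean of [f] along the horizontal line through [z] is a holomorphic
    function of [z], with a quadratic remainder, and does not change in the real
    direction: so its derivative vanishes. *)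
Lemma mean_strip_cst a b f : hbounded a b f ->
  forall z y l, strip a b z -> strip a b y ->
  is_mean (fun t => f (z + t%:C)) l -> is_mean (fun t => f (y + t%:C)) l.
Proof.
move=> fhb z y l zS yS zl; have [fh fB] := fhb.
pose c := Num.min (complex.Im z) (complex.Im y).
pose d := Num.max (complex.Im z) (complex.Im y).
have cd : inner a b c d by apply: inner_join; exact: strip_inner.
have zb : band c d z by rewrite /band /= ge_min le_max !lexx.
have yb : band c d y by rewrite /band /= ge_min le_max !lexx !orbT.
have [s s0 scd] := inner_enlarge cd; have [B B0 hB] := fB _ _ scd.
have [s' [L [_ L0 fL]]] := hbounded_lipschitz fhb scd.
have sb x : band c d x -> band (c - s) (d + s) x by apply: band_sub; lra.
have strB x : band (c - s) (d + s) x -> strip a b x by exact: band_strip.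
have ex_f' x : exists m, band c d x -> cabs m <= 2 / s * B /\ forall h, cabs h <= s ->
    cabs (f (x + h) - f x - m * h) <= (2 / s) ^+ 2 * B * cabs h ^+ 2.
  have [xb|xb] := pselect (band c d x); last by exists 0.
  have [||m hm] := @holo_quadratic R f x s B s0; last by exists m.
    by move=> x' xD; apply/fh/strB; exact: band_disc xD.
  by move=> x' xD; apply: hB; exact: band_disc xD.
have [f' hf'] := choice ex_f'.
have ex_phi x : exists m, band (c - s) (d + s) x -> is_mean (fun t => f (x + t%:C)) m.
  have [xb|xb] := pselect (band (c - s) (d + s) x); last by exists 0.
  have [m hm] := @mean_ex R (fun t => f (x + t%:C)) B (fun t => hB _ (band_real t xb)).
  by exists m.
have [phi hphi] := choice ex_phi.
pose K := (2 / s) ^+ 2 * B.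
have K0 : 0 <= K by rewrite mulr_ge0 ?exprn_ge0 ?divr_ge0 ?ltW.
have quad x h : band c d x -> cabs h <= s -> cabs (phi (x + h) - phi x) <= K * cabs h ^+ 2.
  move=> xb hs.
  have [m hm] := @mean_ex R (fun t => f' (x + t%:C)) (2 / s * B)
    (fun t => (hf' _ (band_real t xb)).1).
  have diff k : cabs k <= s -> cabs (phi (x + k) - phi x - m * k) <= K * cabs k ^+ 2.
    move=> ks; have xkb : band (c - s) (d + s) (x + k).
      by apply: band_disc xb _; rewrite addrC addKr.
    have M1 := is_meanD (is_meanD (hphi _ xkb) (is_meanZ (-1) (hphi _ (sb _ xb)))) (is_meanZ (- k) hm).
    have -> : phi (x + k) - phi x - m * k = phi (x + k) + -1 * phi x + - k * m by ring.
    apply: (is_mean_le M1) => t.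
    have -> : x + k + t%:C = x + t%:C + k by ring.
    have := (hf' _ (band_real t xb)).2 k ks.
    by congr (cabs _ <= _); ring.
  have m0 : m = 0.
    apply: cabs_le0 => e e0.
    pose x0 := Num.min s (e / (K + 1)).
    have x00 : 0 < x0 by rewrite lt_min s0 divr_gt0 //; lra.
    have x0s : x0 <= s by rewrite ge_min lexx.
    have x0e : x0 * (K + 1) <= e by rewrite -ler_pdivlMr ?ge_min ?lexx ?orbT //; lra.
    have := diff x0%:C; rewrite cabsC gtr0_norm // => /(_ x0s).
    have -> : phi (x + x0%:C) = phi x.
      apply: is_mean_uniq (hphi _ (band_real x0 (sb _ xb))) _.
      have := @is_mean_shift R (fun t => f (x + t%:C)) B L x0 (phi x)
        (fun t => hB _ (band_real t (sb _ xb))) _ (hphi _ (sb _ xb)).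
      have -> : (fun t => f (x + (t + x0)%:C)) = (fun t => f (x + x0%:C + t%:C)).
        by apply/funext => t; rewrite rmorphD /=; congr f; ring.
      apply => t t'; apply: le_trans (fL _ _ (band_real t (sb _ xb)) (band_real t' (sb _ xb))) _.
      by rewrite opprD addrACA subrr add0r -rmorphB cabsC.
    rewrite subrr sub0r cabsN cabsM cabsC gtr0_norm // expr2 mulrA ler_pM2r //.
    have : x0 * K <= x0 * (K + 1) by rewrite ler_pM2l //; lra.
    lra.
  by have := diff h hs; rewrite m0 mul0r subr0.
have yz : phi y = phi z.
  apply/eqP; rewrite -subr_eq0; apply/eqP/cabs_le0 => e e0.
  pose D := cabs (y - z).
  have D0 : 0 <= D by exact: cabs_ge0.
  have [n hn] := nat_ub (D / s + K * D ^+ 2 / e + 1).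
  have q1 : 0 <= D / s by rewrite divr_ge0 // ltW.
  have q2 : 0 <= K * D ^+ 2 / e by rewrite divr_ge0 ?(ltW e0) // mulr_ge0 ?exprn_ge0.
  have n0 : 0 < n%:R :> R by lra.
  have nC : n%:R != 0 :> R[i] by rewrite pnatr_eq0 -lt0n -(ltr_nat R).
  pose p j := z + (j%:R / n%:R)%:C * (y - z).
  have pb j : (j <= n)%N -> band c d (p j).
    move=> jn; apply: band_convex => //.
    by rewrite divr_ge0 //= ler_pdivrMr // mul1r ler_nat.
  have hD : cabs (n%:R^-1 * (y - z)) = D / n%:R.
    by rewrite cabsM cabsV cabs_nat mulrC.
  have pS j : p j.+1 = p j + n%:R^-1 * (y - z).
    by rewrite /p !rmorphM !fmorphV !rmorph_nat -natr1; field.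
  have steps j : (j <= n)%N -> cabs (phi (p j) - phi z) <= j%:R * (K * (D / n%:R) ^+ 2).
    elim: j => [|j IH] jn.
      have -> : p 0%N = z by rewrite /p mulr0n mul0r rmorph0 mul0r addr0.
      by rewrite subrr cabs0 mul0r.
    apply: le_trans (cabs_trans (phi (p j)) _ _) _.
    rewrite -natr1 mulrDl mul1r addrC lerD ?IH ?(ltnW jn) //.
    rewrite pS -hD; apply: quad; first by apply: pb; exact: ltnW.
    rewrite hD ler_pdivrMr // mulrC -ler_pdivrMr //; lra.
  have := steps n (leqnn n).
  have -> : p n = y by rewrite /p divff ?gt_eqF // mul1r; ring.
  move/le_trans; apply.
  have -> : n%:R * (K * (D / n%:R) ^+ 2) = K * D ^+ 2 / n%:R by field; rewrite gt_eqF.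
  rewrite ler_pdivrMr // [e * _]mulrC -ler_pdivrMr //; lra.
have -> : l = phi y by rewrite yz; apply: is_mean_uniq zl (hphi _ (sb _ zb)).
exact: hphi (sb _ yb).
Qed.

End MeanHolo.

(** * Approximation by exponential sums *)

Section Kernel.
Variable R : realType.
Implicit Types (a b : \bar R) (c d e r s t x B L : R) (z y h l m : R[i]).
Implicit Types (f g : R[i] -> R[i]) (mu : seq R) (La : R -> Prop).

Definition trig La (k : R -> R[i]) := exists2 u : seq (R[i] * R),
  (forall v, List.In v u -> La v.2) & forall t, k t = \sum_(v <- u) v.1 * cis v.2 t%:C.

Lemma trigM La k1 k2 : (forall s t, La s -> La t -> La (s + t)) ->
  trig La k1 -> trig La k2 -> trig La (fun t => k1 t * k2 t).
Proof.
move=> LaD [u1 L1 E1] [u2 L2 E2].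
exists [seq (v.1 * w.1, v.2 + w.2) | v <- u1, w <- u2].
  elim: u1 L1 {E1} => [|v u1 IH] //= L1 w /List.in_app_iff [|]; last first.
    by apply: IH => v' v'u; apply: L1; right.
  have Lv : La v.2 by apply: L1; left.
  elim: u2 L2 {E2 IH} => [|v2 u2 IH2] //= L2 [<-|]; first by apply: LaD => //; apply: L2; left.
  by apply: IH2 => v' v'u; apply: L2; right.
move=> t; rewrite E1 E2 big_allpairs_dep /= big_distrl /=.
apply: eq_bigr => v _; rewrite big_distrr /=; apply: eq_bigr => w _.
by rewrite cisDl mulrACA.
Qed.

Lemma trig1 La : La 0 -> trig La (fun=> 1).
Proof.
move=> L0; exists [:: (1, 0)] => [v [<-|]|t] //.
by rewrite big_seq1 cis0l mulr1.
Qed.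

Lemma trig_lipschitz La k : trig La k -> exists L, forall t x, cabs (k t - k x) <= L * `|t - x|.
Proof.
move=> [u _ E]; exists (\sum_(v <- u) cabs v.1 * (12 * `|v.2|)) => t x.
rewrite !E -sumrB mulr_suml; apply: le_trans (cabs_sum _ _ _) _.
apply: ler_sum => v _.
have -> : v.1 * cis v.2 t%:C - v.1 * cis v.2 x%:C = v.1 * (cis v.2 x%:C * (cis v.2 (t - x)%:C - 1)).
  have {1}-> : t%:C = x%:C + (t - x)%:C :> R[i] by rewrite rmorphB /=; ring.
  by rewrite cisD; ring.
rewrite cabsM (cabsM (cis _ _)) cabs_cis_real mul1r -mulrA ler_wpM2l ?cabs_ge0 //.
exact: cis_lipschitz.
Qed.

(** [(1 + cos (x t)) / 2], in the form that shows its behaviour on Bohr sets. *)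
Definition fejer x t : R := 1 - cabs (cis x t%:C - 1) ^+ 2 / 4.

Lemma cis_real x t : cis x t%:C = cos (x * t) +i* sin (x * t).
Proof. by rewrite /cis /cexp /= !(mul0r, mulr0, mul1r, subr0, addr0, oppr0, add0r, expR0). Qed.

Lemma fejerE x t : (fejer x t)%:C = 2^-1 + 4^-1 * cis x t%:C + 4^-1 * cis (- x) t%:C.
Proof.
have -> : fejer x t = 2^-1 + 2^-1 * cos (x * t).
  rewrite /fejer cabs_sqr cis_real /=.
  have := cos2Dsin2 (x * t); move: (cos _) (sin _) => C S CS.
  rewrite oppr0 addr0.
  have -> : S ^+ 2 = 1 - C ^+ 2 by rewrite -CS; ring.
  by field.
have c4 : 4^-1 = (4^-1 : R)%:C :> R[i] by rewrite fmorphV rmorph_nat.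
have c2 : 2^-1 = (2^-1 : R)%:C :> R[i] by rewrite fmorphV rmorph_nat.
rewrite !cis_real mulNr cosN sinN c2 c4.
by apply/eqP; rewrite eq_complex /=; apply/andP; split; apply/eqP; field.
Qed.

Lemma fejer_ge0 x t : 0 <= fejer x t.
Proof.
have h := cabsB (cis x t%:C) 1; rewrite cabs_cis_real cabs1 in h.
have := cabs_ge0 (cis x t%:C - 1); rewrite /fejer; nra.
Qed.

Lemma fejer_le1 x t : fejer x t <= 1.
Proof. by rewrite /fejer lerBlDr lerDl divr_ge0 ?sqr_ge0. Qed.

Lemma trig_fejer La x : La 0 -> La x -> La (- x) -> trig La (fun t => (fejer x t)%:C).
Proof.
move=> L0 Lx LNx; exists [:: (2^-1, 0); (4^-1, x); (4^-1, - x)].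
  by move=> v [<-|[<-|[<-|]]].
by move=> t; rewrite fejerE !big_cons big_nil /= cis0l mulr1 addr0 addrA.
Qed.

(** A nonnegative trigonometric polynomial concentrated on Bohr sets. *)
Definition kernel mu n t : R := (\prod_(x <- mu) fejer x t) ^+ n.

Lemma kernel_ge0 mu n t : 0 <= kernel mu n t.
Proof. by rewrite exprn_ge0 // prodr_ge0 // => x _; exact: fejer_ge0. Qed.

Lemma prod_fejer_le1 mu t : \prod_(x <- mu) fejer x t <= 1.
Proof.
elim: mu => [|x mu IH]; rewrite ?big_nil // big_cons.
by rewrite mulr_ile1 ?fejer_ge0 ?fejer_le1 // prodr_ge0 // => *; exact: fejer_ge0.
Qed.

Lemma kernel_le1 mu n t : kernel mu n t <= 1.
Proof.
rewrite exprn_ile1 ?prod_fejer_le1 // prodr_ge0 // => x _; exact: fejer_ge0.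
Qed.

Lemma trig_kernel La mu n : La 0 -> (forall s t, La s -> La t -> La (s + t)) ->
  (forall x, x \in mu -> La x /\ La (- x)) -> trig La (fun t => (kernel mu n t)%:C).
Proof.
move=> L0 LD Lmu.
have P : trig La (fun t => (\prod_(x <- mu) fejer x t)%:C).
  elim: mu Lmu => [|x mu IH] Lmu.
    by under eq_fun do rewrite big_nil; exact: trig1.
  under eq_fun do rewrite big_cons rmorphM.
  apply: trigM => //; first by apply: trig_fejer => //; apply Lmu; rewrite inE eqxx.
  by apply: IH => s smu; apply: Lmu; rewrite inE smu orbT.
rewrite /kernel; elim: n => [|n IH]; first by under eq_fun do rewrite expr0; exact: trig1.
by under eq_fun do rewrite exprS rmorphM; exact: trigM.
Qed.

(** Off the Bohr set a single factor is already bounded away from [1]. *)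
Lemma kernel_off mu n d t : 0 < d -> ~ bohr mu d t -> kernel mu n t <= (1 - d ^+ 2 / 4) ^+ n.
Proof.
move=> d0 nb; have [x xmu dx] : exists2 x, x \in mu & d < cabs (cis x t%:C - 1).
  apply: contrapT => h; apply: nb => x xmu; rewrite leNgt; apply/negP => hx.
  by apply: h; exists x.
have fx : fejer x t <= 1 - d ^+ 2 / 4.
  by rewrite /fejer lerB // ler_pM2r // lerXn2r ?nnegrE ?cabs_ge0 ?ltW.
have P0 : 0 <= \prod_(s <- mu) fejer s t by rewrite prodr_ge0 // => *; exact: fejer_ge0.
apply: lerXn2r; rewrite ?nnegrE //; first exact: le_trans (fejer_ge0 x t) fx.
apply: le_trans fx; rewrite (big_rem x xmu) /= ler_piMr ?fejer_ge0 //.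
exact: prod_fejer_le1.
Qed.

(** On a sufficiently small Bohr set all factors are close to [1]; with [n]-th
    powers this beats the bound off the larger Bohr set. *)
Lemma kernel_on mu d t : 0 < d -> d <= 1 -> bohr mu d t ->
  (1 - (size mu)%:R * (d ^+ 2 / 4)) <= \prod_(x <- mu) fejer x t.
Proof.
move=> d0 d1; elim: mu => [|x mu IH] bmu; first by rewrite big_nil mul0r subr0.
rewrite big_cons /= -natr1.
have fx : 1 - d ^+ 2 / 4 <= fejer x t.
  rewrite /fejer lerB // ler_pM2r // lerXn2r ?nnegrE ?cabs_ge0 ?(ltW d0) //.
  by apply: bmu; rewrite inE eqxx.
have {}bmu : bohr mu d t by move=> s smu; apply: bmu; rewrite inE smu orbT.
have := IH bmu.
have := prod_fejer_le1 mu t; have := fejer_le1 x t; have := fejer_ge0 x t.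
move: ((size mu)%:R) (\prod_(s <- mu) _) => S P.
have : d ^+ 2 / 4 <= 1 by nra.
have : 0 <= d ^+ 2 / 4 by rewrite divr_ge0 ?sqr_ge0.
move: (d ^+ 2 / 4) fx => q; nra.
Qed.

(** If the translations in a Bohr set almost fix [g], averaging them against a
    kernel concentrated on that set approximates [g].  Since the mean of
    [g * cis x] is constant on the strip, the average is an exponential sum; its
    frequencies lie in any additive class [La] that contains those of the Bohr
    set. *)
Lemma bohr_approximation a b g c d mu dl e La : hbounded a b g -> inner a b c d ->
  0 < e -> 0 < dl ->
  (forall t, bohr mu dl t -> forall z, band c d z -> cabs (g (z + t%:C) - g z) <= e) ->
  La 0 -> (forall s t, La s -> La t -> La (s + t)) ->
  (forall x, x \in mu -> La x /\ La (- x)) ->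
  exists (u : seq (R[i] * R)) (phi : R -> R[i]),
  [/\ forall v, List.In v u -> La v.2,
   forall x z, strip a b z -> is_mean (fun t => g (z + t%:C) * cis x (z + t%:C)) (phi x) &
   forall z, band c d z ->
     cabs (g z - \sum_(v <- u) v.1 * phi v.2 * cis (- v.2) z) <= 2 * e].
Proof.
move=> ghb cd e0.
wlog dl1 : dl / dl <= 1.
  move=> hwlog dl0 gb; apply: (hwlog (Num.min dl 1)).
  - by rewrite ge_min lexx orbT.
  - by rewrite lt_min dl0 ltr01.
  - move=> t bt; apply: gb; apply: bohr_sub bt => //; by rewrite ge_min lexx.
move=> dl0 gb L0 LD Lmu.
have [gh gB] := ghb; have [B B0 hB] := gB c d cd.
have chb x : hbounded a b (fun z => g z * cis x z).
  split=> [z zS|c' d' cd']; first by apply: holoM; [exact: gh | exact: holo_cis].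
  have [B1 B10 h1] := gB _ _ cd'.
  have [B2 B20 h2] := @exp_sums_bounded R (fun z => \sum_(v <- [:: (1, x)]) v.1 * cis v.2 z) c' d'
     (exp_sums_cis _).
  exists (B1 * B2) => [|z zb]; first exact: mulr_gt0.
  rewrite cabsM ler_pM ?cabs_ge0 //; first exact: h1.
  by have := h2 z zb; rewrite big_seq1 mul1r.
have ex_phi x : exists m, forall z, strip a b z ->
    is_mean (fun t => g (z + t%:C) * cis x (z + t%:C)) m.
  have [[z0 z0S]|nS] := pselect (exists z, strip a b z); last first.
    by exists 0 => z zS; exfalso; apply: nS; exists z.
  have [B1 B10 h1] := hbounded_line (chb x) z0S.
  have [m hm] := mean_ex h1; exists m => z zS; exact: (mean_strip_cst (chb x) z0S zS hm).
have [phi hphi] := choice ex_phi.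
(* [d'] is so small that the kernel is at least [q2 ^+ n] on its Bohr set, against
   [q1 ^+ n] off the Bohr set of [dl], where [q1 < q2] *)
pose S := (size mu)%:R : R; have S0 : 0 <= S by rewrite /S.
pose d' := dl / (2 * (S + 1)).
have d'0 : 0 < d' by rewrite divr_gt0 // mulr_gt0 //; lra.
have d'S : d' * (2 * (S + 1)) = dl by rewrite /d' divfK // gt_eqF // mulr_gt0 //; lra.
have d'1 : d' <= 1 by nra.
have [ts hts] := bohr_cover mu d'0.
pose q1 := 1 - dl ^+ 2 / 4; pose q2 := 1 - dl ^+ 2 / 8.
have dl2 : 0 < dl ^+ 2 by rewrite exprn_gt0.
have dl21 : dl ^+ 2 <= 1 by nra.
have q10 : 0 <= q1 by rewrite /q1; lra.
have q20 : 0 < q2 by rewrite /q2; lra.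
have qq : 0 <= q1 / q2 < 1.
  by rewrite divr_ge0 ?(ltW q20) //= ltr_pdivrMr // mul1r /q1 /q2; lra.
pose T := (size ts)%:R : R; have T0 : 0 <= T by rewrite /T.
have eT : 0 < e / (2 * B * T + 1) by rewrite divr_gt0 // ltr_wpDl // !mulr_ge0 // ltW.
have [n hn] := geom_small qq eT.
rewrite expr_div_n ltr_pdivrMr ?exprn_gt0 // in hn.
have Kq2 t : bohr mu d' t -> q2 ^+ n <= kernel mu n t.
  move=> bt; apply: lerXn2r; rewrite ?nnegrE ?(ltW q20) //.
    by rewrite prodr_ge0 // => *; exact: fejer_ge0.
  apply: le_trans (kernel_on d'0 d'1 bt); rewrite /q2 -/S; nra.
have Kt := trig_kernel n L0 LD Lmu.
have Kb t : cabs (kernel mu n t)%:C <= 1.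
  by rewrite cabsC ger0_norm ?kernel_ge0 ?kernel_le1.
have [L KL] := trig_lipschitz Kt.
have [ka hka] := mean_ex Kb.
have kaT : q2 ^+ n <= T * complex.Re ka.
  have M1 : is_mean (fun t => \sum_(s <- ts) (kernel mu n (t - s))%:C) (\sum_(s <- ts) ka).
    by apply: is_mean_sum => s _; exact: is_mean_shift Kb KL hka.
  have M2 : is_mean (fun t => (\sum_(s <- ts) kernel mu n (t - s))%:C) (\sum_(s <- ts) ka).
    by under eq_fun do rewrite rmorph_sum.
  have := is_mean_dom (is_mean_cst (q2 ^+ n)%:C) M2.
  rewrite cabsC (ger0_norm (exprn_ge0 _ (ltW q20))).
  rewrite big_const_seq count_predT iter_addr_0.
  have -> : complex.Re (ka *+ size ts) = T * complex.Re ka.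
    by rewrite /T mulr_natl; elim: (size ts) => [|k IH]; rewrite ?mulr0n // !mulrS ReD IH.
  apply => t; have [s sts bs] := hts t.
  rewrite (big_rem s sts) /=; apply: le_trans (Kq2 _ bs) _.
  by rewrite lerDl sumr_ge0 // => *; exact: kernel_ge0.
have q2n : 0 < q2 ^+ n by rewrite exprn_gt0.
have ka0 : 0 < complex.Re ka by nra.
have kac : cabs ka >= complex.Re ka by exact: le_trans (ler_norm _) (Re_le_cabs _).
have kaC : ka != 0 by rewrite -cabs_gt0; lra.
have [u uL uE] := Kt.
exists [seq (v.1 / ka, v.2) | v <- u], phi; split => //.
  by move=> v /List.in_map_iff [w [<- wu]]; exact: (uL w wu).
move=> z zb; have zS : strip a b z by exact: band_strip zb.
rewrite big_map /=.
pose G := \sum_(v <- u) v.1 * (phi v.2 * cis (- v.2) z).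
have -> : \sum_(v <- u) v.1 / ka * phi v.2 * cis (- v.2) z = G / ka.
  by rewrite /G mulr_suml; apply: eq_bigr => v _; field.
have MG : is_mean (fun t => g (z + t%:C) * (kernel mu n t)%:C) G.
  have -> : (fun t => g (z + t%:C) * (kernel mu n t)%:C) =
    fun t => \sum_(v <- u) v.1 * (cis (- v.2) z * (g (z + t%:C) * cis v.2 (z + t%:C))).
    apply/funext => t; rewrite uE mulr_sumr; apply: eq_bigr => v _.
    rewrite cisD; have := cisNl v.2 z; move: (cis (- v.2) z) (cis v.2 z) => p q pq.
    by rewrite -[in LHS](mul1r (cis _ _)) -pq; ring.
  apply: is_mean_sum => v _; apply: is_meanZ; rewrite [phi _ * _]mulrC.
  by apply: is_meanZ; exact: hphi.
have MF := is_meanD (is_meanZ (g z) hka) (is_meanZ (-1) MG).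
have MD : is_mean (fun t => (e * kernel mu n t + 2 * B * q1 ^+ n)%:C)
    (e%:C * ka + (2 * B * q1 ^+ n)%:C).
  under eq_fun do rewrite rmorphD rmorphM.
  by apply: is_meanD; [exact: is_meanZ | exact: is_mean_cst].
have := is_mean_dom MF MD.
have -> : complex.Re (e%:C * ka + (2 * B * q1 ^+ n)%:C) = e * complex.Re ka + 2 * B * q1 ^+ n.
  by rewrite ReD /=; case: (ka) => k1 k2 /=; ring.
have -> : g z * ka + -1 * G = (g z - G / ka) * ka by field.
rewrite cabsM => H.
have {H} H : cabs (g z - G / ka) * cabs ka <= e * complex.Re ka + 2 * B * q1 ^+ n.
  apply: H => t.
  have -> : g z * (kernel mu n t)%:C + -1 * (g (z + t%:C) * (kernel mu n t)%:C) =
     - (g (z + t%:C) - g z) * (kernel mu n t)%:C by ring.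
  rewrite cabsM cabsN cabsC ger0_norm ?kernel_ge0 //.
  have k0 := kernel_ge0 mu n t.
  have h0 : 0 <= 2 * B * q1 ^+ n by rewrite mulr_ge0 ?exprn_ge0 // mulr_ge0 // ltW.
  have [bt|nbt] := pselect (bohr mu dl t).
    apply: le_trans (_ : e * kernel mu n t <= _); last by rewrite lerDl.
    by rewrite ler_wpM2r // gb.
  apply: le_trans (_ : 2 * B * q1 ^+ n <= _); last by rewrite lerDr mulr_ge0 // ltW.
  apply: ler_pM => //; first exact: cabs_ge0; last exact: kernel_off.
  apply: le_trans (cabsB _ _) _; have := hB z zb; have := hB _ (band_real t zb); lra.
have P0 : 0 <= cabs (g z - G / ka) by exact: cabs_ge0.
suff : 2 * B * q1 ^+ n <= e * complex.Re ka by nra.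
have q1n : 0 <= q1 ^+ n by rewrite exprn_ge0.
have hn2 : q1 ^+ n * (2 * B * T + 1) <= e * q2 ^+ n.
  move: hn; rewrite mulrAC ltr_pdivlMr ?ltr_wpDl // ?mulr_ge0 ?(ltW B0) //.
  by move/ltW.
have T1 : 0 < T by nra.
have hn3 : e * q2 ^+ n <= e * (T * complex.Re ka) by rewrite ler_pM2l.
have : T * (2 * B * q1 ^+ n) <= T * (e * complex.Re ka).
  have -> : T * (2 * B * q1 ^+ n) = q1 ^+ n * (2 * B * T + 1) - q1 ^+ n by ring.
  have -> : T * (e * complex.Re ka) = e * (T * complex.Re ka) by ring.
  lra.
by rewrite ler_pM2l.
Qed.

End Kernel.

(** * Removable singularities *)

Section Removable.
Variable R : realType.
Implicit Types (c d e r s t B : R) (x z y h : R[i]) (f g : R[i] -> R[i]).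

Lemma polar h : h != 0 -> exists z, cis 1 z = h.
Proof.
rewrite -cabs_gt0 => h0; pose X := complex.Re h / cabs h.
have e1 := cabs_sqr h.
have rh : complex.Re h = X * cabs h by rewrite /X divfK ?gt_eqF.
have X1 : -1 <= X <= 1.
  have : `|X| <= 1 by rewrite normrM normfV (gtr0_norm h0) ler_pdivrMr // mul1r Re_le_cabs.
  by rewrite ler_norml.
have sq : complex.Im h ^+ 2 = (cabs h * Num.sqrt (1 - X ^+ 2)) ^+ 2.
  rewrite exprMn sqr_sqrtr; last by move: X1 => /andP[]; nra.
  have -> : complex.Im h ^+ 2 = cabs h ^+ 2 - complex.Re h ^+ 2 by rewrite e1; ring.
  by rewrite rh; ring.
have [th [ct st]] : exists th, cos th = X /\ cabs h * sin th = complex.Im h.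
  move/eqP: sq; rewrite eqf_sqr => /orP[/eqP ->|/eqP ->].
    by exists (acos X); rewrite acosK ?in_itv //= sin_acos.
  by exists (- acos X); rewrite cosN sinN acosK ?in_itv //= sin_acos // mulrN.
exists (th +i* - ln (cabs h)).
rewrite /cis mulr1 /cexp /= !(mul0r, mul1r, sub0r, subr0, opprK, add0r, addr0).
rewrite lnK ?posrE //.
apply/eqP; rewrite eq_complex /=; apply/andP; split; apply/eqP.
  by rewrite mul0r subr0 ct rh mulrC.
by rewrite mul0r addr0 st.
Qed.

Lemma cis_nat n z : cis n%:R z = cis 1 z ^+ n.
Proof.
elim: n => [|n IH]; first by rewrite cis0l.
by rewrite -natr1 cisDl IH exprSr.
Qed.

Lemma disc_bounded z r f : 0 <= r -> (forall y, disc z r y -> cont_at (disc z r) f y) ->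
  exists2 B : R, 0 < B & forall y, disc z r y -> cabs (f y) <= B.
Proof.
move=> r0 fc; have [y yD e e0|y yD hy] := @disc_max R z r (fun x => cabs (f x)) r0.
  have [d d0 hd] := fc y yD e e0; exists d => // x xD xy.
  have := hd x xD xy; have := cabs_sub (f x) (f y); have := cabs_sub (f y) (f x).
  by rewrite (cabsBC (f y)) ltr_norml => *; apply/andP; split; lra.
exists (cabs (f y) + 1); first by have := cabs_ge0 (f y); lra.
by move=> x /hy; lra.
Qed.

(** The functions [f^n (y - z)] vanish at the exceptional point, so the maximum
    principle applies to them, and [n]-th roots remove the factor [y - z] as [n]
    grows. *)
Lemma max_modulus_punctured z r f M : 0 < r -> 0 < M ->
  (forall y, disc z r y -> cont_at (disc z r) f y) ->
  (forall y, 0 < cabs (y - z) < r -> holo f y) ->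
  (forall y, cabs (y - z) = r -> cabs (f y) <= M) ->
  forall y, disc z r y -> cabs (f y) <= M.
Proof.
move=> r0 M0 fc fh fM.
have off y : disc z r y -> y != z -> cabs (f y) <= M.
  move=> yD yz; have yz0 : 0 < cabs (y - z) by rewrite cabs_gt0 subr_eq0.
  rewrite leNgt; apply/negP => My.
  have fy0 : 0 < cabs (f y) by exact: lt_trans My.
  have [B B0 hB] := disc_bounded (ltW r0) fc.
  have key n : cabs (f y) ^+ n * cabs (y - z) <= M ^+ n * r.
    rewrite -cabsX -cabsM.
    apply: (@max_modulus R z r (fun x => f x ^+ n * (x - z))) yD => // [x xD|x xr x0|x xr].
    - have [->|xz] := eqVneq x z; last first.
        have xz0 : 0 < cabs (x - z) by rewrite cabs_gt0 subr_eq0.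
        have [xr|xr] := ltP (cabs (x - z)) r.
          have fhx := fh x ltac:(by rewrite xz0 xr).
          have gh : holo (fun x => f x ^+ n * (x - z)) x.
            by apply: holoM; [exact: holoX | apply: holoB; [exact: holo_id | exact: holo_cst]].
          by move=> e /(holo_cont gh)[d d0 hd]; exists d => // x' _; exact: hd.
        move=> e e0.
        have fn : cont_at (disc z r) (fun x => f x ^+ n) x.
          move=> e1 e10; have [d d0 hd] := fc x xD (e1 / (n%:R * (B + 1) ^+ n + 1)) ltac:(
            rewrite divr_gt0 // ltr_wpDl // mulr_ge0 ?exprn_ge0 //; lra).
          exists d => // x' x'D x'd; have := hd x' x'D x'd.
          rewrite ltr_pdivlMr; last by rewrite ltr_wpDl // mulr_ge0 ?exprn_ge0 //; lra.
          have B1 : 1 <= B + 1 by lra.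
          have := @cabs_subX R (f x') (f x) (B + 1) n B1 ltac:(by have := hB _ x'D; lra)
            ltac:(by have := hB _ xD; lra).
          have := cabs_ge0 (f x' - f x).
          have : 0 <= n%:R * (B + 1) ^+ n by rewrite mulr_ge0 ?exprn_ge0 //; lra.
          move: (n%:R * (B + 1) ^+ n) => K; nra.
        have e2 : 0 < e / 2 / r by rewrite !divr_gt0.
        have [d d0 hd] := fn _ e2.
        have Bn : 0 < B ^+ n by rewrite exprn_gt0.
        exists (Num.min d (e / 2 / B ^+ n)); first by rewrite lt_min d0 !divr_gt0.
        move=> x' x'D; rewrite lt_min => /andP[xd]; rewrite ltr_pdivlMr // => xB.
        have -> : f x' ^+ n * (x' - z) - f x ^+ n * (x - z) =
          (f x' ^+ n - f x ^+ n) * (x' - z) + f x ^+ n * (x' - x) by ring.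
        apply: le_lt_trans (cabsD _ _) _; rewrite !cabsM cabsX.
        have h1 := hd x' x'D xd; rewrite ltr_pdivlMr // in h1.
        have h2 : cabs (f x) ^+ n <= B ^+ n by rewrite lerXn2r ?nnegrE ?cabs_ge0 ?(ltW B0) ?hB.
        have := cabs_ge0 (f x' ^+ n - f x ^+ n); have := cabs_ge0 (x' - x).
        move: x'D; rewrite /disc /= => x'D; have := cabs_ge0 (x' - z).
        nra.
      move=> e e0; have Bn : 0 < B ^+ n by rewrite exprn_gt0.
      exists (e / B ^+ n); first by rewrite divr_gt0.
      move=> x' x'D; rewrite ltr_pdivlMr // subrr mulr0 subr0 cabsM cabsX mulrC.
      apply: le_lt_trans; rewrite mulrC [leRHS]mulrC ler_wpM2r ?cabs_ge0 //.
      by rewrite lerXn2r ?nnegrE ?cabs_ge0 ?(ltW B0) ?hB.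
    - have xz : x != z by apply: contra x0 => /eqP ->; rewrite subrr mulr0.
      apply: holoM; last by apply: holoB; [exact: holo_id | exact: holo_cst].
      by apply/holoX/fh; rewrite cabs_gt0 subr_eq0 xz.
    - rewrite cabsM cabsX xr ler_wpM2r ?(ltW r0) // lerXn2r ?nnegrE ?cabs_ge0 ?(ltW M0) //.
      exact: fM.
  have qq : 0 <= M / cabs (f y) < 1.
    by rewrite divr_ge0 ?ltW //= ltr_pdivrMr // mul1r.
  have s0 : 0 < cabs (y - z) / r by rewrite divr_gt0.
  have [n hn] := geom_small qq s0.
  rewrite expr_div_n ltr_pdivrMr ?exprn_gt0 // mulrAC ltr_pdivlMr // in hn.
  have := key n; rewrite mulrC; lra.
move=> y yD; have [->|] := eqVneq y z; last exact: off.
apply/le_eps => e e0.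
have zz : disc z r z by rewrite /disc /= subrr cabs0 ltW.
have [d d0 hd] := fc z zz e e0.
pose s := Num.min r (d / 2).
have s0 : 0 < s by rewrite lt_min r0 divr_gt0.
have sr : s <= r by rewrite ge_min lexx.
have sd : s <= d / 2 by rewrite ge_min lexx orbT.
have es : cabs (z + s%:C - z) = s by rewrite addrC addKr cabsC gtr0_norm.
have sD : disc z r (z + s%:C) by rewrite /disc /= es.
have sz : z + s%:C != z by rewrite -subr_eq0 -cabs_gt0 es.
have := off _ sD sz; have := hd _ sD ltac:(rewrite es; lra).
have := cabs_sub (f z) (f (z + s%:C)); rewrite (cabsBC (f z)); lra.
Qed.

(** In the coordinate [zeta] with [y = z + e^(i zeta)] the punctured disc becomes
    a half-plane and [f] a function of period [2 pi], whose exponential sums are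
    Laurent polynomials; the negative powers are absent because [f] is bounded
    near [z].  So [f] is a uniform limit of polynomials on a circle, hence inside. *)
Lemma removable z r f : 0 < r ->
  (forall y, disc z r y -> cont_at (disc z r) f y) ->
  (forall y, 0 < cabs (y - z) < r -> holo f y) -> holo f z.
Proof.
move=> r0 fc fh; have [B B0 hB] := disc_bounded (ltW r0) fc.
pose a0 := - ln r; pose W x := f (z + cis 1 x).
have er : expR (- a0) = r by rewrite /a0 opprK lnK.
have cr y : a0 < complex.Im y -> 0 < cabs (cis 1 y) < r.
  by move=> ay; rewrite cabs_cis mul1r expR_gt0 -er ltr_expR ltrN2.
have cD y : a0 < complex.Im y -> disc z r (z + cis 1 y).
  by move=> /cr /andP[_ h]; rewrite /disc /= addrC addKr ltW.
have Whb : hbounded a0%:E +oo%E W.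
  split=> [y [ay _]|c d [ac _]].
    rewrite lte_fin in ay; apply: (holo_comp (f := f) (g := fun x => z + cis 1 x)).
      by apply: holoD; [exact: holo_cst | exact: holo_cis].
    by apply: fh; rewrite addrC addKr; exact: cr.
  exists B => // y /andP[cy _]; apply/hB/cD; rewrite lte_fin in ac; exact: lt_le_trans cy.
(* an arbitrary level of the half-plane, that is, an arbitrary circle *)
pose y0 := a0 + 1; pose rho := expR (- y0).
have rho0 : 0 < rho by exact: expR_gt0.
have rhor : rho < r by rewrite -er ltr_expR ltrN2 /y0 ltrDl.
have cd : inner a0%:E +oo%E y0 y0.
  by split; [rewrite lte_fin /y0 ltrDl | rewrite ltry].
exists rho => // e e0; have e4 : 0 < e / 4 by rewrite divr_gt0.
have [d d0 hd] := disc_uniform_cont fc e4.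
have dl0 : 0 < d / (2 * r) by rewrite divr_gt0 // mulr_gt0.
have gb t : bohr [:: 1] (d / (2 * r)) t -> forall y, band y0 y0 y ->
    cabs (W (y + t%:C) - W y) <= e / 4.
  move=> bt y yb; have ay : a0 < complex.Im y.
    by move: yb => /andP[y1 _]; apply: lt_le_trans y1; rewrite /y0 ltrDl.
  apply/ltW/hd; [apply: cD; by rewrite ImD /= addr0 | exact: cD |].
  have -> : z + cis 1 (y + t%:C) - (z + cis 1 y) = cis 1 y * (cis 1 t%:C - 1).
    by rewrite cisD; ring.
  rewrite cabsM; have /andP[_ cy] := cr y ay; have := bt 1 (mem_head _ _).
  rewrite ler_pdivlMr ?mulr_gt0 //; have := cabs_ge0 (cis 1 t%:C - 1).
  have := cabs_ge0 (cis 1 y); nra.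
have [||x|u [phi [uL phiM up]]] := @bohr_approximation R _ _ W y0 y0 [:: 1] _ _
    (fun t => exists k : int, t = k%:~R) Whb cd e4 dl0 gb.
- by exists 0.
- by move=> s t [k1 ->] [k2 ->]; exists (k1 + k2); rewrite rmorphD.
- by rewrite inE => /eqP ->; split; [exists 1 | exists (-1)].
have neg k : phi k.+1%:R = 0.
  apply: cabs_le0 => e1 e10.
  have [n hn] := nat_ub (B / e1 + `|a0| + 1).
  pose yn : R[i] := 0 +i* n%:R.
  have Be : 0 <= B / e1 by rewrite divr_ge0 // ltW.
  have an : a0 < n%:R by have := ler_norm a0; lra.
  have M := phiM k.+1%:R yn ltac:(by split; rewrite /= ?lte_fin ?ltry).
  apply: (is_mean_le M) => t; rewrite cabsM.
  have h1 : cabs (W (yn + t%:C)) <= B by apply/hB/cD; rewrite /= addr0.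
  have h2 : cabs (cis k.+1%:R (yn + t%:C)) <= n%:R^-1.
    rewrite cabs_cis /= addr0 expRN lef_pV2 ?posrE ?expR_gt0 //; last first.
      by have := normr_ge0 a0; lra.
    apply: (@le_trans _ _ (expR n%:R)); first by apply: le_trans (expR_ge1Dx _); rewrite lerDr.
    by rewrite ler_expR ler_peMl // ler1n.
  apply: le_trans (_ : B * n%:R^-1 <= _); first by rewrite ler_pM ?cabs_ge0.
  have n0 : 0 < n%:R :> R by have := normr_ge0 a0; lra.
  rewrite ler_pdivrMr // [e1 * _]mulrC -ler_pdivrMr //; have := normr_ge0 a0; lra.
have [p hp] : exists p : {poly R[i]}, forall y,
    \sum_(v <- u) v.1 * phi v.2 * cis (- v.2) y = p.[cis 1 y].
  elim: u uL {up} => [|v u IH] uL.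
    by exists 0 => y; rewrite big_nil horner0.
  have [p hp] := IH (fun w wu => uL w (or_intror wu)).
  have [[k|k] hk] := uL v (or_introl (erefl _)); last first.
    exists (p + (v.1 * phi v.2)%:P * 'X^(k.+1)) => y.
    rewrite big_cons hp hornerD hornerM hornerC hornerXn addrC; congr (_ + _ * _).
    by rewrite hk NegzE rmorphN opprK -cis_nat.
  case: k hk => [|k] hk.
    exists (p + (v.1 * phi v.2)%:P) => y.
    by rewrite big_cons hp hornerD hornerC addrC hk oppr0 cis0l mulr1.
  by exists p => y; rewrite big_cons hp hk -pmulrn neg mulr0 mul0r add0r.
have sub y : disc z rho y -> disc z r y by move=> /le_trans; apply; exact: ltW.
exists p => h hr.
have -> : p.[h] = p.[z + h - z] by congr horner; ring.
have e2 : 0 < e / 2 by rewrite divr_gt0.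
apply: (le_trans (_ : _ <= e / 2)); last lra.
have ph y : holo (fun x => p.[x - z]) y by exists 1 => //; exact: pa_poly.
apply: (@max_modulus_punctured z rho (fun y => f y - p.[y - z]) (e / 2)) => //.
- move=> y yD e1 e10; have e12 : 0 < e1 / 2 by rewrite divr_gt0.
  have [d1 d10 h1] := fc y (sub y yD) _ e12; have [d2 d20 h2] := holo_cont (ph y) e12.
  exists (Num.min d1 d2) => [|x xD]; first by rewrite lt_min d10.
  rewrite lt_min => /andP[x1 x2].
  rewrite (_ : _ - _ = (f x - f y) - (p.[x - z] - p.[y - z])); last ring.
  apply: le_lt_trans (cabsB _ _) _.
  by have := h1 x (sub x xD) x1; have := h2 x I x2; lra.
- move=> y /andP[y1 y2]; apply: holoB => //; apply: fh.
  by rewrite y1 (lt_trans y2).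
- move=> y yr.
  have [x hx] := @polar (y - z) ltac:(by rewrite -cabs_gt0 yr).
  have xb : band y0 y0 x.
    have : cabs (cis 1 x) = rho by rewrite hx.
    by rewrite cabs_cis mul1r => /expR_inj /oppr_inj xy; rewrite /band /= xy lexx.
  have := up x xb; rewrite hp hx /W hx (_ : z + (y - z) = y); last ring.
  by move/le_trans; apply; lra.
- by rewrite /disc /= addrC addKr.
Qed.

End Removable.

(** * Connectedness *)

Section Connected.
Variable R : realType.
Implicit Types (a b : \bar R) (c d e r s t : R) (x y z u v h : R[i]).

Lemma interval_clopen (P : R -> Prop) : P 0 ->
  (forall t, 0 <= t <= 1 -> P t -> exists2 d : R, 0 < d &
     forall s, 0 <= s <= 1 -> `|s - t| < d -> P s) ->
  (forall t, 0 <= t <= 1 -> (forall d, 0 < d -> exists s, [/\ 0 <= s <= 1, `|s - t| < d & P s]) ->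
     P t) -> P 1.
Proof.
move=> P0 Popen Pclosed.
pose A := [set t : R | 0 <= t <= 1 /\ forall s, 0 <= s <= t -> P s].
have A0 : A 0.
  by split=> [|s /andP[s0 s1]]; [lra | have -> : s = 0 by lra].
have supA : has_sup A by split; [exists 0 | exists 1 => t [/andP[]]].
pose T := sup A.
have T0 : 0 <= T by apply: sup_ubound => //; exact: supA.2.
have T1 : T <= 1 by apply: sup_le_ub; [exists 0 | move=> t [/andP[]]].
have below s : 0 <= s < T -> P s.
  move=> /andP[s0 sT]; have Ts : 0 < T - s by rewrite subr_gt0.
  have [t [_ tP] st] := sup_adherent Ts supA; apply: tP; rewrite s0 /=.
  by move: st; rewrite -/T; lra.
have PT : P T.
  have [->|T00] := eqVneq T 0; first by [].
  have {}T00 : 0 < T by rewrite lt_neqAle eq_sym T00.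
  apply: Pclosed => [|d d0]; first by rewrite T0.
  exists (Num.max 0 (T - d / 2)); split.
  - by rewrite le_max lexx /= ge_max ler01 /=; lra.
  - by rewrite maxEle; case: ifP => h; rewrite ltr_norml; apply/andP; split; lra.
  - by apply: below; rewrite le_max lexx /= gt_max T00 /=; lra.
have [d d0 hd] := Popen T ltac:(by rewrite T0) PT.
have [T1'|T1'] := leP 1 T; first by have -> : 1 = T by lra.
pose t := Num.min 1 (T + d / 2).
have tT : T < t by rewrite lt_min T1' /=; lra.
have t1 : t <= 1 by rewrite ge_min lexx.
have td : t <= T + d / 2 by rewrite ge_min lexx orbT.
suff At : A t by have := sup_ubound supA.2 At; rewrite -/T; lra.
split=> [|s /andP[s0 st]]; first by apply/andP; split; lra.
have [sT|sT] := ltP s T; first by apply: below; rewrite s0.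
by apply: hd; [apply/andP; split; lra | rewrite ger0_norm; lra].
Qed.

Definition segment_at z y t : R[i] := z + t%:C * (y - z).

Lemma segment_clopen z y (P : R[i] -> Prop) : P z ->
  (forall t, 0 <= t <= 1 -> P (segment_at z y t) -> exists2 d : R, 0 < d &
     forall s, 0 <= s <= 1 -> cabs (segment_at z y s - segment_at z y t) < d ->
       P (segment_at z y s)) ->
  (forall t, 0 <= t <= 1 -> (forall d : R, 0 < d -> exists s, [/\ 0 <= s <= 1,
     cabs (segment_at z y s - segment_at z y t) < d & P (segment_at z y s)]) ->
     P (segment_at z y t)) -> P y.
Proof.
move=> Pz Popen Pclosed.
have dist s t : cabs (segment_at z y s - segment_at z y t) = `|s - t| * cabs (y - z).
  by rewrite -cabsC -cabsM rmorphB /segment_at; congr cabs; ring.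
have L0 : 0 < cabs (y - z) + 1 by have := cabs_ge0 (y - z); lra.
have near s t (d : R) : 0 < d -> `|s - t| < d / (cabs (y - z) + 1) ->
    cabs (segment_at z y s - segment_at z y t) < d.
  move=> d0; rewrite dist ltr_pdivlMr //; have := normr_ge0 (s - t); lra.
have -> : y = segment_at z y 1 by rewrite /segment_at rmorph1; ring.
apply: (@interval_clopen (fun t => P (segment_at z y t))).
- by rewrite /segment_at mul0r addr0.
- move=> t t01 Pt; have [d d0 hd] := Popen t t01 Pt.
  exists (d / (cabs (y - z) + 1)); first by rewrite divr_gt0.
  by move=> s s01 st; apply: hd => //; exact: near.
- move=> t t01 H; apply: Pclosed => // d d0.
  have [|s [s01 st Ps]] := H (d / (cabs (y - z) + 1)); first by rewrite divr_gt0.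
  by exists s; split => //; exact: near.
Qed.

Lemma complex_pair (p q : R) : p +i* q = p%:C + 'i%C * q%:C.
Proof. exact: complexE (p +i* q). Qed.

(** A point does not disconnect a disc. *)
Lemma punctured_disc_path x r u y : 0 < cabs (u - x) < r -> 0 < cabs (y - x) < r ->
  exists2 v, 0 < cabs (v - x) < r & forall t, 0 <= t <= 1 ->
    segment_at u v t != x /\ segment_at v y t != x.
Proof.
move=> /andP[u0 ur] /andP[y0 yr].
have ux : u - x != 0 by rewrite -cabs_gt0.
have yx : y - x != 0 by rewrite -cabs_gt0.
have [[t0 t0i xt]|avoid] := pselect (exists2 t, 0 <= t <= 1 & segment_at u y t = x); last first.
  exists u; first by rewrite u0.
  move=> t t01; split; last by apply/eqP => xt; apply: avoid; exists t.
  by rewrite /segment_at subrr mulr0 addr0 -subr_eq0.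
have t0C : t0%:C != 0 :> R[i].
  by apply: contra ux => /eqP t00; rewrite -xt /segment_at t00 mul0r addr0 subrr.
pose la := (1 - t0) / t0.
have yla : y - x = - la%:C * (u - x).
  apply: (mulfI t0C); rewrite /la rmorphM fmorphV rmorphB rmorph1.
  rewrite (_ : t0%:C * (- ((1 - t0%:C) / t0%:C) * (u - x)) = (t0%:C - 1) * (u - x)); last by field.
  have -> : t0%:C * (y - x) = segment_at u y t0 - x + (t0%:C - 1) * (u - x).
    by rewrite /segment_at; ring.
  by rewrite xt subrr add0r.
have la0 : la != 0.
  by apply: contra yx => /eqP la0; rewrite yla la0 rmorph0 oppr0 mul0r.
clearbody la.
have nz (p q : R) : (p != 0) || (q != 0) -> (p +i* q) * (u - x) != 0.
  move=> pq; rewrite mulf_neq0 // eq_complex /=; move: pq.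
  by case: eqVneq => //= _ ->.
exists (x + 'i%C * (u - x)) => [|t t01].
  by rewrite addrC addKr cabsM cabs_i mul1r u0.
split; rewrite -subr_eq0.
  have -> : segment_at u (x + 'i%C * (u - x)) t - x = ((1 - t) +i* t) * (u - x).
    rewrite (complex_pair (1 - t)) rmorphB rmorph1 /segment_at; ring.
  apply: nz; have [->|//] := eqVneq t 0; last by rewrite orbT.
  by rewrite subr0 oner_eq0.
have -> : segment_at (x + 'i%C * (u - x)) y t - x = ((- (t * la)) +i* (1 - t)) * (u - x).
  have ey : y = x - la%:C * (u - x) by rewrite -[LHS](subrK x) yla; ring.
  rewrite ey.
  rewrite (complex_pair (- _)) rmorphN rmorphM rmorphB rmorph1 /segment_at; ring.
apply: nz; rewrite oppr_eq0 mulf_eq0 (negPf la0) orbF.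
have [->|//] := eqVneq t 0; by rewrite subr0 oner_eq0 orbT.
Qed.

Lemma segment_disc x (r : R) u y t : 0 <= t <= 1 -> cabs (u - x) < r -> cabs (y - x) < r ->
  cabs (segment_at u y t - x) < r.
Proof.
move=> /andP[t0 t1] ur yr.
have -> : segment_at u y t - x = (1 - t)%:C * (u - x) + t%:C * (y - x).
  by rewrite /segment_at rmorphB rmorph1; ring.
apply: le_lt_trans (cabsD _ _) _; rewrite !cabsM !cabsC !ger0_norm ?subr_ge0 //.
have [AB|BA] := leP (cabs (u - x)) (cabs (y - x)); nra.
Qed.

Lemma segment_strip a b z y t : 0 <= t <= 1 -> strip a b z -> strip a b y ->
  strip a b (segment_at z y t).
Proof.
move=> t01 zS yS.
apply: (@band_strip R a b (Num.min (complex.Im z) (complex.Im y))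
                          (Num.max (complex.Im z) (complex.Im y))).
  by apply: inner_join; exact: strip_inner.
by apply: band_convex => //; rewrite /band /= ge_min le_max !lexx ?orbT.
Qed.

(** On the strip [phi E = 0], and [E = f] where [phi] vanishes.  Near a limit
    point of the open set where [E] vanishes identically, [f] has no zero but
    perhaps that point itself; off this point exactly one of [phi] and [E] is
    zero, so by connectedness [E] vanishes all around it. *)
Lemma glue a b (f phi E : R[i] -> R[i]) z1 z0 : ap a b f -> strip a b z0 -> f z0 != 0 ->
  (forall z, strip a b z -> cont_at (strip a b) phi z) ->
  (forall z, strip a b z -> cont_at (strip a b) E z) ->
  (forall z, strip a b z -> phi z = 0 \/ E z = 0) ->
  (forall z, strip a b z -> phi z = 0 -> E z = f z) ->
  strip a b z1 -> phi z1 != 0 -> forall z, strip a b z -> E z = 0.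
Proof.
move=> fa z0S fz0 phic Ec phiE Ef z1S phi1 z zS.
have nzopen (g : R[i] -> R[i]) x : cont_at (strip a b) g x -> g x != 0 -> exists2 d : R, 0 < d &
    forall y, strip a b y -> cabs (y - x) < d -> g y != 0.
  move=> gc gx; have [d d0 hd] := gc (cabs (g x)) ltac:(by rewrite cabs_gt0).
  exists d => // y yS yx; rewrite -cabs_gt0; have := hd y yS yx.
  have := cabs_sub (g x) (g y); rewrite (cabsBC (g x)); lra.
pose P x := exists2 d : R, 0 < d & forall y, strip a b y -> cabs (y - x) < d -> E y = 0.
suff : P z by case=> d d0; apply => //; rewrite subrr cabs0.
have Pnz x : strip a b x -> phi x != 0 -> P x.
  move=> xS px; have [d d0 hd] := nzopen phi x (phic x xS) px; exists d => // y yS yx.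
  by case: (phiE y yS) => // py; have := hd y yS yx; rewrite py eqxx.
apply: (@segment_clopen z1 z P (Pnz z1 z1S phi1)).
  move=> t t01 [d d0 hd]; exists (d / 2) => [|s s01 st]; first by rewrite divr_gt0.
  exists (d / 2) => [|y yS ys]; first by rewrite divr_gt0.
  apply: hd => //; have := cabs_trans (segment_at z1 z s) y (segment_at z1 z t); lra.
move=> t t01 H; set x := segment_at z1 z t; have xS : strip a b x by exact: segment_strip.
have [px|px] := eqVneq (phi x) 0; last exact: Pnz.
have [s s0 hs] := ap_zeros_isolated fa z0S fz0 xS.
have [s1 s10 s1cd] := inner_enlarge (strip_inner xS).
pose r := Num.min s s1; have r0 : 0 < r by rewrite lt_min s0.
have rs : r <= s by rewrite ge_min lexx.
have rS y : cabs (y - x) < r -> strip a b y.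
  move=> yr; apply: band_strip s1cd _; apply: band_disc (band_Im x) _.
  by apply/ltW/(lt_le_trans yr); rewrite ge_min lexx orbT.
have fnz y : 0 < cabs (y - x) < r -> f y != 0.
  by move=> /andP[y0 yr]; apply: hs; rewrite y0 (lt_le_trans yr).
have [s' [s'01 xs' Ps']] := H r r0; rewrite -/x in xs'.
set u := segment_at z1 z s' in xs' Ps'.
have [<- //|ux] := eqVneq u x.
have u01 : 0 < cabs (u - x) < r by rewrite cabs_gt0 subr_eq0 ux.
have phiu : phi u != 0.
  apply/eqP => pu; have := fnz u u01; rewrite -(Ef u (rS u xs') pu).
  by case: Ps' => d d0 ->; rewrite ?eqxx ?subrr ?cabs0 //; exact: rS.
have along p q : 0 < cabs (p - x) < r -> 0 < cabs (q - x) < r ->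
    (forall t, 0 <= t <= 1 -> segment_at p q t != x) -> phi p != 0 -> phi q != 0.
  move=> /andP[_ pr] /andP[_ qr] pq pp.
  have inD t1 : 0 <= t1 <= 1 -> 0 < cabs (segment_at p q t1 - x) < r.
    by move=> h; rewrite cabs_gt0 subr_eq0 pq // segment_disc.
  have inS t1 : 0 <= t1 <= 1 -> strip a b (segment_at p q t1).
    by move=> h; apply: rS; have /andP[] := inD t1 h.
  apply: (@segment_clopen p q (fun y => phi y != 0) pp) => t1 h1.
    move=> /(nzopen phi _ (phic _ (inS _ h1)))[d d0 hd]; exists d => // t2 h2; apply: hd.
    exact: inS.
  move=> H1; apply/negP => /eqP p0.
  have Enz : E (segment_at p q t1) != 0 by rewrite Ef ?fnz ?inD //; exact: inS.
  have [d d0 hd] := nzopen E _ (Ec _ (inS _ h1)) Enz.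
  have [t2 [h2 d2 p2]] := H1 d d0; have := hd _ (inS _ h2) d2.
  by case: (phiE _ (inS _ h2)) => h; [move: p2; rewrite h eqxx | rewrite h eqxx].
have Enear y : 0 < cabs (y - x) < r -> E y = 0.
  move=> yD; have [v vD hv] := punctured_disc_path u01 yD.
  have pv : phi v != 0 by apply: (along u) => // t1 h1; have [] := hv t1 h1.
  have py : phi y != 0 by apply: (along v) => // t1 h1; have [] := hv t1 h1.
  have /andP[_ yr] := yD.
  by case: (phiE y (rS y yr)) => // h; move: py; rewrite h eqxx.
exists r => // y yS yr; have [->|yx] := eqVneq y x; last first.
  by apply: Enear; rewrite cabs_gt0 subr_eq0 yx.
apply/eqP; apply: contrapT => /negP Ex.
have [d d0 hd] := nzopen E x (Ec x xS) Ex.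
pose k := Num.min r d / 2.
have k0 : 0 < k by rewrite divr_gt0 // lt_min r0.
have kr : k < r.
  have : Num.min r d <= r by rewrite ge_min lexx.
  rewrite /k; lra.
have kd : k < d.
  have : Num.min r d <= d by rewrite ge_min lexx orbT.
  rewrite /k; lra.
have ek : cabs (x + k%:C - x) = k by rewrite addrC addKr cabsC gtr0_norm.
have kS : strip a b (x + k%:C) by apply: rS; rewrite ek.
have := hd (x + k%:C) kS; rewrite ek => /(_ kd).
have -> : E (x + k%:C) = 0 by apply: Enear; rewrite ek k0.
by rewrite eqxx.
Qed.

End Connected.

(** * An algebraic certificate for simple roots *)

Section Certificate.
Variable R : realType.
Implicit Types (a b : \bar R) (x y z : R[i]) (n : nat).

(** Cauchy's bound for the roots of a monic polynomial. *)
Lemma root_bound n (k : nat -> R[i]) x :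
  x ^+ n.+1 + \sum_(j < n.+1) k j * x ^+ j = 0 ->
  cabs x <= 1 + \sum_(j < n.+1) cabs (k j).
Proof.
move=> /eqP; rewrite addr_eq0 => /eqP xE.
have S0 : 0 <= \sum_(j < n.+1) cabs (k j) by apply: sumr_ge0 => *; exact: cabs_ge0.
have [x1|x1] := leP (cabs x) 1; first by lra.
have x0 : 0 < cabs x by lra.
have : cabs x ^+ n * cabs x <= cabs x ^+ n * \sum_(j < n.+1) cabs (k j).
  rewrite -exprSr -cabsX xE cabsN; apply: le_trans (cabs_sum _ _ _) _.
  rewrite mulr_sumr; apply: ler_sum => j _; rewrite cabsM cabsX mulrC.
  by rewrite ler_wpM2r ?cabs_ge0 // ler_weXn2l ?(ltW x1) // -ltnS.
rewrite ler_pM2l ?exprn_gt0 //; lra.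
Qed.

(** Oriented so that the row vector of the powers of a root is an eigenvector. *)
Definition companion n (k : nat -> R[i]) : 'M[R[i]]_n.+1 :=
  \matrix_(i, j) if (j : nat) == n then - k i else (i == j.+1 :> nat)%:R.

Definition companion_poly n (k l : nat -> R[i]) : 'M[R[i]]_n.+1 :=
  \sum_(j < n.+1) l j *: companion n k ^+ j.

(** The powers of a root [x] form an eigenvector of the companion matrix, hence
    of any polynomial in it. *)
Lemma companion_root n (k l : nat -> R[i]) x :
  x ^+ n.+1 + \sum_(j < n.+1) k j * x ^+ j = 0 ->
  (char_poly (companion_poly n k l)).[\sum_(j < n.+1) l j * x ^+ j] = 0.
Proof.
move=> xE; apply/eqP; rewrite -[_ == 0]/(root _ _) -eigenvalue_root_char.
pose v : 'rV[R[i]]_n.+1 := \row_j x ^+ j.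
have vC : v *m companion n k = x *: v.
  apply/rowP => j; rewrite !mxE.
  have [jn|jn] := eqVneq (j : nat) n.
    move/eqP: xE; rewrite addr_eq0 => /eqP xE; rewrite jn -exprS xE -sumrN.
    by apply: eq_bigr => i _; rewrite !mxE jn eqxx mulrN mulrC.
  have jn1 : (j.+1 < n.+1)%N by rewrite ltnS ltn_neqAle jn -ltnS ltn_ord.
  rewrite (bigD1 (Ordinal jn1)) //= !mxE (negPf jn) eqxx mulr1 big1 ?addr0 ?exprS //.
  move=> i ij; rewrite !mxE (negPf jn).
  have -> : (i == j.+1 :> nat) = false by apply: negbTE; apply: contra ij => /eqP h; apply/eqP/val_inj.
  by rewrite mulr0.
have vCX m : v *m companion n k ^+ m = x ^+ m *: v.
  elim: m => [|m IH]; first by rewrite !expr0 scale1r mulmx1.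
  by rewrite exprS -mulmxE mulmxA vC -scalemxAl IH scalerA -exprS.
apply/eigenvalueP; exists v.
  rewrite /companion_poly mulmx_sumr scaler_suml; apply: eq_bigr => j _.
  by rewrite -scalemxAr vCX scalerA.
by apply/eqP => /rowP /(_ ord0); rewrite !mxE expr0 => /eqP; rewrite oner_eq0.
Qed.

Definition ap_poly a b (p : R[i] -> {poly R[i]}) := forall k, ap a b (fun z => (p z)`_k).

Lemma ap_polyM a b p q : ap_poly a b p -> ap_poly a b q -> ap_poly a b (fun z => p z * q z).
Proof.
move=> pa qa k.
apply: (ap_ext (f := fun z => \sum_(j <- index_enum 'I_k.+1) (p z)`_j * (q z)`_(k - j))).
  by apply: (ap_sum _ (F := fun (j : 'I_k.+1) z => (p z)`_j * (q z)`_(k - j))) => j; exact: apM.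
by move=> z; rewrite coefM.
Qed.

Lemma ap_poly_sum a b (I : Type) (s : seq I) (F : I -> R[i] -> {poly R[i]}) :
  (forall i, ap_poly a b (F i)) -> ap_poly a b (fun z => \sum_(i <- s) F i z).
Proof.
move=> Fa k; apply: (ap_ext (f := fun z => \sum_(i <- s) (F i z)`_k)).
  by apply: (ap_sum _ (F := fun i z => (F i z)`_k)) => i; exact: Fa.
by move=> z; rewrite coef_sum.
Qed.

Lemma ap_poly_prod a b (I : Type) (s : seq I) (F : I -> R[i] -> {poly R[i]}) :
  (forall i, ap_poly a b (F i)) -> ap_poly a b (fun z => \prod_(i <- s) F i z).
Proof.
move=> Fa; elim: s => [|i s IH].
  move=> k; apply: (ap_ext (@ap_cst R a b (1 : {poly R[i]})`_k)) => z.
  by rewrite big_nil.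
by move=> k; apply: (ap_ext (ap_polyM (Fa i) IH k)) => z; rewrite big_cons.
Qed.

(** The coefficients of the characteristic polynomial are polynomials in the
    entries. *)
Lemma ap_char_poly a b n (A : R[i] -> 'M[R[i]]_n) : (forall i j, ap a b (fun z => A z i j)) ->
  ap_poly a b (fun z => char_poly (A z)).
Proof.
move=> Aa; apply: (ap_poly_sum _ (F := fun (s : 'S_n) z =>
  (-1) ^+ s * \prod_i char_poly_mx (A z) i (s i))) => s.
apply: ap_polyM; first by move=> k; exact: ap_cst.
apply: (ap_poly_prod _ (F := fun i z => char_poly_mx (A z) i (s i))) => i k.
apply: (ap_ext (f := fun z => ('X *+ (i == s i) : {poly R[i]})`_k + (-1) *
   (if k == 0%N then A z i (s i) else 0))).
  apply: apD; first exact: ap_cst.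
  apply: apM; first exact: ap_cst.
  by case: (k == 0%N) => //; exact: ap_cst.
by move=> z; rewrite !mxE coefB coefC mulN1r.
Qed.

Lemma ap_companion_poly a b n (k l : nat -> R[i] -> R[i]) :
  (forall j, ap a b (k j)) -> (forall j, ap a b (l j)) ->
  forall i j, ap a b (fun z => companion_poly n (k^~ z) (l^~ z) i j).
Proof.
move=> ka la.
have ca i j : ap a b (fun z => companion n (k^~ z) i j).
  apply: (ap_ext (f := fun z => if (j : nat) == n then -1 * k i z else (i == j.+1 :> nat)%:R)).
    by case: (_ == n); [apply: apM => //; exact: ap_cst | exact: ap_cst].
  by move=> z; rewrite mxE mulN1r.
have cX m i j : ap a b (fun z => (companion n (k^~ z) ^+ m) i j).
  elim: m i j => [|m IH] i j.
    by apply: (ap_ext (@ap_cst R a b ((1 : 'M[R[i]]_n.+1) i j))) => z; rewrite expr0.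
  apply: (ap_ext (f := fun z => \sum_(h <- index_enum 'I_n.+1)
     companion n (k^~ z) i h * (companion n (k^~ z) ^+ m) h j)).
    by apply: (ap_sum _ (F := fun h z => companion n (k^~ z) i h * (companion n (k^~ z) ^+ m) h j))
      => h; apply: apM.
  by move=> z; rewrite exprS -mulmxE mxE.
move=> i j; apply: (ap_ext (f := fun z => \sum_(m <- index_enum 'I_n.+1)
     l m z * (companion n (k^~ z) ^+ m) i j)).
  by apply: (ap_sum _ (F := fun (m : 'I_n.+1) z => l m z * (companion n (k^~ z) ^+ m) i j))
    => m; apply: apM.
by move=> z; rewrite /companion_poly summxE; apply: eq_bigr => m _; rewrite mxE.
Qed.

End Certificate.

(** * Newton's iteration *)

Section Newton.
Variable R : realType.
Implicit Types (a b : \bar R) (d e r : R) (x y z v : R[i]) (n : nat).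

(** Continuity of a function of three variables at [(z0, w0, w0)]. *)
Definition near_cont (z0 w0 : R[i]) (F : R[i] -> R[i] -> R[i] -> R[i]) :=
  forall e : R, 0 < e -> exists2 d : R, 0 < d & forall z x y, cabs (z - z0) <= d ->
    cabs (x - w0) <= d -> cabs (y - w0) <= d -> cabs (F z x y - F z0 w0 w0) <= e.

Lemma near_contD z0 w0 F G : near_cont z0 w0 F -> near_cont z0 w0 G ->
  near_cont z0 w0 (fun z x y => F z x y + G z x y).
Proof.
move=> FC GC e e0; have e2 : 0 < e / 2 by rewrite divr_gt0.
have [d1 d10 h1] := FC _ e2; have [d2 d20 h2] := GC _ e2.
exists (Num.min d1 d2) => [|z x y]; first by rewrite lt_min d10.
rewrite !le_min => /andP[z1 z2] /andP[x1 x2] /andP[y1 y2].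
rewrite opprD addrACA; apply: le_trans (cabsD _ _) _.
by have := h1 z x y z1 x1 y1; have := h2 z x y z2 x2 y2; lra.
Qed.

Lemma near_contM z0 w0 F G : near_cont z0 w0 F -> near_cont z0 w0 G ->
  near_cont z0 w0 (fun z x y => F z x y * G z x y).
Proof.
move=> FC GC e e0; set F0 := F z0 w0 w0; set G0 := G z0 w0 w0.
have Fg := cabs_ge0 F0; have Gg := cabs_ge0 G0.
have e1 : 0 < e / 2 / (cabs G0 + 1) by rewrite !divr_gt0 //; lra.
have [d1 d10 h1] := FC _ e1.
have e2 : 0 < Num.min 1 (e / 2 / (cabs F0 + 1)).
  by rewrite lt_min ltr01 !divr_gt0 //; lra.
have e3 : 0 < e / 2 / (cabs F0 + 1) by rewrite !divr_gt0 //; lra.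
have [d2 d20 h2] := GC _ e2.
exists (Num.min d1 d2) => [|z x y]; first by rewrite lt_min d10.
rewrite !le_min => /andP[z1 z2] /andP[x1 x2] /andP[y1 y2].
have := h1 z x y z1 x1 y1; have := h2 z x y z2 x2 y2; rewrite le_min -/F0 -/G0.
move: (F z x y) (G z x y) => f g /andP[g1 g2] f1.
rewrite (_ : f * g - F0 * G0 = (f - F0) * g + F0 * (g - G0)); last ring.
apply: le_trans (cabsD _ _) _; rewrite !cabsM.
have gb : cabs g <= cabs G0 + 1 by have := cabs_sub g G0; lra.
have b1 : cabs (f - F0) * cabs g <= e / 2 / (cabs G0 + 1) * (cabs G0 + 1).
  by rewrite ler_pM ?cabs_ge0.
have b2 : cabs F0 * cabs (g - G0) <= (cabs F0 + 1) * (e / 2 / (cabs F0 + 1)).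
  by rewrite ler_pM ?cabs_ge0 // lerDl.
rewrite divfK ?gt_eqF // in b1; last lra.
rewrite [(cabs F0 + 1) * _]mulrC divfK ?gt_eqF // in b2; lra.
Qed.

Lemma near_contX z0 w0 F n : near_cont z0 w0 F -> near_cont z0 w0 (fun z x y => F z x y ^+ n).
Proof.
move=> FC; elim: n => [|n IH] e e0; first by exists 1 => // *; rewrite subrr cabs0 ltW.
have [d d0 hd] := near_contM FC IH e0; exists d => // z x y h1 h2 h3.
by rewrite !exprS; exact: hd.
Qed.

Lemma near_cont_sum (I : Type) (s : seq I) z0 w0 (F : I -> R[i] -> R[i] -> R[i] -> R[i]) :
  (forall i, near_cont z0 w0 (F i)) ->
  near_cont z0 w0 (fun z x y => \sum_(i <- s) F i z x y).
Proof.
move=> FC; elim: s => [|i s IH] e e0.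
  by exists 1 => // *; rewrite !big_nil subrr cabs0 ltW.
have [d d0 hd] := near_contD (FC i) IH e0; exists d => // z x y h1 h2 h3.
by rewrite !big_cons; exact: hd.
Qed.

(** Written without division, so that it makes sense on the diagonal, where it is
    the derivative. *)
Definition diff_quot n (k : nat -> R[i]) x y : R[i] :=
  \sum_(j < n) k j.+1 * \sum_(i < j.+1) x ^+ (j - i) * y ^+ i.

Lemma diff_quotE n (k : nat -> R[i]) x y :
  \sum_(j < n.+1) k j * x ^+ j - \sum_(j < n.+1) k j * y ^+ j = (x - y) * diff_quot n k x y.
Proof.
rewrite !big_ord_recl /= !expr0 opprD addrACA subrr add0r -sumrB /diff_quot mulr_sumr.
by apply: eq_bigr => j _; rewrite -mulrBr subrXX /= mulrCA.
Qed.

Lemma diff_quot_diag n (k : nat -> R[i]) x :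
  diff_quot n k x x = \sum_(j < n) j.+1%:R * k j.+1 * x ^+ j.
Proof.
apply: eq_bigr => j _; rewrite [_%:R * _]mulrC -mulrA; congr (_ * _).
rewrite (eq_bigr (fun=> x ^+ j)) => [|i _].
  by rewrite sumr_const card_ord mulr_natl.
by rewrite -exprD subnK // -ltnS.
Qed.

(** At a simple root, Newton's iteration with frozen derivative starts from a
    constant, stays within polynomially approximable functions and converges
    uniformly to the continuous root. *)
Lemma simple_root_holo n (k : nat -> R[i] -> R[i]) (w : R[i] -> R[i]) z0 r :
  0 < r -> (forall j, poly_approx (k j) z0 r) -> cont_at (disc z0 r) w z0 ->
  (forall z, disc z0 r z -> \sum_(j < n.+1) k j z * w z ^+ j = 0) ->
  diff_quot n (k^~ z0) (w z0) (w z0) != 0 -> holo w z0.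
Proof.
move=> r0 kp wc wroot; set w0 := w z0; set Q0 := diff_quot n (k^~ z0) w0 w0 => Q00.
have q0 : 0 < cabs Q0 by rewrite cabs_gt0.
have kn j : near_cont z0 w0 (fun z _ _ => k j z).
  move=> e e0; have [d d0 hd] := pa_cont r0 (kp j) e0.
  exists (d / 2) => [|z _ _ zd _ _]; first by rewrite divr_gt0.
  by apply/ltW/hd => //; lra.
have Hn : near_cont z0 w0 (fun z x y => diff_quot n (k^~ z) x y).
  apply: near_cont_sum => j; apply: near_contM; first exact: kn.
  apply: (near_cont_sum _ (F := fun (i : 'I_j.+1) _ x y => x ^+ (j - i) * y ^+ i)) => i.
  apply: near_contM; apply: near_contX => e e0; by exists e.
have q2 : 0 < cabs Q0 / 2 by rewrite divr_gt0.
have [d d0 hd] := Hn _ q2; have d2 : 0 < d / 4 by rewrite divr_gt0.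
have [d1 d10 hw] := wc _ d2.
pose r1 := Num.min (Num.min r d) (d1 / 2).
have r10 : 0 < r1 by rewrite !lt_min r0 d0 divr_gt0.
have r1r : r1 <= r by rewrite /r1 !ge_min lexx.
have r1d : r1 <= d by rewrite /r1 !ge_min lexx !orbT.
have r1d1 : r1 <= d1 / 2 by rewrite ge_min lexx orbT.
exists r1 => //.
pose T z v := v - Q0^-1 * \sum_(j < n.+1) k j z * v ^+ j.
pose V m z := iter m (T z) w0.
have Vp m : poly_approx (V m) z0 r1.
  elim: m => [|m IH]; first exact: pa_cst.
  have : poly_approx (fun z => V m z - Q0^-1 * \sum_(j <- index_enum 'I_n.+1) k j z * V m z ^+ j) z0 r1.
    apply: paB => //; apply: paZ.
    apply: (pa_sum _ (F := fun (j : 'I_n.+1) z => k j z * V m z ^+ j)) => j.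
    by apply: paM; [apply: (pa_sub (kp j)) | exact: paX].
  by [].
have wD h : cabs h <= r1 -> cabs (w (z0 + h) - w0) < d / 4.
  move=> hr; apply: hw; rewrite /disc /= addrC addKr; lra.
have Vw m h : cabs h <= r1 -> cabs (V m (z0 + h) - w (z0 + h)) <= (1 / 2) ^+ m * (d / 4).
  move=> hr; elim: m => [|m IH].
    by rewrite expr0 mul1r cabsBC; apply/ltW/wD.
  have p1 : (1 / 2) ^+ m <= 1 :> R by rewrite exprn_ile1 //; lra.
  have Vd : cabs (V m (z0 + h) - w0) <= d.
    have := cabs_trans (w (z0 + h)) (V m (z0 + h)) w0; have := wD h hr; nra.
  have wd : cabs (w (z0 + h) - w0) <= d by have := wD h hr; lra.
  have zd : cabs (z0 + h - z0) <= d by rewrite addrC addKr; lra.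
  have Hb := hd (z0 + h) _ _ zd Vd wd.
  set H := diff_quot n (k^~ (z0 + h)) (V m (z0 + h)) (w (z0 + h)) in Hb.
  have -> : V m.+1 (z0 + h) - w (z0 + h) =
      - Q0^-1 * (H - Q0) * (V m (z0 + h) - w (z0 + h)).
    have zD : disc z0 r (z0 + h) by rewrite /disc /= addrC addKr; lra.
    have := diff_quotE n (k^~ (z0 + h)) (V m (z0 + h)) (w (z0 + h)).
    rewrite /= wroot // subr0 -/H => e1.
    by rewrite /V /= -/(V m (z0 + h)) /T e1; field.
  rewrite 2!cabsM cabsN cabsV exprS -[X in _ <= X]mulrA.
  apply: ler_pM; rewrite ?cabs_ge0 ?mulr_ge0 ?invr_ge0 ?cabs_ge0 //.
  by rewrite mulrC ler_pdivrMr //; lra.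
apply: pa_limit => e e0.
have ed : 0 < e / (d / 4) by rewrite divr_gt0.
have [m hm] := @geom_small R (1 / 2) _ ltac:(lra) ed.
exists (V m) => // h hr; rewrite cabsBC; apply: le_trans (Vw m h hr) _.
by rewrite -ler_pdivlMr // ltW.
Qed.

End Newton.

(** * Regularity of the root *)

Section Root.
Variable R : realType.
Implicit Types (a b : \bar R) (c d e r s t : R) (x y z : R[i]) (n : nat).

Lemma near_cont_comp (D : set R[i]) (w : R[i] -> R[i]) z0 F :
  near_cont z0 (w z0) F -> cont_at D w z0 -> cont_at D (fun z => F z (w z) (w z)) z0.
Proof.
move=> FC wc e e0; have e2 : 0 < e / 2 by rewrite divr_gt0.
have [d d0 hd] := FC _ e2; have [d1 d10 hw] := wc d d0.
exists (Num.min d d1) => [|y yD]; first by rewrite lt_min d0.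
rewrite lt_min => /andP[y1 y2]; have h := ltW (hw y yD y2).
by have := hd y _ _ (ltW y1) h h; lra.
Qed.

Lemma near_cont_holo z0 w0 (f : R[i] -> R[i]) : holo f z0 -> near_cont z0 w0 (fun z _ _ => f z).
Proof.
move=> fh e e0; have [d d0 hd] := holo_cont fh e0.
exists (d / 2) => [|z _ _ zd _ _]; first by rewrite divr_gt0.
by apply/ltW/hd => //; lra.
Qed.

Lemma near_cont_snd (z0 w0 : R[i]) : near_cont z0 w0 (fun _ x _ => x).
Proof. by move=> e e0; exists e. Qed.

Definition annihilates a b (w : R[i] -> R[i]) n (k : nat -> R[i] -> R[i]) :=
  [/\ forall j, ap a b (k j), exists2 z, strip a b z & k n z != 0 &
      forall z, strip a b z -> \sum_(j < n.+1) k j z * w z ^+ j = 0].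

(** In an equation of minimal degree the derivative [Q] of the polynomial does not
    vanish identically at [w].  Multiplied by a power of the leading coefficient,
    [Q] becomes a polynomial [phi] in the integral element [k n.+1 * w], hence a
    root of a monic characteristic polynomial; its lowest coefficient [f] that is
    not identically zero is a multiple of [phi]. *)
Lemma simplicity_certificate a b w n k :
  annihilates a b w n.+1 k -> (forall k', ~ annihilates a b w n k') ->
  (forall z, strip a b z -> cont_at (strip a b) w z) ->
  (forall c d, inner a b c d -> exists2 B : R, 0 < B &
     forall z, band c d z -> cabs (k n.+1 z * w z) <= B) /\
  exists f, [/\ ap a b f, exists2 z, strip a b z & f z != 0 &
    forall c d, inner a b c d -> exists2 K : R, 0 < K &
     forall z, band c d z -> cabs (f z) <= K * cabs (diff_quot n.+1 (k^~ z) (w z) (w z))].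
Proof.
move=> [ka [z0 z0S kz0] kw] kmin wc.
pose al := k n.+1; pose W z := al z * w z.
pose bt j z := k j z * al z ^+ (n - j).
pose l j z := j.+1%:R * k j.+1 z * al z ^+ (n - j).
pose Q z := diff_quot n.+1 (k^~ z) (w z) (w z).
pose phi z := \sum_(j < n.+1) l j z * W z ^+ j.
have ala m : ap a b (fun z => al z ^+ m) by apply: apX; exact: ka.
have bta j : ap a b (bt j) by apply: apM.
have la j : ap a b (l j).
  by apply: apM => //; apply: apM => //; exact: ap_cst.
have pw z (j : 'I_n.+1) : al z ^+ (n - j) * W z ^+ j = al z ^+ n * w z ^+ j.
  by rewrite /W exprMn mulrA -exprD subnK // -ltnS.
have We z : strip a b z -> W z ^+ n.+1 + \sum_(j < n.+1) bt j z * W z ^+ j = 0.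
  move=> zS; have := congr1 (fun x => al z ^+ n * x) (kw z zS).
  rewrite mulr0 big_ord_recr /= mulrDr addrC => e1; apply: etrans e1; congr (_ + _).
    by rewrite /W exprMn exprSr -mulrA.
  rewrite mulr_sumr; apply: eq_bigr => j _.
  by rewrite /bt -mulrA pw mulrCA.
have phiE z : phi z = al z ^+ n * Q z.
  rewrite /phi /Q diff_quot_diag mulr_sumr; apply: eq_bigr => j _.
  by rewrite /l -mulrA pw mulrCA.
have WB c d : inner a b c d -> exists2 B : R, 0 < B & forall z, band c d z -> cabs (W z) <= B.
  move=> cd.
  have [B hB] : exists B : R, forall z, band c d z -> 1 + \sum_(j < n.+1) cabs (bt j z) <= B.
    have [B hB] : exists B : 'I_n.+1 -> R, forall (j : 'I_n.+1) z, band c d z -> cabs (bt j z) <= B j.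
      have ex (j : 'I_n.+1) : exists B : R, forall z, band c d z -> cabs (bt j z) <= B.
        by have [B _ hB] := ap_bounded (bta j) cd; exists B.
      by have [B hB] := choice ex; exists B.
    exists (1 + \sum_(j < n.+1) B j) => z zb.
    by rewrite lerD2l; apply: ler_sum => j _; exact: hB.
  exists (`|B| + 1) => [|z zb]; first by have := normr_ge0 B; lra.
  have := root_bound (k := bt^~ z) (We z (band_strip cd zb)).
  by move/le_trans; apply; apply: le_trans (hB z zb) _; have := ler_norm B; lra.
split=> //.
pose chi j z := (char_poly (companion_poly n (bt^~ z) (l^~ z)))`_j.
have chia j : ap a b (chi j) by exact: (ap_char_poly (ap_companion_poly bta la)).
have chiE z : strip a b z -> \sum_(j < n.+2) chi j z * phi z ^+ j = 0.
  move=> zS; have := companion_root (k := bt^~ z) (l^~ z) (We z zS).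
  by rewrite (@horner_coef_wide _ n.+2) // size_char_poly.
have [z1 z1S phi1] : exists2 z, strip a b z & phi z != 0.
  apply: contrapT => nophi; apply: (kmin (fun j z => al z ^+ n * (j.+1%:R * k j.+1 z))).
  split.
  - by move=> j; apply: apM => //; apply: apM => //; exact: ap_cst.
  - by exists z0 => //; rewrite mulf_neq0 ?expf_neq0 // mulf_neq0 // pnatr_eq0.
  - move=> z zS; apply/eqP; apply: contrapT => /negP h; apply: nophi; exists z => //.
    rewrite phiE /Q diff_quot_diag mulr_sumr; move: h; congr (~~ (_ == _)).
    by apply: eq_bigr => j _; rewrite -!mulrA.
have exK : exists j, `[< exists2 z, strip a b z & chi j z != 0 >].
  exists n.+1; apply/asboolP; exists z0 => //.
  have := char_poly_monic (companion_poly n (bt^~ z0) (l^~ z0)).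
  by rewrite monicE lead_coefE size_char_poly /= => /eqP h; rewrite /chi h oner_neq0.
have [K /asboolP [z2 z2S chi2] Kmin] := ex_minnP exK.
have chi0 j z : (j < K)%N -> strip a b z -> chi j z = 0.
  move=> jK zS; apply/eqP; apply: contrapT => /negP h.
  have : (K <= j)%N by apply: Kmin; apply/asboolP; exists z.
  by rewrite leqNgt jK.
have Kn : (K <= n.+1)%N.
  apply: Kmin; apply/asboolP; exists z0 => //.
  have := char_poly_monic (companion_poly n (bt^~ z0) (l^~ z0)).
  by rewrite monicE lead_coefE size_char_poly /= => /eqP h; rewrite /chi h oner_neq0.
pose B z := \sum_(j < n.+1 - K) chi (K + j.+1)%N z * phi z ^+ j.
pose E z := chi K z + phi z * B z.
have EE z : strip a b z -> phi z ^+ K * E z = 0.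
  move=> zS; rewrite -(chiE z zS) -(subnKC (leqW Kn)) big_split_ord /=.
  rewrite big1 ?add0r => [|j _]; last by rewrite chi0 ?mul0r.
  rewrite subSn // big_ord_recl /= addn0 /E mulrDr mulrC; congr (_ + _).
  rewrite /B mulrA mulr_sumr; apply: eq_bigr => j _.
  by rewrite -exprSr mulrCA -exprD addSnnS.
have nh j z u : strip a b z -> near_cont z u (fun z _ _ => l j z).
  by move=> zS; apply: near_cont_holo; exact: ap_holo (la j) zS.
have nphi z : strip a b z -> near_cont z (w z) (fun z x _ => \sum_(j < n.+1) l j z * (al z * x) ^+ j).
  move=> zS; apply: (near_cont_sum _ (F := fun (j : 'I_n.+1) z x _ => l j z * (al z * x) ^+ j)) => j.
  apply: near_contM; first exact: nh.
  apply: near_contX; apply: near_contM; last exact: near_cont_snd.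
  by apply: near_cont_holo; exact: ap_holo (ka n.+1) zS.
have phic z : strip a b z -> cont_at (strip a b) phi z.
  by move=> zS; exact: near_cont_comp (nphi z zS) (wc z zS).
have Ec z : strip a b z -> cont_at (strip a b) E z.
  move=> zS; apply: (near_cont_comp (F := fun z x _ => chi K z +
     (\sum_(j < n.+1) l j z * (al z * x) ^+ j) *
     \sum_(i < n.+1 - K) chi (K + i.+1)%N z * (\sum_(j < n.+1) l j z * (al z * x) ^+ j) ^+ i)
     _ (wc z zS)).
  apply: near_contD; first by apply: near_cont_holo; exact: ap_holo (chia K) zS.
  apply: near_contM; first exact: nphi.
  apply: (near_cont_sum _ (F := fun (i : 'I_(n.+1 - K)) z x _ =>
     chi (K + i.+1)%N z * (\sum_(j < n.+1) l j z * (al z * x) ^+ j) ^+ i)) => i.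
  apply: near_contM; first by apply: near_cont_holo; exact: ap_holo (chia _) zS.
  apply: near_contX; exact: nphi.
have E0 : forall z, strip a b z -> E z = 0.
  apply: (glue (chia K) z2S chi2 phic Ec _ _ z1S phi1) => z zS.
    have /eqP := EE z zS; rewrite mulf_eq0 expf_eq0 => /orP[/andP[_ /eqP]|/eqP]; tauto.
  by move=> p0; rewrite /E p0 mul0r addr0.
exists (chi K); split => //; first by exists z2.
move=> c d cd; have [BW BW0 hW] := WB c d cd.
have bd (f : R[i] -> R[i]) : ap a b f -> exists B : R, 0 <= B /\ forall z, band c d z -> cabs (f z) <= B.
  by move=> fa; have [M M0 hM] := ap_bounded fa cd; exists M; split; [exact: ltW |].
have [Bl hBl] := choice (fun j => bd (l j) (la j)).
have [Bc hBc] := choice (fun j => bd (chi j) (chia j)).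
have [Ba [Ba0 hBa]] := bd al (ka n.+1).
pose Bp := \sum_(j < n.+1) Bl j * BW ^+ j.
have Bp0 : 0 <= Bp by apply: sumr_ge0 => j _; rewrite mulr_ge0 ?exprn_ge0 ?(ltW BW0) ?(hBl j).1.
have hp z : band c d z -> cabs (phi z) <= Bp.
  move=> zb; apply: le_trans (cabs_sum _ _ _) _; apply: ler_sum => j _.
  rewrite cabsM cabsX ler_pM ?exprn_ge0 ?cabs_ge0 ?(hBl j).2 //.
  by rewrite lerXn2r ?nnegrE ?cabs_ge0 ?(ltW BW0) ?hW.
pose BB := \sum_(j < n.+1 - K) Bc (K + j.+1)%N * Bp ^+ j.
have BB0 : 0 <= BB by apply: sumr_ge0 => j _; rewrite mulr_ge0 ?exprn_ge0 ?(hBc _).1.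
have hb z : band c d z -> cabs (B z) <= BB.
  move=> zb; apply: le_trans (cabs_sum _ _ _) _; apply: ler_sum => j _.
  rewrite cabsM cabsX ler_pM ?exprn_ge0 ?cabs_ge0 ?(hBc _).2 //.
  by rewrite lerXn2r ?nnegrE ?cabs_ge0 ?hp.
exists (BB * Ba ^+ n + 1) => [|z zb]; first by rewrite ltr_wpDl // mulr_ge0 ?exprn_ge0.
have /eqP := E0 z (band_strip cd zb); rewrite /E addr_eq0 => /eqP ->.
rewrite cabsN cabsM phiE cabsM cabsX mulrC mulrA -/(Q z).
apply: (@le_trans _ _ (BB * Ba ^+ n * cabs (Q z))); last first.
  by rewrite ler_wpM2r ?cabs_ge0 // lerDl.
rewrite ler_wpM2r ?cabs_ge0 // ler_pM ?cabs_ge0 ?exprn_ge0 ?cabs_ge0 ?hb //.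
by rewrite lerXn2r ?nnegrE ?cabs_ge0 ?(hBa).
Qed.

(** Away from the isolated zeros of the certificate the root is simple; the
    remaining singularities are removable since [w] is continuous. *)
Lemma root_holo a b w n k f :
  annihilates a b w n k -> (forall z, strip a b z -> cont_at (strip a b) w z) ->
  ap a b f -> (exists2 z, strip a b z & f z != 0) ->
  (forall z, strip a b z -> f z != 0 -> diff_quot n (k^~ z) (w z) (w z) != 0) ->
  forall z, strip a b z -> holo w z.
Proof.
move=> [ka _ kw] wc fa [z0 z0S fz0] fQ z zS.
have simple y : strip a b y -> f y != 0 -> holo w y.
  move=> yS fy; have [r r0 rcd] := inner_enlarge (strip_inner yS).
  have D x : disc y r x -> strip a b x.
    by move=> xD; apply: band_strip rcd _; exact: band_disc (band_Im y) xD.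
  apply: (@simple_root_holo R n k w y r r0) => [j||x /D|].
  - exact: ap_pa.
  - by move=> e /(wc y yS)[d d0 hd]; exists d => // x /D; exact: hd.
  - exact: kw.
  - exact: fQ.
have [r r0 rcd] := inner_enlarge (strip_inner zS).
have [s s0 hs] := ap_zeros_isolated fa z0S fz0 zS.
have D x : disc z r x -> strip a b x.
  by move=> xD; apply: band_strip rcd _; exact: band_disc (band_Im z) xD.
have D' x : disc z (Num.min r s) x -> strip a b x.
  by move=> xD; apply: D; apply: le_trans xD _; rewrite ge_min lexx.
apply: (@removable R z (Num.min r s)); first by rewrite lt_min r0.
  by move=> y yD e /(wc y (D' y yD))[d d0 hd]; exists d => // x /D'; exact: hd.
move=> y /andP[y0 y1]; apply: simple; first by apply: D'; exact: ltW.
by apply: hs; rewrite y0 (lt_le_trans y1) // ge_min lexx orbT.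
Qed.

(** Division by an almost periodic function preserves boundedness: around every
    point there is a circle, of radius bounded above, on which the divisor is
    bounded below, and the maximum principle fills it. *)
Lemma quotient_bounded a b f w :
  ap a b f -> (exists2 z, strip a b z & f z != 0) ->
  (forall z, strip a b z -> holo w z) ->
  (forall c d, inner a b c d -> exists2 B : R, 0 < B &
     forall z, band c d z -> cabs (f z * w z) <= B) -> hbounded a b w.
Proof.
move=> fa [z0 z0S fz0] wh fwB; split=> // c d cd.
have [s s0 scd] := inner_enlarge cd.
have [A A0 hA] := ap_bounded fa scd; have [B B0 hB] := fwB _ _ scd.
have s4 : 0 < s / 4 by rewrite divr_gt0.
have [ka ka0 hka] := ap_lower_bound fa z0S fz0 cd s4.
have [e e0 he] := exists_circle_lower s0 A0 ka0.
exists (B / e) => [|z zb]; first by rewrite divr_gt0.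
have D y : disc z s y -> band (c - s) (d + s) y by move=> yD; exact: band_disc yD.
have [||rho /andP[rho0 rhos] hrho] := he f z.
- move=> y /D yb; split; last exact: hA.
  by apply: ap_holo fa _; exact: band_strip yb.
- exact: hka.
have rs : rho <= s by lra.
apply: (@holo_max_modulus R z rho w) => // [y yD|y yr|].
- apply: wh; apply: band_strip scd _; apply: D; exact: le_trans rs.
- have yb : band (c - s) (d + s) y by apply: D; rewrite /disc /= yr.
  rewrite ler_pdivlMr // mulrC; apply: le_trans (hB y yb).
  by rewrite cabsM ler_wpM2r ?cabs_ge0 // hrho.
- by rewrite /disc /= subrr cabs0 ltW.
Qed.

End Root.

(** * Translates of the root *)

Section Translates.
Variable R : realType.
Implicit Types (a b : \bar R) (c d e r s t B L : R) (x y z u v : R[i]) (n : nat).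
Implicit Types (mu : seq R).

Lemma ap_bohr_family a b (k : nat -> R[i] -> R[i]) n c d e :
  (forall j, ap a b (k j)) -> inner a b c d -> 0 < e ->
  exists mu dl, 0 < dl /\ forall t, bohr mu dl t ->
    forall j, (j < n)%N -> forall z, band c d z -> cabs (k j (z + t%:C) - k j z) <= e.
Proof.
move=> ka cd e0; elim: n => [|n [mu1 [dl1 [dl10 h1]]]]; first by exists [::], 1.
have [mu2 [dl2 [dl20 h2]]] := ap_bohr (ka n) cd e0.
exists (mu1 ++ mu2), (Num.min dl1 dl2); split; first by rewrite lt_min dl10.
move=> t bt j; rewrite ltnS leq_eqVlt => /orP[/eqP -> | jn].
  apply: h2; apply: bohr_sub bt => [x xmu|]; first by rewrite mem_cat xmu orbT.
  by rewrite ge_min lexx orbT.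
apply: h1 => //; apply: bohr_sub bt => [x xmu|]; first by rewrite mem_cat xmu.
by rewrite ge_min lexx.
Qed.

Lemma diff_quot_lipschitz n A B : 0 <= A -> 1 <= B -> exists2 K : R, 0 < K &
  forall (k : nat -> R[i]) u v, (forall j, (j < n.+1)%N -> cabs (k j) <= A) ->
    cabs u <= B -> cabs v <= B ->
    cabs (diff_quot n k u v - diff_quot n k v v) <= K * cabs (u - v).
Proof.
move=> A0 B1.
pose K : R := \sum_(j < n) A * (\sum_(i < j.+1) (j - i)%:R * B ^+ (j - i) * B ^+ i).
have K0 : 0 <= K.
  apply: sumr_ge0 => j _; rewrite mulr_ge0 // sumr_ge0 // => i _.
  by rewrite !mulr_ge0 ?exprn_ge0 //; lra.
exists (K + 1) => [|k u v kA uB vB]; first lra.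
apply: (@le_trans _ _ (K * cabs (u - v))); last first.
  by rewrite ler_wpM2r ?cabs_ge0 //; lra.
rewrite /diff_quot -sumrB mulr_suml; apply: le_trans (cabs_sum _ _ _) _.
apply: ler_sum => j _; rewrite -mulrBr -sumrB cabsM -mulrA.
rewrite ler_pM ?cabs_ge0 //; first by apply: kA; rewrite ltnS.
rewrite mulr_suml; apply: le_trans (cabs_sum _ _ _) _.
apply: ler_sum => i _; rewrite -mulrBl cabsM [leRHS]mulrAC cabsX.
rewrite ler_pM ?cabs_ge0 ?exprn_ge0 ?cabs_ge0 //; first exact: cabs_subX.
by rewrite lerXn2r ?nnegrE ?cabs_ge0 //; lra.
Qed.

(** The difference [u - v] of two approximate roots of the same polynomial is
    either tiny or not small where the root [v] is simple. *)
Lemma root_gap n A B q : 0 <= A -> 1 <= B -> 0 < q -> exists2 e0 : R, 0 < e0 &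
  forall (k : nat -> R[i]) u v s, (forall j, (j < n.+1)%N -> cabs (k j) <= A) ->
    cabs u <= B -> cabs v <= B ->
    q <= cabs (diff_quot n k v v) ->
    \sum_(j < n.+1) k j * v ^+ j = 0 -> cabs (\sum_(j < n.+1) k j * u ^+ j) <= s ->
    cabs (u - v) <= e0 -> cabs (u - v) <= 2 / q * s.
Proof.
move=> A0 B1 q0; have [K K0 hK] := diff_quot_lipschitz n A0 B1.
exists (q / (2 * K)) => [|k u v s kA uB vB qk kv ku uv]; first by rewrite divr_gt0 ?mulr_gt0.
rewrite ler_pdivlMr ?mulr_gt0 // in uv.
have h := hK k u v kA uB vB.
have h2 : q / 2 <= cabs (diff_quot n k u v).
  have := cabs_sub (diff_quot n k v v) (diff_quot n k u v).
  rewrite (cabsBC (diff_quot n k v v)); lra.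
have := diff_quotE n k u v; rewrite kv subr0 => e1.
rewrite e1 cabsM in ku; rewrite mulrAC ler_pdivlMr //.
have := cabs_ge0 (u - v); nra.
Qed.

(** Each box contains a disc on which the root is uniformly simple.  There
    [w (z + t)] is an approximate root of the equation at [z], so a difference not
    exceeding [e0] is tiny by [root_gap], and unique continuation extends this to
    a wider box. *)
Lemma translate_gap a b w n k f c d : hbounded a b w -> annihilates a b w n k ->
  ap a b f -> (exists2 z, strip a b z & f z != 0) ->
  inner a b c d -> c < d ->
  (exists2 K : R, 0 < K & forall z, band c d z ->
     cabs (f z) <= K * cabs (diff_quot n (k^~ z) (w z) (w z))) ->
  exists2 e0 : R, 0 < e0 & forall eta : R, 0 < eta ->
  exists mu dl, 0 < dl /\ forall t, bohr mu dl t -> forall x : R,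
    (forall z, band c d z -> `|complex.Re z - x| <= d - c -> cabs (w (z + t%:C) - w z) <= e0) ->
    forall z, band c d z -> `|complex.Re z - x| <= 2 * (d - c) ->
      cabs (w (z + t%:C) - w z) <= eta.
Proof.
move=> whb [ka _ kw] fa [z0 z0S fz0] cd lt_cd [K K0 hK]; have [wh wB] := whb.
have [r r0 rcd] := inner_enlarge cd; have [B1 B10 hB1] := wB _ _ rcd.
pose B := B1 + 1; have B1' : 1 <= B by rewrite /B; lra.
have hB z : band (c - r) (d + r) z -> cabs (w z) <= B by move=> /hB1; rewrite /B; lra.
have bsub z : band c d z -> band (c - r) (d + r) z by apply: band_sub; lra.
have [A [A0 hA]] : exists A : R, 0 <= A /\ forall j z, (j < n.+1)%N -> band c d z -> cabs (k j z) <= A.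
  have ex j : exists2 M : R, 0 < M & forall z, band c d z -> cabs (k j z) <= M.
    exact: ap_bounded (ka j) cd.
  elim: n.+1 => [|m [A [A0 hA]]]; first by exists 0.
  have [M M0 hM] := ex m; exists (A + M); split; first lra.
  move=> j z; rewrite ltnS leq_eqVlt => /orP[/eqP ->|jm] zb.
    by have := hM z zb; lra.
  by have := hA j z jm zb; lra.
pose h := (d - c) / 2; have h0 : 0 < h by rewrite /h; lra.
have h20 : 0 < h / 2 by rewrite divr_gt0.
have [ka0 ka00 hka] := ap_lower_bound fa z0S fz0 cd h20.
have fhb : hbounded a b f.
  by split=> [z zS|c' d' cd']; [exact: ap_holo fa zS | exact: ap_bounded fa cd'].
have [_ [La [_ La0 fL]]] := hbounded_lipschitz fhb cd.
pose rho := Num.min (ka0 / (2 * La)) (h / 2).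
have rho0 : 0 < rho by rewrite lt_min h20 andbT divr_gt0 // mulr_gt0.
have rhoh : rho <= h / 2 by rewrite ge_min lexx orbT.
have rhoL : rho * La <= ka0 / 2.
  have : rho <= ka0 / (2 * La) by rewrite ge_min lexx.
  by rewrite ler_pdivlMr ?mulr_gt0 //; lra.
pose q := ka0 / 2 / K; have q0 : 0 < q by rewrite !divr_gt0.
have [e0 e00 he0] := root_gap n A0 B1' q0.
exists e0 => // eta eta0.
pose r' := Num.min r (8 * rho).
have r'0 : 0 < r' by rewrite lt_min r0 mulr_gt0.
have r'r : r' <= r by rewrite ge_min lexx.
have r'rho : r' / 8 <= rho by rewrite ler_pdivrMr // mulrC ge_min lexx orbT.
have r80 : 0 < r' / 8 by rewrite divr_gt0.
have [N hN] := nat_ub (8 * (d - c) / (r' / 8)); rewrite ler_pdivrMr // in hN.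
have B20 : 0 < 2 * B by lra.
have [kap kap0 hkap] := @small_propagates R c d r' (2 * B) N r'0 B20 eta eta0.
pose S : R := \sum_(j < n.+1) B ^+ j.
have S0 : 0 < S by rewrite /S big_ord_recl expr0 ltr_wpDr // sumr_ge0 // => *; rewrite exprn_ge0 //; lra.
have s0 : 0 < kap * q / 2 / S by rewrite divr_gt0 // divr_gt0 // mulr_gt0.
have [mu [dl [dl0 hmu]]] := ap_bohr_family n.+1 ka cd s0.
exists mu, dl; split => // t bt x smallx z zb zx.
(* a point where [f] is not small, near the centre of the box *)
pose zx0 : R[i] := x +i* ((c + d) / 2).
have zx0b : band c d zx0 by rewrite /band /=; apply/andP; split; lra.
have [y yD fy] := hka zx0 zx0b.
have yRe : `|complex.Re y - x| <= h / 2.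
  by apply: le_trans yD; apply: le_trans (Re_le_cabs _); rewrite ReB.
have yIm : `|complex.Im y - (c + d) / 2| <= h / 2.
  by apply: le_trans yD; apply: le_trans (Im_le_cabs _); rewrite ImB.
have inbox p : cabs (p - y) <= rho -> band c d p /\ `|complex.Re p - x| <= d - c.
  move=> py; have := Re_le_cabs (p - y); have := Im_le_cabs (p - y).
  rewrite ReB ImB !ler_norml => /andP[i1 i2] /andP[j1 j2].
  move: yRe yIm; rewrite !ler_norml => /andP[k1 k2] /andP[l1 l2].
  by rewrite /band /=; split; apply/andP; split; move: h0 rhoh k1 k2 l1 l2; rewrite /h; lra.
have small p : disc y (r' / 8) p -> cabs (w (p + t%:C) - w p) <= kap.
  move=> pD; have py : cabs (p - y) <= rho by exact: le_trans r'rho.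
  have [pb px] := inbox p py.
  have yb : band c d y by have [] := inbox y; rewrite ?subrr ?cabs0 ?(ltW rho0).
  have fp : ka0 / 2 <= cabs (f p).
    have := fL y p yb pb; have := cabs_sub (f y) (f p); rewrite (cabsBC y p).
    have : La * cabs (p - y) <= rho * La by rewrite mulrC ler_pM2r.
    lra.
  have qp : q <= cabs (diff_quot n (k^~ p) (w p) (w p)).
    by rewrite /q ler_pdivrMr // [_ * K]mulrC; exact: le_trans fp (hK p pb).
  have ks : cabs (\sum_(j < n.+1) k j p * w (p + t%:C) ^+ j) <= kap * q / 2.
    have -> : \sum_(j < n.+1) k j p * w (p + t%:C) ^+ j =
        - \sum_(j < n.+1) (k j (p + t%:C) - k j p) * w (p + t%:C) ^+ j.
      rewrite -[LHS]opprK; congr (- _).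
      have := kw (p + t%:C) (strip_real t (band_strip cd pb)).
      move=> e1; under [RHS]eq_bigr do rewrite mulrBl.
      by rewrite [RHS]sumrB e1 sub0r.
    rewrite cabsN; apply: le_trans (cabs_sum _ _ _) _.
    apply: (@le_trans _ _ (\sum_(j < n.+1) kap * q / 2 / S * B ^+ j)).
      apply: ler_sum => j _; rewrite cabsM cabsX ler_pM ?cabs_ge0 ?exprn_ge0 ?cabs_ge0 //.
        by apply: hmu.
      rewrite lerXn2r ?nnegrE ?cabs_ge0 //; first lra.
      by apply: hB; apply: band_real; exact: bsub.
    by rewrite -mulr_sumr divfK // gt_eqF.
  have := he0 (k^~ p) (w (p + t%:C)) (w p) (kap * q / 2).
  move=> /(_ (fun j jn => hA j p jn pb) (hB _ (band_real t (bsub p pb))) (hB _ (bsub p pb)) qp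
      (kw p (band_strip cd pb)) ks (smallx p pb px)).
  move/le_trans; apply; rewrite (_ : 2 / q * (kap * q / 2) = kap) //.
  by field; rewrite gt_eqF.
have yb : band c d y by have [] := inbox y; rewrite ?subrr ?cabs0 ?(ltW rho0).
apply: (hkap (fun p => w (p + t%:C) - w p) _ y z yb zb) => //.
- move=> p pb; have pb' : band (c - r) (d + r) p by apply: band_sub pb; lra.
  have pS := band_strip rcd pb'; split.
    apply: holoB; last exact: wh.
    apply: (holo_comp (f := w) (g := fun p => p + t%:C)).
      by apply: holoD; [exact: holo_id | exact: holo_cst].
    by apply: wh; exact: strip_real.
  apply: le_trans (cabsB _ _) _; have := hB _ pb'; have := hB _ (band_real t pb'); lra.
- apply: le_trans hN; apply: le_trans (cabs_le_ReIm _) _.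
  rewrite ReB ImB; move: yRe zx zb yIm; rewrite /band /= !ler_norml.
  move=> /andP[k1 k2] /andP[l1 l2] /andP[m1 m2] /andP[n1 n2].
  have p1 : `|complex.Re z - complex.Re y| <= 4 * (d - c).
    by rewrite ler_norml; apply/andP; split; move: k1 k2; rewrite /h; lra.
  have p2 : `|complex.Im z - complex.Im y| <= 4 * (d - c).
    by rewrite ler_norml; apply/andP; split; move: n1 n2; rewrite /h; lra.
  lra.
- by rewrite /disc /= subrr cabs0 ltW.
Qed.

(** The wider box in the hypothesis contains the neighbouring boxes, so smallness
    spreads along the whole band. *)
Lemma translate_spread (w : R[i] -> R[i]) c d (e0 eta : R) t (x0 : R) : c < d -> eta <= e0 ->
  (forall x : R,
    (forall z, band c d z -> `|complex.Re z - x| <= d - c -> cabs (w (z + t%:C) - w z) <= e0) ->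
    forall z, band c d z -> `|complex.Re z - x| <= 2 * (d - c) ->
      cabs (w (z + t%:C) - w z) <= eta) ->
  (forall z, band c d z -> `|complex.Re z - x0| <= d - c -> cabs (w (z + t%:C) - w z) <= e0) ->
  forall z, band c d z -> cabs (w (z + t%:C) - w z) <= eta.
Proof.
move=> cd ee gap P0 z zb.
have dc : 0 < d - c by rewrite subr_gt0.
pose P (x : R) := forall z, band c d z -> `|complex.Re z - x| <= d - c ->
  cabs (w (z + t%:C) - w z) <= e0.
have step (x x' : R) : `|x' - x| <= d - c -> P x -> P x'.
  move=> xx Px y yb yx; apply: le_trans ee; apply: (gap x Px y yb).
  have := ler_normD (complex.Re y - x') (x' - x); rewrite addrA subrK; lra.
have far N (x : R) : `|x - x0| <= N%:R * (d - c) -> P x.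
  elim: N x => [|N IH] x hx.
    have -> : x = x0.
      by apply/eqP; rewrite -subr_eq0 -normr_eq0 eq_le normr_ge0 andbT; move: hx; rewrite mul0r.
    exact: P0.
  pose x' := x0 + (x - x0) * (N%:R / N.+1%:R).
  have N0 : 0 < N.+1%:R :> R by rewrite ltr0n.
  have e1 : x - x' = (x - x0) / N.+1%:R.
    by rewrite /x' -natr1; field; rewrite natr1 gt_eqF.
  apply: (step x').
    rewrite e1 normrM (@gtr0_norm _ N.+1%:R^-1) ?invr_gt0 // ler_pdivrMr //.
    by rewrite mulrC.
  apply: IH; rewrite /x' addrC addKr normrM (@ger0_norm _ (N%:R / N.+1%:R)) ?divr_ge0 //.
  rewrite mulrA ler_pdivrMr //; move: hx; move: (`|x - x0|) => X hx.
  have : X * N%:R <= N.+1%:R * (d - c) * N%:R by rewrite ler_wpM2r.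
  by congr (_ <= _); ring.
have [N hN] := nat_ub (`|complex.Re z - x0| / (d - c)).
rewrite ler_pdivrMr // in hN.
apply: (gap (complex.Re z) (far N _ hN) z zb); rewrite subrr normr0; lra.
Qed.

(** Among sufficiently many multiples of [t] two give nearly the same translate
    of [w] on a box, by total boundedness. *)
Lemma translate_pigeonhole a b w c d e : hbounded a b w -> inner a b c d -> c < d -> 0 < e ->
  exists N : nat, forall t, exists i j : nat, [/\ (i < j)%N, (j <= N)%N &
    forall z, band c d z -> `|complex.Re z| <= d - c ->
      cabs (w (z + (j%:R * t)%:C) - w (z + (i%:R * t)%:C)) <= e].
Proof.
move=> whb cd lt_cd e0; have [wh wB] := whb.
have [B B0 hB] := wB _ _ cd.
have [_ [L [_ L0 wL]]] := hbounded_lipschitz whb cd.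
pose box : set R[i] := [set z | band c d z /\ `|complex.Re z| <= d - c].
pose z0 : R[i] := 0 +i* c.
have z0box : box z0 by rewrite /box /band /= normr0 lexx; split; lra.
pose F z (_ : 'I_1) := if `[< box z >] then z else z0.
have Fbox z i : box (F z i) by rewrite /F; case: asboolP.
have e4 : 0 < e / 4 / L by rewrite !divr_gt0.
have [|ts hts] := @finite_net R R[i] 'I_1 F (d - c + (`|c| + `|d|)) (e / 4 / L) _ e4.
  move=> z i; have [/andP[h1 h2] h3] := Fbox z i; apply: le_trans (cabs_le_ReIm _) _.
  apply: lerD => //; rewrite ler_norml; have := ler_norm (- c); have := ler_norm d.
  have := ler_norm (- d); have := ler_norm c; rewrite !normrN => *.
  by apply/andP; split; have := normr_ge0 c; have := normr_ge0 d; lra.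
pose G t (i : 'I_(size ts)) := w (F (nth 0 ts i) ord0 + t%:C).
have e40 : 0 < e / 4 by rewrite divr_gt0.
have [|us hus] := @finite_net R R 'I_(size ts) G B (e / 4) _ e40.
  by move=> t i; apply: hB; apply: band_real; have [] := Fbox (nth 0 ts i) ord0.
exists (size us) => t.
have [u hu] := choice (fun m : nat => let: ex_intro2 s h1 h2 := hus (m%:R * t) in
  ex_intro (fun s => s \in us /\ forall i, cabs (G (m%:R * t) i - G s i) <= e / 4) s (conj h1 h2)).
have : ~~ uniq [seq u m | m <- iota 0 (size us).+1].
  apply/negP => un.
  have sub : {subset [seq u m | m <- iota 0 (size us).+1] <= us}.
    by move=> s /mapP [m _ ->]; have [] := hu m.
  by have := uniq_leq_size un sub; rewrite size_map size_iota ltnn.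
move=> /(uniqPn 0) [i [j [ij]]]; rewrite size_map size_iota => jn.
have iN := ltn_trans ij jn.
rewrite !(nth_map 0%N) ?size_iota // !nth_iota // !add0n => uij.
exists i, j; split => // z zb zx.
have [s sts hs] := hts z.
have il : (index s ts < size ts)%N by rewrite index_mem.
pose p := F s ord0; have pbox : box p by exact: Fbox.
have zp : cabs (z - p) <= e / 4 / L.
  have := hs ord0; rewrite -/p /F; case: asboolP => // nb.
  by exfalso; apply: nb.
have GE m : G m (Ordinal il) = w (p + m%:C) by rewrite /G /= nth_index.
have h1 := (hu i).2 (Ordinal il); have h2 := (hu j).2 (Ordinal il).
rewrite !GE in h1 h2; rewrite -uij in h2.
have near m : cabs (w (z + m%:C) - w (p + m%:C)) <= e / 4.
  apply: le_trans (wL _ _ (band_real m zb) (band_real m pbox.1)) _.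
  rewrite (_ : z + m%:C - (p + m%:C) = z - p); last ring.
  by rewrite mulrC -ler_pdivlMr.
have n1 := near (i%:R * t); have n2 := near (j%:R * t).
set wi := w (z + (i%:R * t)%:C) in n1 *; set wj := w (z + (j%:R * t)%:C) in n2 *.
set pi0 := w (p + _) in n1 h1; set pj0 := w (p + _) in n2 h2.
set q := w (p + (u i)%:C) in h1 h2.
have := cabs_trans pj0 wj wi; have := cabs_trans q pj0 wi; have := cabs_trans pi0 q wi.
rewrite (cabsBC q pi0) (cabsBC pi0 wi); lra.
Qed.

(** Small multiples of [t] almost translate [w] into itself, hence so does
    [N! t]: the Bohr set of the coefficients, shrunk by [N!] in frequency,
    consists of almost periods of [w]. *)
Lemma root_bohr a b w n k f c d e : hbounded a b w -> annihilates a b w n k ->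
  ap a b f -> (exists2 z, strip a b z & f z != 0) ->
  inner a b c d -> c < d ->
  (exists2 K : R, 0 < K & forall z, band c d z ->
     cabs (f z) <= K * cabs (diff_quot n (k^~ z) (w z) (w z))) -> 0 < e ->
  exists mu dl, 0 < dl /\ forall t, bohr mu dl t -> forall z, band c d z ->
    cabs (w (z + t%:C) - w z) <= e.
Proof.
move=> whb kw fa fz cd lt_cd fK e0.
have [e1 e10 gap] := translate_gap whb kw fa fz cd lt_cd fK.
have [N hN] := translate_pigeonhole whb cd lt_cd e10.
have NF : 0 < N`!%:R :> R by rewrite ltr0n fact_gt0.
(* [N! t] is reached from [k t] in at most [N!] steps *)
pose eta := Num.min e1 (e / N`!%:R).
have eta0 : 0 < eta by rewrite lt_min e10 divr_gt0.
have etae : eta <= e1 by rewrite ge_min lexx.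
have etaN : N`!%:R * eta <= e by rewrite mulrC -ler_pdivlMr // ge_min lexx orbT.
have [mu [dl [dl0 hmu]]] := gap eta eta0.
have N10 : 0 < N.+1%:R :> R by rewrite ltr0n.
exists [seq l / N`!%:R | l <- mu], (dl / N.+1%:R); split; first by rewrite divr_gt0.
move=> t1 bt1; pose t := t1 / N`!%:R.
have t1E : t1 = N`!%:R * t by rewrite /t mulrC divfK // gt_eqF.
have bt : bohr mu (dl / N.+1%:R) t.
  by apply: (bohr_div (k := N`!%:R)); [rewrite gt_eqF | rewrite -t1E].
have [i [j [ij jN hij]]] := hN t.
pose m := (j - i)%N.
have m0 : (0 < m)%N by rewrite subn_gt0.
have mN : (m <= N)%N by apply: leq_trans jN; exact: leq_subr.
have ijE : (m%:R * t : R) = j%:R * t - i%:R * t by rewrite /m natrB ?(ltnW ij) // mulrBl.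
have bm : bohr mu dl (m%:R * t).
  apply: bohr_sub (bohr_mul m bt) => //; rewrite mulrA ler_pdivrMr // mulrC ler_pM2l //.
  by rewrite ler_nat leqW.
have small z : band c d z -> cabs (w (z + (m%:R * t)%:C) - w z) <= eta.
  apply: (@translate_spread w c d e1 eta (m%:R * t) (i%:R * t)) => //; first exact: hmu.
  move=> y yb yx; have yb' : band c d (y + (- (i%:R * t))%:C) by exact: band_real.
  have := hij _ yb'; rewrite ReD /= => /(_ yx).
  congr (cabs (w _ - w _) <= _).
    by rewrite -addrA -rmorphD /= ijE addrC [- _ + _]addrC addrC.
  by rewrite -addrA -rmorphD /= addNr addr0.
have /dvdnP [q qE] : (m %| N`!)%N by apply: dvdn_fact; rewrite m0.
have mult p z : band c d z -> cabs (w (z + (p%:R * (m%:R * t))%:C) - w z) <= p%:R * eta.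
  move=> zb; elim: p => [|p IH]; first by rewrite !mul0r addr0 subrr cabs0.
  apply: le_trans (cabs_trans (w (z + (p%:R * (m%:R * t))%:C)) _ _) _.
  have -> : p.+1%:R * eta = eta + p%:R * eta by rewrite -natr1; ring.
  apply: lerD => //.
  have -> : z + (p.+1%:R * (m%:R * t))%:C = z + (p%:R * (m%:R * t))%:C + (m%:R * t)%:C.
    by rewrite -addrA -rmorphD /= -natr1; congr (_ + _%:C); ring.
  by apply: small; exact: band_real.
move=> z zb; have := mult q z zb.
have -> : q%:R * (m%:R * t) = t1 by rewrite t1E mulrA -natrM -qE.
move/le_trans; apply; apply: le_trans etaN; rewrite ler_pM2r // ler_nat qE.
by rewrite leq_pmulr.
Qed.

Lemma root_ap a b w n k : annihilates a b w n k ->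
  (forall z, strip a b z -> cont_at (strip a b) w z) -> ap a b w.
Proof.
move=> kw0 wc.
have exN : exists n, `[< exists k, annihilates a b w n k >].
  by exists n; apply/asboolP; exists k.
have [N /asboolP [k1 kw] Nmin] := ex_minnP exN.
move: kw0 => _; move: {k} k1 kw; case: N Nmin => [|{}n] Nmin k kw.
  have [_ [z zS kz] kE] := kw; exfalso; move/eqP: kz; apply.
  by have := kE z zS; rewrite big_ord_recl big_ord0 addr0 expr0 mulr1.
have nodown k' : ~ annihilates a b w n k'.
  move=> h; have : (n.+1 <= n)%N by apply: Nmin; apply/asboolP; exists k'.
  by rewrite ltnn.
have [WB [f [fa fz fK]]] := simplicity_certificate kw nodown wc.
have wh : forall z, strip a b z -> holo w z.
  apply: (root_holo kw wc fa fz) => z zS fz0.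
  have [K K0 hK] := fK _ _ (strip_inner zS).
  apply: contra fz0 => /eqP Q0; have := hK z (band_Im z); rewrite Q0 cabs0 mulr0 => h.
  by apply/eqP/cabs_eq0/eqP; rewrite eq_le h cabs_ge0.
have [ka kz _] := kw.
have whb : hbounded a b w by exact: quotient_bounded (ka n.+1) kz wh WB.
move=> c d cd e e0.
have [s s0 scd] := inner_enlarge cd.
have [dc|cd1] := ltP (d + s) (c - s).
  exists (fun z => \sum_(p <- [::] : seq (R[i] * R)) p.1 * cis p.2 z).
    exact: exp_sums_cis.
  by move=> z /andP[z1 z2]; lra.
have [s' s'0 scd'] := inner_enlarge scd.
have e2 : 0 < e / 2 by rewrite divr_gt0.
have [|mu [dl [dl0 hmu]]] := @root_bohr a b w n.+1 k f (c - s - s') (d + s + s') (e / 2)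
   whb kw fa fz scd' _ (fK _ _ scd') e2; first by lra.
have [//|//|//|u [phi [_ _ up]]] := @bohr_approximation R a b w _ _ mu dl (e / 2) (fun=> True)
   whb scd' e2 dl0 hmu.
exists (fun z => \sum_(p <- [seq (p.1 * phi p.2, - p.2) | p <- u]) p.1 * cis p.2 z).
  exact: exp_sums_cis.
move=> z zb; rewrite big_map /=; apply: le_trans (up z _) _; last lra.
by apply: band_sub zb; lra.
Qed.

Lemma annihilates_leading a b w (k : nat -> R[i] -> R[i]) m : (forall j, ap a b (k j)) ->
  (exists2 j, (j <= m)%N & exists2 z, strip a b z & k j z != 0) ->
  (forall z, strip a b z -> \sum_(j < m.+1) k j z * w z ^+ j = 0) ->
  exists n, annihilates a b w n k.
Proof.
move=> ka; elim: m => [|m IH] [j jm [z zS kz]] kw.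
  by exists 0%N; split => //; exists z => //; move: jm kz; rewrite leqn0 => /eqP ->.
have [km|km] := pselect (exists2 z, strip a b z & k m.+1 z != 0); first by exists m.+1.
have km0 y : strip a b y -> k m.+1 y = 0.
  by move=> yS; apply/eqP; apply: contrapT => /negP h; apply: km; exists y.
apply: IH => [|y yS]; last first.
  by have := kw y yS; rewrite big_ord_recr /= km0 // mul0r addr0.
exists j; last by exists z.
rewrite -ltnS ltn_neqAle jm andbT; apply: contra kz => /eqP ->.
by rewrite km0.
Qed.

Lemma within_continuous_cont_at a b w : {within strip a b, continuous w} ->
  forall z, strip a b z -> cont_at (strip a b) w z.
Proof.
move=> /subspace_continuousP wc z zS e e0.
have eC : 0 < e%:C :> R[i] by rewrite ltcR.
have := wc z zS _ (nbhsx_ballx (w z) e%:C eC).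
rewrite /= nbhs_simpl /= /within /= => /nbhs_ballP [r /= r0 hr].
have [r' r'0 rr'] : exists2 r' : R, 0 < r' & r = r'%:C.
  by move: r0; case: (r) => x y; rewrite ltcE /= => /andP[/eqP -> x0]; exists x.
exists r' => // y yS yz; have := hr y; rewrite -!ball_normE /= !cabsE rr' !ltcR.
by rewrite (cabsBC z) => /(_ yz yS); rewrite cabsBC.
Qed.

End Translates.

Unset Implicit Arguments.

Theorem theorem1 (R : realType) (a b : \bar R) (hab : (a < b)%E)
    (m : nat) (hm : (1 <= m)%N)
    (coef : 'I_m.+1 -> R[i] -> R[i])
    (hcoef : forall k : 'I_m.+1, AP a b (coef k))
    (hnontrivial : exists (k : 'I_m.+1) (z : R[i]), strip a b z /\ coef k z <> 0)
    (w : R[i] -> R[i])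
    (hw : {within strip a b, continuous w})
    (heq : forall z : R[i], strip a b z ->
             \sum_(k < m.+1) coef k z * w z ^+ k = 0) :
  AP a b w.
Proof.
have coefa j : ap a b (coef j) by apply/(AP_iff_ap _ hab).
pose k (j : nat) (z : R[i]) : R[i] := if insub j : option 'I_m.+1 is Some i then coef i z else 0.
have kE (j : 'I_m.+1) z : k j z = coef j z by rewrite /k valK.
apply/(AP_iff_ap _ hab).
have wc := within_continuous_cont_at hw.
have [|||n kw] := @annihilates_leading R a b w k m.
- by move=> j; rewrite /k; case: insubP => [i _ _|_]; [exact: coefa | exact: ap_cst].
- have [i0 [z [zS cz]]] := hnontrivial.
  exists i0; first by rewrite -ltnS.
  by exists z => //; rewrite kE; apply/eqP.
- move=> z zS; apply: etrans (heq z zS); apply: eq_bigr => j _.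
  by rewrite kE.
exact: root_ap kw wc.
Qed.
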